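(* Let $\mathbb{K}=\mathbb{R}$ or $\mathbb{C}$, let $U\subset\mathbb{K}^n$ be a domain, $f:U\to\mathbb{K}^{n+1}$ a front, and $p\in U$ a $k$-nondegenerate singular point ($1\le k\le n$). Then there exist a $\mathbb{K}$-differentiable coordinate system $(z_1,\dots,z_n)$ around $p$ and a (non-degenerate) $\mathbb{K}$-affine transformation $\Theta:\mathbb{K}^{n+1}\to\mathbb{K}^{n+1}$ such that $$\hat f(z_1,\dots,z_n)=(\hat f^1,\dots,\hat f^{n+1})=\Theta\circ f(z_1,\dots,z_n)$$ satisfies the following properties (with $\partial_{z_j}=\partial/\partial z_j$): (P$_0$) The point $p$ corresponds to $(z_1,\dots,z_n)=(0,\dots,0)$. (P$_1$) $\partial_{z_n}$ gives an extended null vector field on $U$ ($U$ being replaced by a smaller neighborhood of $p$ if necessary). (P$_2$) If $k\ge2$, then for $i=1,\dots,k-1$ the $\mathbb{K}$-vector space $T_pS_i$ is spanned by $\partial_{z_{i+1}},\dots,\partial_{z_n}$. (P$_3$) Suppose $k<n$. If $p$ is $(k+1)$-singular, then $T_pS_k=\mathrm{Span}_{\mathbb{K}}\{\partial_{z_{k+1}},\dots,\partial_{z_n}\}$. On the other hand, if $p$ is not $(k+1)$-singular, $T_pS_k=\mathrm{Span}_{\mathbb{K}}\{\partial_{z_k},\dots,\partial_{z_{n-1}}\}$. (P$_4$) $\hat f(p)=\boldsymbol 0$ and $\nu(p)=(1,0,\dots,0)$, where $\nu$ is the $\mathbb{K}$-normal vector field (of $\hat f$). (P$_5$) $\hat f(z_1,\dots,z_n)=(\hat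 f^1(z_1,\dots,z_n),\hat f^2(z_1,\dots,z_n),z_1,\dots,z_{n-1})$ for $n\ge2$, and $\hat f(z_1)=(\hat f^1(z_1),\hat f^2(z_1))$ for $n=1$. (P$_6$) If $n\ge2$, then $(\hat f^1)_{z_i}(p)=(\hat f^2)_{z_i}(p)=0$ for $i=1,\dots,n-1$.
   Context: $\mathbb{K}$-differentiable means $C^\infty$ if $\mathbb{K}=\mathbb{R}$ and holomorphic if $\mathbb{K}=\mathbb{C}$. $\langle X,Y\rangle=\sum_j x_jy_j$ is the $\mathbb{K}$-inner product on $\mathbb{K}^{n+1}$. Front: a $\mathbb{K}$-differentiable map $f:U\to\mathbb{K}^{n+1}$ on a domain $U\subset\mathbb{K}^n$ is a front if locally there is a $\mathbb{K}$-differentiable $\nu$ with values in $\mathbb{K}^{n+1}\setminus\{0\}$ (the $\mathbb{K}$-normal vector field) such that $\langle df(u),\nu\rangle=0$ for all $u\in TU$ and $(f,[\nu])$ is an immersion into $\mathbb{K}^{n+1}\times P^n(\mathbb{K})$. (If $\mathbb{K}=\mathbb{C}$, $\langle\nu,\nu\rangle$ might vanish.) Everything is local, so $\nu$ is assumed defined on $U$. A singular point is a point where the map in question is not an immersion; $S(\cdot)$ denotes the set of singular points. Function $\lambda$: $\lambda:=\det(f_{x_1},\dots,f_{x_n},\nu)$. A point $p$ is $1$-singular (or singular) if $\lambda(p)=0$, that is, $p$ is a singular point, and $1$-nondegenerate if moreover $d\lambda_p\ne0$. In that case, near $p$, $S_1:=S(f)=\{\lambda=0\}$ is an embedded hypersurface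 and $\ker df_q$ is one-dimensional for $q\in S_1$; a null vector field $\eta$ is a non-zero $\mathbb{K}$-differentiable vector field along $S_1$ with $df(\eta)=0$, and an extended null vector field $\tilde\eta$ is a $\mathbb{K}$-differentiable vector field on a neighborhood of $p$ whose restriction to $S_1$ is a null vector field. Put $\lambda^{(0)}=\lambda$, $\lambda^{(l)}=d\lambda^{(l-1)}(\tilde\eta)$. Inductive definition ($2\le j\le n$, $S_0:=U$): let $p$ be $(j-1)$-nondegenerate. After shrinking $U$, $S_{j-1}$ is an embedded hypersurface of $S_{j-2}$ around $p$. Let $f_{j-1}=f|_{S_{j-1}}$ and $S_j:=S(f_{j-1})$; one has $S_j=\{q\in S_{j-1}:\eta_q\in T_qS_{j-1}\}=\{q\in S_{j-1}:\lambda^{(j-1)}(q)=0\}$. Points of $S_j$ are called $j$-singular, and $q\in S_j$ is $j$-nondegenerate if $(d\lambda^{(j-1)})_q\ne0$ on $T_qS_{j-1}$. *)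

(* Defs.v *)
From HB Require Import structures.
From mathcomp Require Import all_boot all_order all_algebra.
From mathcomp Require Import complex.
From mathcomp Require Import all_classical all_reals all_analysis.

Set Implicit Arguments.
Unset Strict Implicit.
Unset Printing Implicit Defensive.
Import Order.TTheory GRing.Theory Num.Theory.
Import numFieldNormedType.Exports.

Local Open Scope classical_set_scope.
Local Open Scope ring_scope.

Variant scalar_kind := RealScalars | ComplexScalars.

Definition scalars (R : realType) (c : scalar_kind) : numFieldType :=
  if c is RealScalars then (R : numFieldType) else (R[i] : numFieldType).

(* Only used between finite-dimensional spaces, where continuity of
   [fun x => 'd f x v] for every [v] amounts to continuity of [fun x => 'd f x]. *)
Fixpoint Ck (K : numFieldType) (E F : normedModType K) (k : nat)
    (D : set E) (f : E -> F) : Prop :=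
  match k with
  | 0 => forall x, D x -> {for x, continuous f}
  | k'.+1 => (forall x, D x -> differentiable f x) /\
             (forall v, Ck k' D (fun x => 'd f x v))
  end.

(* For complex scalars, [differentiable] is complex Fréchet differentiability,
   which on an open set is holomorphy.  [D] is open in all uses. *)
Definition Kdifferentiable (R : realType) (c : scalar_kind)
    (E F : normedModType (scalars R c)) (D : set E) (f : E -> F) : Prop :=
  match c with
  | RealScalars => forall k, Ck k D f
  | ComplexScalars => forall x, D x -> differentiable f x
  end.

Section Fronts.
Context {R : realType} {c : scalar_kind}.
Local Notation K := (scalars R c).

Definition Kdot (m : nat) (X Y : 'rV[K]_m) : K := \sum_(j < m) X 0 j * Y 0 j.

(* The [j]-th standard basis vector, with [j] counted from 1. *)
Definition basis_vector (m j : nat) : 'rV[K]_m := \row_(i < m) (i.+1 == j)%:R.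

Definition is_domain (m : nat) (U : set 'rV[K]_m) : Prop :=
  [/\ open U, connected U & U !=set0].

Definition affine_transformation (m : nat) (T : 'rV[K]_m -> 'rV[K]_m) : Prop :=
  exists (A : 'M[K]_m) (b : 'rV[K]_m),
    A \in unitmx /\ T = (fun y => y *m A + b).

(* Velocities at [q] of K-differentiable curves (germs at 0) lying in [S]; this
   is the usual tangent space when [S] is an embedded submanifold near [q]. *)
Definition tangent_space (m : nat) (S : set 'rV[K]_m) (q : 'rV[K]_m)
    : set 'rV[K]_m :=
  [set v | exists (D : set K^o) (g : K^o -> 'rV[K]_m),
    [/\ open D, D 0, Kdifferentiable D g & forall t, D t -> S (g t)] /\
    g 0 = q /\ 'd g 0 (1 : K^o) = v].

Section FrontsIn.
Context {n : nat}.
Implicit Types (U V : set 'rV[K]_n) (f nu : 'rV[K]_n -> 'rV[K]_(n + 1)).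
Implicit Types (eta : 'rV[K]_n -> 'rV[K]_n) (p q : 'rV[K]_n).

(* The map [(f, [nu])] into K^(n+1) x P^n is an immersion at [q]: near [q],
   [[nu]] is read in the affine chart [y |-> y / y_i] of P^n, for each [i] such
   that this chart is defined at [[nu q]]. *)
Definition projective_immersion_at f nu q : Prop :=
  forall i, nu q 0 i != 0 ->
    injective ('d (fun x => row_mx (f x) ((nu x 0 i)^-1 *: nu x)) q).

Definition normal_field V f nu : Prop :=
  Kdifferentiable V nu /\
  (forall q, V q ->
    [/\ nu q != 0,
        forall u, Kdot ('d f q u) (nu q) = 0 &
        projective_immersion_at f nu q]).

Definition is_front U f : Prop :=
  Kdifferentiable U f /\
  (forall q, U q -> exists V nu,
    [/\ open V, V q, V `<=` U & normal_field V f nu]).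

(* [S_0 = U] and [S_j] is the set of singular points of the restriction of [f]
   to [S_(j-1)].  The definition is local: [S_j] near [q] only depends on
   [S_(j-1)] near [q], so that no shrinking of [U] is needed; it is meaningful
   around (j-1)-nondegenerate points. *)
Fixpoint singular_set U f (j : nat) : set 'rV[K]_n :=
  match j with
  | 0 => U
  | j'.+1 => [set q | singular_set U f j' q /\
      ~ set_inj (tangent_space (singular_set U f j') q) ('d f q)]
  end.

Definition extended_null_field U f V eta : Prop :=
  Kdifferentiable V eta /\
  (forall q, V q -> singular_set U f 1 q ->
    eta q != 0 /\ 'd f q (eta q) = 0).

(* The vectors f_(x_1), ..., f_(x_n), nu are the rows of the matrix. *)
Fixpoint lambda_ f nu eta (l : nat) : 'rV[K]_n -> K^o :=
  match l with
  | 0 => fun q => \det (col_mx ('J f q) (nu q))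
  | l'.+1 => fun q => 'd (lambda_ f nu eta l') q (eta q)
  end.

(* [nu] and [eta] are arbitrary local choices, of which the notion is
   independent; [eta] plays no role when [k = 1]. *)
Definition k_nondegenerate U f (k : nat) p : Prop :=
  exists V nu eta,
    [/\ open V, V p, V `<=` U & normal_field V f nu] /\
    ((1 < k)%N -> extended_null_field U f V eta) /\
    (forall j, (1 <= j <= k)%N ->
      singular_set U f j p /\
      exists2 v, tangent_space (singular_set U f j.-1) p v &
                 'd (lambda_ f nu eta j.-1) p v != 0).

(* [z] is a coordinate system on the neighborhood [V] of [p], and [x] is the
   inverse parametrization, defined on [z @` V]. *)
Definition coordinate_system V p (z x : 'rV[K]_n -> 'rV[K]_n) : Prop :=
  [/\ open V, V p & open (z @` V)] /\
  [/\ Kdifferentiable V z, Kdifferentiable (z @` V) x &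
      forall q, V q -> x (z q) = q].

(* The coordinate vector field d/dz_j, with [j] counted from 1. *)
Definition coordinate_field (z x : 'rV[K]_n -> 'rV[K]_n) (j : nat) q
    : 'rV[K]_n :=
  'd x (z q) (basis_vector n j).

(* The span at [q] of d/dz_a, ..., d/dz_b. *)
Definition coordinate_span (z x : 'rV[K]_n -> 'rV[K]_n) (a b : nat) q
    : set 'rV[K]_n :=
  [set v | v \in <<[seq coordinate_field z x j q | j <- index_iota a b.+1]>>%VS].

End FrontsIn.
End Fronts.

(* Main.v *)
(* By the identity [u_i0 * lambda = sum_j df(u)_j * kappa_j], with [kappa] a row of
   cofactors of (df; nu) and [u] a null vector at p, [d lambda <> 0] at p forces
   rank(df_p) = n - 1 and <nu, nu> <> 0 at p (also for complex scalars).  Hence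
   near p the singular points are the zeros of lambda and the null vectors form
   lines; by induction S_j = {lambda^(0) = ... = lambda^(j-1) = 0}, and the implicit
   function theorem gives T S_j as the common kernel of the differentials of
   lambda^(l), l < j, which are independent because p is j-nondegenerate.
   At p, with null vector eta, these covectors kill eta for l < k-1, so they are
   of the form df_p . alpha_l (the image of the transpose of df_p is the
   annihilator of eta), and so is the last one exactly when p is (k+1)-singular.
   Completing them to a basis of the annihilator of eta, adding a covector [b]
   with b(eta) = 1 (proportional to d lambda^(k-1) when p is not (k+1)-singular),
   the affine map Theta has linear part (nu_p, c, alpha_0, alpha_1, ...), and the
   coordinates are the last n-1 components of Theta o f together with [b].
   The analytic input is the inverse function theorem over a complete archimedean
   normed field, and the smoothness of complex differentiable maps, which rests on
   Goursat's lemma for squares. *)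
Require Import Defs.
From HB Require Import structures.
From mathcomp Require Import all_boot all_order all_algebra.
From mathcomp Require Import complex.
From mathcomp Require Import all_classical all_reals all_analysis.
From mathcomp Require Import ring.

Set Implicit Arguments.
Unset Strict Implicit.
Unset Printing Implicit Defensive.
Import Order.TTheory GRing.Theory Num.Theory.
Import numFieldNormedType.Exports.

Local Open Scope classical_set_scope.
Local Open Scope ring_scope.

(** The order on complex scalars is only partial, so compactness and the order of the line are
    replaced by bisection over an abstract [numFieldType]: a bound that is additive under halving
    and fails somewhere fails on a shrinking sequence of pieces, and continuity or differentiability
    at their limit refutes it. Complex [Kdifferentiable] asks for no continuity of the derivative,
    whereas the inverse function theorem does; closing this gap takes Goursat's lemma and a mean
    value formula. That formula divides by the contour integral of dw/w, which only has to be
    non-zero, so neither pi nor the exponential occurs. Since [tangent_space] is defined by curves,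
    its inclusion in the kernel of the differentials is the chain rule, while the converse needs
    actual curves; they are straight lines read in a straightening chart. The chart also yields
    (P_1) at every nearby singular point, not only at p: its first n-1 coordinates are affine in f,
    so any null vector w has dz(w) proportional to the last basis vector. *)

(** * Limits, completeness and bisection over real or complex scalars *)

Section Sequences.
Context {K : numFieldType}.
Implicit Types V W : normedModType K.

Definition seq_lim V (u : nat -> V) (l : V) : Prop :=
  forall e : K, 0 < e -> exists N, forall m, (N <= m)%N -> `|u m - l| < e.

Definition cauchy_seq V (u : nat -> V) : Prop :=
  forall e : K, 0 < e -> exists N, forall m p, (N <= m)%N -> (N <= p)%N ->
    `|u m - u p| < e.

Definition seq_complete V : Prop :=
  forall u : nat -> V, cauchy_seq u -> exists l, seq_lim u l.

(** Powers of 1/2 are the sizes produced by repeated halving; a positive complex [e] is a positive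
    real. *)
Definition archimedean_scalars : Prop :=
  forall e : K, 0 < e -> exists m, 2^-1 ^+ m < e.

Lemma half_half (x : K) : x / 2 + x / 2 = x.
Proof. by rewrite -splitr. Qed.

Lemma half_gt0 (x : K) : 0 < x -> 0 < x / 2.
Proof. by move=> x0; rewrite divr_gt0. Qed.

Lemma le_of_le_add (x y : K) : (forall e, 0 < e -> x <= y + e) -> x <= y.
Proof. by move=> H; apply/ler_addgt0Pr. Qed.

Lemma seq_lim_unique V (u : nat -> V) l l' : seq_lim u l -> seq_lim u l' -> l = l'.
Proof.
move=> ul ul'; apply/eqP; rewrite -subr_eq0 -normr_eq0 eq_le normr_ge0 andbT.
apply: le_of_le_add => e e0; rewrite add0r.
have [N HN] := ul _ (half_gt0 e0); have [N' HN'] := ul' _ (half_gt0 e0).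
rewrite (le_trans (ler_distD (u (maxn N N')) _ _)) // -(half_half e) lerD // ltW //.
  by rewrite distrC HN // leq_maxl.
by rewrite HN' // leq_maxr.
Qed.

Lemma seq_lim_le V (u : nat -> V) l a (M : K) :
  seq_lim u l -> (forall m, `|u m - a| <= M) -> `|l - a| <= M.
Proof.
move=> ul H; apply: le_of_le_add => e e0; have [N HN] := ul _ e0.
by rewrite (le_trans (ler_distD (u N) _ _)) // addrC lerD // distrC ltW // HN.
Qed.

Lemma seq_lim_shift V (u : nat -> V) l : seq_lim u l -> seq_lim (u \o succn) l.
Proof.
by move=> ul e /ul[N HN]; exists N => m Nm; apply: HN; apply: leqW.
Qed.

Lemma seq_limD V (u v : nat -> V) l l' :
  seq_lim u l -> seq_lim v l' -> seq_lim (fun m => u m + v m) (l + l').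
Proof.
move=> ul vl e e0; have [N HN] := ul _ (half_gt0 e0).
have [N' HN'] := vl _ (half_gt0 e0); exists (maxn N N') => m.
rewrite geq_max => /andP[Nm N'm].
rewrite opprD addrACA (le_lt_trans (ler_normD _ _)) // -(half_half e) ltrD //.
  exact: HN.
exact: HN'.
Qed.

Lemma seq_limZ V (u : nat -> V) l (a : K) :
  seq_lim u l -> seq_lim (fun m => a *: u m) (a *: l).
Proof.
move=> ul e e0; have a0 : 0 < `|a| + 1 by rewrite ltr_wpDl.
have [N HN] := ul _ (divr_gt0 e0 a0); exists N => m Nm.
rewrite -scalerBr normrZ (@le_lt_trans _ _ ((`|a| + 1) * `|u m - l|)) //.
  by rewrite ler_wpM2r // lerDl.
by rewrite mulrC -ltr_pdivlMr // HN.
Qed.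

Lemma half_pow_eventually : archimedean_scalars -> forall (C e : K), 0 <= C -> 0 < e ->
  exists N, forall m, (N <= m)%N -> C * 2^-1 ^+ m < e.
Proof.
move=> Harch C e C0 e0; have C1 : 0 < C + 1 by rewrite ltr_wpDl.
have [N HN] := Harch _ (divr_gt0 e0 C1); exists N => m Nm.
rewrite (@le_lt_trans _ _ ((C + 1) * 2^-1 ^+ N)) //; last first.
  by rewrite mulrC -ltr_pdivlMr.
apply: ler_pM => //; first by rewrite lerDl.
by rewrite ler_wiXn2l // invf_le1 // ler1n.
Qed.

Lemma geometric_lim V : archimedean_scalars -> seq_complete V ->
  forall (u : nat -> V) (C : K), 0 <= C ->
  (forall k, `|u k.+1 - u k| <= C * 2^-1 ^+ k.+1) ->
  exists l, seq_lim u l /\ forall k, `|l - u k| <= C * 2^-1 ^+ k.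
Proof.
move=> Harch Hc u C C0 Hu.
(* The difference on the right is the telescoped geometric sum; the induction needs it in place of
   the weaker bound [C * 2^-1 ^+ k]. *)
have step k p : `|u (k + p)%N - u k| <= C * 2^-1 ^+ k - C * 2^-1 ^+ (k + p).
  elim: p => [|p IH]; first by rewrite addn0 !subrr normr0.
  rewrite addnS.
  rewrite (le_trans (ler_distD (u (k + p)%N) _ _)) // (le_trans (lerD (Hu _) IH)) //.
  rewrite [leLHS]addrCA lerD2l exprSr mulrA -[X in _ - X](half_half (C * 2^-1 ^+ (k + p))).
  by rewrite opprD addrA subrr add0r.
have bnd k p : `|u (k + p)%N - u k| <= C * 2^-1 ^+ k.
  by rewrite (le_trans (step k p)) // gerBl mulr_ge0 // exprn_ge0.
have [l ul] : exists l, seq_lim u l.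
  apply: Hc => e e0; have [N HN] := half_pow_eventually Harch C0 (half_gt0 e0).
  exists N => m p Nm Np.
  rewrite (le_lt_trans (ler_distD (u N) _ _)) // -(half_half e) ltrD //.
    by rewrite (le_lt_trans _ (HN N _)) // -(subnKC Nm) bnd.
  by rewrite distrC (le_lt_trans _ (HN N _)) // -(subnKC Np) bnd.
exists l; split=> // k; apply: (@seq_lim_le _ (fun m => u (k + m)%N)) => //.
move=> e /ul[N HN]; exists N => m Nm; apply: HN.
by rewrite (leq_trans Nm) // leq_addl.
Qed.

(** Dependent choice follows pieces on which [P] fails; their centres move by at most half the
    radius, so they converge geometrically. The type [T] of pieces is abstract so that the same
    lemma serves dyadic subsegments of a normed space, scalar segments and squares. *)
Lemma bisection V (T : Type) (pos : T -> V) (rad : T -> K) (P : T -> Prop)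
    (child : T -> T -> Prop) (x0 : T) :
  archimedean_scalars -> seq_complete V -> 0 <= rad x0 ->
  (forall x, ~ P x -> exists2 y, child x y & ~ P y) ->
  (forall x y, child x y -> `|pos y - pos x| <= rad x / 2 /\ rad y = rad x / 2) ->
  ~ P x0 ->
  exists (u : nat -> T) (l : V),
    [/\ u 0%N = x0, forall k, child (u k) (u k.+1), forall k, ~ P (u k),
        forall k, rad (u k) = rad x0 * 2^-1 ^+ k &
        forall k, `|l - pos (u k)| <= rad (u k)].
Proof.
move=> Harch Hc r0 Hstep Hchild Px0.
have nextP (x : {x : T | ~ P x}) : exists y : {x : T | ~ P x}, child (sval x) (sval y).
  by have [y cy Py] := Hstep _ (svalP x); exists (exist _ y Py).
pose next x := projT1 (cid (nextP x)).
have nextE x : child (sval x) (sval (next x)) by rewrite /next; case: cid.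
pose v k := iter k next (exist _ x0 Px0); pose u k := sval (v k).
have cu k : child (u k) (u k.+1) by rewrite /u /=; apply: nextE.
have radu k : rad (u k) = rad x0 * 2^-1 ^+ k.
  elim: k => [|k IH]; first by rewrite mulr1.
  by rewrite (Hchild _ _ (cu k)).2 IH exprSr mulrA.
have [|l [_ Hl]] := geometric_lim (u := pos \o u) Harch Hc r0.
  by move=> k; rewrite exprSr mulrA -radu; have [] := Hchild _ _ (cu k).
exists u, l; split=> // [k|k]; first exact: (svalP (v k)).
by rewrite radu; exact: Hl.
Qed.

End Sequences.

Arguments archimedean_scalars K : clear implicits.

Lemma norm_coord_le (K : numFieldType) n (v : 'rV[K]_n) j : `|v 0 j| <= `|v|.
Proof.
have [x0|] := eqVneq (mx_norm v) 0; first by rewrite (mx_norm_eq0 x0) mxE normr0.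
move=> _; rewrite [leRHS]mx_normE -[leLHS]nngE num_le.
by rewrite (le_bigmax _ (fun i : 'I_1 * 'I_n => `|v i.1 i.2|%:nng) (0, j)).
Qed.

Lemma seq_complete_row (K : numFieldType) (n : nat) :
  seq_complete K^o -> seq_complete 'rV[K]_n.
Proof.
move=> HK u Hu.
have /choice[l Hl] : forall j : 'I_n, exists l : K^o, seq_lim (fun m => u m 0 j : K^o) l.
  move=> j; apply: HK => e /Hu[N HN]; exists N => m p Nm Np.
  by rewrite (le_lt_trans _ (HN m p Nm Np)) // (le_trans _ (norm_coord_le _ j)) // !mxE.
exists (\row_j l j) => e e0.
have /choice[N HN] : forall j : 'I_n, exists N, forall m, (N <= m)%N ->
    `|u m 0 j - l j| < e by move=> j; apply: Hl.
exists (\max_j N j)%N => m Nm.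
have [x0|/mx_norm_neq0[[i j] /= E]] := eqVneq (mx_norm (u m - \row_j l j)) 0.
  by rewrite /Num.norm /= x0.
rewrite /Num.norm /= E !mxE (ord1 i) HN // (leq_trans _ Nm) //.
exact: (leq_bigmax j).
Qed.

Section RealComplexScalars.
Variable R : realType.

Lemma archimedean_real : archimedean_scalars R.
Proof.
move=> e e0.
have /cvgrPdist_lt/(_ e e0)[N _ HN] : (GRing.exp (2^-1 : R)) @ \oo --> (0 : R).
  by apply: cvg_expr; rewrite ger0_norm // invf_lt1 // ltr1n.
by exists N; have := HN N (leqnn N); rewrite /= sub0r normrN ger0_norm.
Qed.

Lemma archimedean_complex : archimedean_scalars (R[i] : numFieldType).
Proof.
move=> e; rewrite ltcE => /= /andP[/eqP Im0 Re0].
have [m Hm] := archimedean_real Re0; exists m.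
have -> : (2^-1 ^+ m : R[i]) = (2^-1 ^+ m)%:C%C by rewrite rmorphXn /= fmorphV rmorph_nat.
by rewrite ltcE /= Im0 eqxx.
Qed.

Lemma seq_complete_real : seq_complete (R : numFieldType)^o.
Proof.
move=> u Hu.
have /cvg_ex[l Hl] : cvg (u @ \oo).
  apply: R_complete; apply: cauchy_exP => e e0.
  have [N HN] := Hu _ e0; exists (u N); exists N => // m Nm /=.
  exact: HN.
exists l => e e0; move/cvgrPdist_lt: Hl => /(_ e e0)[N _ HN].
by exists N => m Nm; rewrite distrC; apply: HN.
Qed.

Lemma normC_real (x : R) : `|x%:C%C| = `|x|%:C%C.
Proof. by rewrite normc_def /= expr0n addr0 sqrtr_sqr. Qed.

Lemma seq_complete_complex : seq_complete (R[i] : numFieldType)^o.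
Proof.
move=> u Hu.
have norm_i : `|'i%C| = 1 :> R[i] by rewrite normc_def /= expr0n expr1n add0r sqrtr1.
have Im_le (z : R[i]) : `|complex.Im z|%:C%C <= `|z|.
  by have := normc_ge_Re (z * 'i%C); rewrite ReiNIm normrN normrM norm_i mulr1.
have cplx (g : R[i] -> R) : (forall z w, g (z - w) = g z - g w) ->
    (forall z, `|g z|%:C%C <= `|z|) ->
    exists l, seq_lim (fun m => g (u m) : (R : numFieldType)^o) l.
  move=> gB gle; apply: seq_complete_real => e e0.
  have e0' : 0 < e%:C%C by rewrite ltcR.
  have [N HN] := Hu _ e0'; exists N => m p Nm Np.
  by rewrite -ltcR -gB (le_lt_trans (gle _)) // HN.
have [a Ha] := cplx (@complex.Re R) (raddfB _) (@normc_ge_Re R).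
have [b Hb] := cplx (@complex.Im R) (raddfB _) Im_le.
exists (a +i* b)%C => e; rewrite ltcE /= => /andP[/eqP Im0 Re0].
have [N HN] := Ha _ (half_gt0 Re0); have [N' HN'] := Hb _ (half_gt0 Re0).
exists (maxn N N') => m; rewrite geq_max => /andP[Nm N'm].
have -> : e = ((complex.Re e)%:C)%C by rewrite [LHS]complexE Im0 mulr0 addr0.
rewrite [u m - _]complexE (le_lt_trans (ler_normD _ _)) // normrM norm_i mul1r.
rewrite !normC_real -rmorphD ltcR -(half_half (complex.Re e)) ltrD //.
  have -> : complex.Re (u m - (a +i* b)%C) = complex.Re (u m) - a.
    by case: (u m).
  exact: HN.
have -> : complex.Im (u m - (a +i* b)%C) = complex.Im (u m) - b.
  by case: (u m).
exact: HN'.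
Qed.

End RealComplexScalars.

Lemma archimedean_scalarsP (R : realType) (c : scalar_kind) :
  archimedean_scalars (scalars R c).
Proof. by case: c; [apply: archimedean_real | apply: archimedean_complex]. Qed.

Lemma seq_complete_scalars (R : realType) (c : scalar_kind) :
  seq_complete (scalars R c)^o.
Proof. by case: c; [apply: seq_complete_real | apply: seq_complete_complex]. Qed.

(** * Differentials by explicit epsilon estimates *)

Section EpsilonDifferential.
Context {K : numFieldType}.
Implicit Types V W : normedModType K.

Lemma near0_norm V (P : V -> Prop) :
  (\forall h \near 0, P h) <-> exists2 d : K, 0 < d & forall h, `|h| < d -> P h.
Proof.
rewrite nbhs_norm0P; split=> -[d d0 H]; exists d => // h hd; exact: H.
Qed.

(** With a partial order a minimum is awkward; d d'/(d + d') is positive and lies below both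
    radii. *)
Lemma common_radius (d d' : K) : 0 < d -> 0 < d' ->
  exists2 d1, 0 < d1 & forall x, x < d1 -> x < d /\ x < d'.
Proof.
move=> d0 d'0; have dd' := addr_gt0 d0 d'0.
exists (d * d' / (d + d')) => [|x xd]; first by rewrite divr_gt0 ?mulr_gt0.
split; apply: (lt_trans xd); rewrite ltr_pdivrMr // mulrDr.
  by rewrite ltrDr mulr_gt0.
by rewrite mulrC ltrDl mulr_gt0.
Qed.

Lemma open_radius V (D : set V) x : open D -> D x ->
  exists2 d : K, 0 < d & forall y, `|y - x| < d -> D y.
Proof.
move=> oD Dx.
have /nbhs_normP[d d0 H] : nbhs x D by exact: open_nbhs_nbhs.
by exists d => // y yd; apply: H; rewrite /= distrC.
Qed.

Lemma is_diff_epsilon V W (f L : V -> W) x : is_diff x f L ->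
  forall e : K, 0 < e -> exists2 d : K, 0 < d &
    forall h, `|h| < d -> `|f (x + h) - f x - L h| <= e * `|h|.
Proof.
move=> [df <-] e e0.
have /diff_locallyP[_ /eqaddoP/(_ e e0)/near0_norm[d d0 H]] := df.
exists d => // h /H.
change (`|f (h + x) - (f x + 'd f x h)| <= e * `|h| ->
        `|f (x + h) - f x - 'd f x h| <= e * `|h|).
by rewrite [h + x]addrC opprD addrA.
Qed.

Lemma is_diff_linear V W (f L : V -> W) x : is_diff x f L -> linear L.
Proof. by move=> [_ <-] a u v; rewrite linearP. Qed.

Lemma is_diff_bounded V W (f L : V -> W) x : is_diff x f L ->
  exists2 C : K, 0 < C & forall h, `|L h| <= C * `|h|.
Proof.
move=> [df <-]; exact: linear_lipschitz (diff_continuous df).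
Qed.

(** The bound [C] provides the continuity of [L], which differentiability requires besides the
    estimate of the remainder. *)
Lemma is_diff_of_epsilon V W (f L : V -> W) x (C : K) : linear L -> 0 <= C ->
  (forall h, `|L h| <= C * `|h|) ->
  (forall e : K, 0 < e -> exists2 d : K, 0 < d &
    forall h, `|h| < d -> `|f (x + h) - f x - L h| <= e * `|h|) ->
  is_diff x f L.
Proof.
move=> Llin C0 LC Heps.
pose LM := GRing.isLinear.Build _ _ _ _ _ Llin.
pose L' : {linear V -> W} := HB.pack L LM.
have L'c : continuous L'.
  apply/linear_bounded_continuous/linear_boundedP.
  near=> r; move=> u; rewrite (le_trans (LC u)) // ler_wpM2r //.
  by near: r; apply: nbhs_pinfty_ge; rewrite ger0_real.
have E : f \o shift x = cst (f x) + L' +o_ 0 id.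
  apply/eqaddoP => e e0; apply/near0_norm; have [d d0 H] := Heps e e0.
  exists d => // h /H.
  change (`|f (x + h) - f x - L h| <= e * `|h| ->
          `|f (h + x) - (f x + L h)| <= e * `|h|).
  by rewrite [h + x]addrC opprD addrA.
have dE := diff_unique L'c E.
by split; first (apply/diff_locallyP; rewrite dE).
Unshelve. all: by end_near. Qed.

Lemma is_diff_eq_open V W (f g L : V -> W) (D : set V) x :
  open D -> D x -> (forall y, D y -> f y = g y) -> is_diff x f L -> is_diff x g L.
Proof.
move=> oD Dx fg df; have [C C0 HC] := is_diff_bounded df.
apply: (is_diff_of_epsilon (is_diff_linear df) (ltW C0) HC) => e e0.
have [d d0 H] := is_diff_epsilon df e0.
have [d' d'0 H'] := open_radius oD Dx.
have [d1 d10 dd1] := common_radius d0 d'0.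
by exists d1 => // h /dd1[hd hd']; rewrite -!fg //; [exact: H|apply: H'; rewrite addrC addKr].
Qed.

Fact scale_is_bilinear W : bilinear_for
    (GRing.Scale.Law.clone _ _ *:%R _) (GRing.Scale.Law.clone _ _ *:%R _)
    ( *:%R : K^o -> W -> W).
Proof.
split=> [u'|u] a x y /=; first by rewrite scalerDl scalerA.
by rewrite scalerDr !scalerA mulrC.
Qed.

Lemma is_diff_scale V W (a da : V -> K^o) (b db : V -> W) x :
  is_diff x a da -> is_diff x b db ->
  is_diff x (fun y => a y *: b y) (fun h => a x *: db h + da h *: b x).
Proof.
move=> dfa dfb; pose bM := bilinear_isBilinear.Build K K^o W W _ _ _ (@scale_is_bilinear W).
pose B : {bilinear K^o -> W -> W} := HB.pack ( *:%R : K^o -> W -> W) bM.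
have Bc : continuous (fun p => B p.1 p.2) by apply: scale_continuous.
have dB : is_diff (a x, b x) (fun p => B p.1 p.2) (fun q => a x *: q.2 + q.1 *: b x).
  by split; [exact: differentiable_bilin | rewrite diff_bilin].
exact: (is_diff_comp (is_diff_pair dfa dfb) dB).
Qed.

End EpsilonDifferential.

(** * The mean value inequality by bisection *)

Section MeanValue.
Context {K : numFieldType} {V W : normedModType K}.

Lemma midpoint_ball (c x v : V) (r : K) :
  `|x - c| <= r -> `|x + v - c| <= r -> `|x + 2^-1 *: v - c| <= r.
Proof.
move=> xr yr; have half1 : 2^-1 + 2^-1 = 1 :> K by rewrite [RHS]splitr !mul1r.
have -> : x + 2^-1 *: v - c = 2^-1 *: ((x - c) + (x + v - c)).
  by rewrite [x + v - c]addrAC addrA scalerDr scalerDr -scalerDl half1 scale1r addrAC.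
rewrite normrZ ger0_norm ?invr_ge0 // mulrC ler_pdivrMr // mulr2n mulrDr mulr1.
by rewrite (le_trans (ler_normD _ _)) // lerD.
Qed.

(* Bisection replaces the order of the real line, so that real and complex
   scalars are covered at once. *)
Lemma mean_value_le (f : V -> W) (c : V) (r M : K) (a b : V) :
  archimedean_scalars K -> seq_complete V -> 0 <= M ->
  (forall x, `|x - c| <= r -> differentiable f x /\ `|'d f x (b - a)| <= M) ->
  `|a - c| <= r -> `|b - c| <= r -> `|f b - f a| <= M.
Proof.
(* The slack [e] absorbs the error of the linear approximation at the limit point of the
   bisection. *)
move=> Harch Hc M0 Hdiff ar br; apply: le_of_le_add => e e0.
pose h := 2^-1 : K; pose v := b - a.
have h0 k : 0 <= h ^+ k by rewrite /h exprn_ge0.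
have hS k : h ^+ k = h ^+ k.+1 + h ^+ k.+1 by rewrite exprSr half_half.
(* A piece is a base point with a depth k; it stands for the segment from that point with
   displacement 2^-k v. *)
pose y (x : V * nat) := x.1 + h ^+ x.2 *: v.
pose P (x : V * nat) := `|x.1 - c| <= r -> `|y x - c| <= r ->
  `|f (y x) - f x.1| <= (M + e) * h ^+ x.2.
pose child (x x' : V * nat) :=
  x'.2 = x.2.+1 /\ (x'.1 = x.1 \/ x'.1 = x.1 + h ^+ x.2.+1 *: v).
pose rad (x : V * nat) := `|v| * h ^+ x.2.
suff : P (a, 0%N).
  by rewrite /P /y /= expr0 scale1r mulr1 /v subrKC; apply.
apply: contrapT => nP.
have := bisection (pos := fst) (rad := rad) (child := child) Harch Hc _ _ _ nP.
case=> [|x Px|x x' [E Ex]|u [l [u0 cu Pu radu lu]]].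
- by rewrite /rad /= mulr1.
- apply: contrapT => H; apply: Px => xr yr.
  pose m := x.1 + h ^+ x.2.+1 *: v.
  have ym : y x = m + h ^+ x.2.+1 *: v by rewrite /m /y hS scalerDl addrA.
  have mr : `|m - c| <= r.
    rewrite /m exprS -scalerA; apply: midpoint_ball => //.
  have P1 : P (x.1, x.2.+1).
    by apply: contrapT => nP1; apply: H; exists (x.1, x.2.+1) => //; split => //; left.
  have P2 : P (m, x.2.+1).
    by apply: contrapT => nP1; apply: H; exists (m, x.2.+1) => //; split => //; right.
  rewrite (le_trans (ler_distD (f m) _ _)) // hS mulrDr lerD //.
    by have := P2; rewrite /P {1 2}/y /= -ym; apply.
  exact: P1.
- rewrite /rad E exprSr mulrA; split => //.
  case: Ex => ->; first by rewrite subrr normr0 !mulr_ge0.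
  by rewrite addrAC subrr add0r normrZ ger0_norm // exprSr mulrC -mulrA.
have inr k : `|(u k).1 - c| <= r /\ `|y (u k) - c| <= r.
  by split; apply: contrapT => nr; apply: (Pu k) => // ? ?.
have lr : `|l - c| <= r.
  apply: (@seq_lim_le _ _ (fun k => (u k).1)) (fun k => (inr k).1) => d d0.
  have [N HN] := half_pow_eventually Harch (normr_ge0 v) d0; exists N => m Nm.
  rewrite distrC (le_lt_trans (lu m)) // radu /rad /= mulr1; exact: HN.
have [dfl Ml] := Hdiff _ lr.
(* At depth N, with s = 2^-N, the two endpoints lie within |v| s and 2 |v| s of [l], so the two
   remainders together cost 3 |v| s times the tolerance; the added 1 covers v = 0. *)
have D0 : 0 < 3 * `|v| + 1 by rewrite ltr_wpDl // mulr_ge0.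
have [d d0 Hd] := is_diff_epsilon (differentiableP dfl) (divr_gt0 e0 D0).
have [N HN] := half_pow_eventually Harch (mulr_ge0 (ler0n K 2) (normr_ge0 v)) d0.
have uN2 k : (u k).2 = k.
  by elim: k => [|k IH]; [rewrite u0 | have [-> _] := cu k; rewrite IH].
have {}HN := HN N (leqnn N); pose s := h ^+ N.
have xl : `|(u N).1 - l| <= `|v| * s by have := lu N; rewrite /rad uN2 distrC.
have yl : `|y (u N) - l| <= 2 * `|v| * s.
  rewrite /y addrAC (le_trans (ler_normD _ _)) // mulr2n mulrDl mul1r mulrDl.
  by rewrite lerD // normrZ uN2 ger0_norm // mulrC.
apply: (Pu N) => _ _; rewrite uN2 -/s.
have xd : `|(u N).1 - l| < d.
  rewrite (le_lt_trans xl) // (le_lt_trans _ HN) // ler_wpM2r ?h0 //.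
  by rewrite ler_peMl // ler1n.
have yd : `|y (u N) - l| < d by rewrite (le_lt_trans yl).
have := Hd _ xd; have := Hd _ yd; rewrite ![l + _]addrC !subrK.
set dy := _ - l; set dx := _ - l => Hy Hx.
have -> : f (y (u N)) - f (u N).1 =
    (f (y (u N)) - f l - 'd f l dy) - (f (u N).1 - f l - 'd f l dx)
    + s *: 'd f l (b - a).
  have -> : s *: 'd f l (b - a) = 'd f l dy - 'd f l dx.
    rewrite -linearB -linearZ; congr ('d f l _).
    rewrite /dy /dx opprB addrA subrK /y uN2 addrAC subrr add0r.
    by [].
  by rewrite addrAC addrA subrK opprB addrA subrK opprB addrA subrK.
rewrite (le_trans (ler_normD _ _)) // [leRHS]mulrDl addrC lerD //.
  by rewrite normrZ (ger0_norm (h0 N)) mulrC ler_wpM2r ?h0.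
rewrite (le_trans (ler_normB _ _)) // (le_trans (lerD Hy Hx)) // -mulrDr.
rewrite mulrAC ler_pdivrMr // -mulrA ler_wpM2l ?(ltW e0) //.
rewrite (le_trans (lerD yl xl)) // -mulrDl -[X in _ + X]mul1r -mulrDl mulrC.
by rewrite ler_wpM2l ?h0 // natr1 lerDl.
Qed.

End MeanValue.

(** * Stability of [Ck] under algebraic operations and composition *)

Section CkCalculus.
Context {K : numFieldType}.
Implicit Types E F G : normedModType K.

Lemma Ck_eq E F k (D : set E) (f g : E -> F) : open D ->
  (forall x, D x -> f x = g x) -> Ck k D f -> Ck k D g.
Proof.
move=> oD; elim: k f g => [|k IH] f g fg /=.
  move=> fc x Dx; have := fc x Dx; rewrite /prop_for /continuous_at (fg x Dx).
  apply: cvg_trans; apply: near_eq_cvg.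
  have : \forall y \near x, D y by apply: open_nbhs_nbhs.
  by apply: filterS => y /fg.
have gP x (Dx : D x) (df : differentiable f x) : is_diff x g ('d f x).
  exact: is_diff_eq_open oD Dx fg (differentiableP df).
move=> [df Cf]; split=> [x Dx|v]; first by have [] := gP x Dx (df x Dx).
apply: IH (Cf v) => x Dx.
by rewrite (diff_val (is_diff_def := gP x Dx (df x Dx))).
Qed.

Lemma Ck_sub E F k (D D' : set E) (f : E -> F) : D' `<=` D -> Ck k D f -> Ck k D' f.
Proof.
move=> sD; elim: k f => [|k IH] f /= => [fc x /sD/fc //|[df Cf]].
by split=> [x /sD/df //|v]; apply: IH.
Qed.

Lemma CkW E F k (D : set E) (f : E -> F) : Ck k.+1 D f -> Ck k D f.
Proof.
elim: k f => [|k IH] f [df Cf].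
  by move=> x Dx; apply: differentiable_continuous; apply: df.
by split=> // v; apply: IH.
Qed.

Lemma Ck_step E F k (D : set E) (f : E -> F) (df : E -> E -> F) : open D ->
  (forall x, D x -> is_diff x f (df x)) -> (forall v, Ck k D (fun x => df x v)) ->
  Ck k.+1 D f.
Proof.
move=> oD Hf Hdf; split=> [x /Hf[] //|v].
by apply: Ck_eq (Hdf v) => // x /Hf H; rewrite (diff_val (is_diff_def := H)).
Qed.

Lemma Ck_diff E F k (D : set E) (f : E -> F) x : Ck k.+1 D f -> D x -> is_diff x f ('d f x).
Proof. by move=> [df _] Dx; apply: differentiableP; apply: df. Qed.

Lemma Ck_deriv E F k (D : set E) (f : E -> F) v :
  Ck k.+1 D f -> Ck k D (fun x => 'd f x v).
Proof. by move=> [_ H]; apply: H. Qed.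

Lemma Ck_cst E F k (D : set E) (w : F) : Ck k D (fun=> w).
Proof.
elim: k w => [|k IH] w /= => [x _|]; first exact: cst_continuous.
split=> [x _|v]; first exact: differentiable_cst.
suff -> : (fun x => 'd (fun=> w) x v) = (fun=> 0 : F) by apply: IH.
by apply/funext => x; rewrite (diff_cst w x).
Qed.

Lemma CkD E F k (D : set E) (f g : E -> F) : open D ->
  Ck k D f -> Ck k D g -> Ck k D (fun x => f x + g x).
Proof.
move=> oD; elim: k f g => [|k IH] f g Cf Cg.
  by move=> x Dx; apply: continuousD; [apply: Cf|apply: Cg].
apply: (Ck_step (df := fun x v => 'd f x v + 'd g x v)) => // [x Dx|v].
  exact: is_diffD (Ck_diff Cf Dx) (Ck_diff Cg Dx).
by apply: IH; apply: Ck_deriv.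
Qed.

Lemma Ck_scale E F k (D : set E) (a : E -> K^o) (b : E -> F) : open D ->
  Ck k D a -> Ck k D b -> Ck k D (fun x => a x *: b x).
Proof.
move=> oD; elim: k a b => [|k IH] a b Ca Cb.
  by move=> x Dx; apply: continuousZ; [apply: Ca|apply: Cb].
apply: (Ck_step (df := fun x v => a x *: 'd b x v + 'd a x v *: b x)) => // [x Dx|v].
  exact: is_diff_scale (Ck_diff Ca Dx) (Ck_diff Cb Dx).
apply: CkD => //; apply: IH; first exact: CkW.
- exact: Ck_deriv.
- exact: Ck_deriv.
- exact: CkW.
Qed.

Lemma CkM E k (D : set E) (a b : E -> K^o) : open D ->
  Ck k D a -> Ck k D b -> Ck k D (fun x => a x * b x : K^o).
Proof. exact: Ck_scale. Qed.

Lemma CkN E F k (D : set E) (f : E -> F) : open D -> Ck k D f -> Ck k D (fun x => - f x).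
Proof.
move=> oD Cf; apply: (Ck_eq (f := fun x => (-1 : K^o) *: f x)) => //.
  by move=> x _; rewrite scaleN1r.
exact: Ck_scale (Ck_cst _ _ _) Cf.
Qed.

Lemma Ck_sum E F k (D : set E) (I : Type) (r : seq I) (P : pred I) (f : I -> E -> F) :
  open D -> (forall i, Ck k D (f i)) -> Ck k D (fun x => \sum_(i <- r | P i) f i x).
Proof.
move=> oD Cf; elim: r => [|i r IH].
  by apply: Ck_eq (Ck_cst k D 0) => // x _; rewrite big_nil.
case: (boolP (P i)) => Pi; last by apply: Ck_eq IH => // x _; rewrite big_cons (negbTE Pi).
by apply: Ck_eq (CkD oD (Cf i) IH) => // x _; rewrite big_cons Pi.
Qed.

Lemma Ck_prod E k (D : set E) (I : Type) (r : seq I) (P : pred I) (f : I -> E -> K^o) :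
  open D -> (forall i, Ck k D (f i)) ->
  Ck k D (fun x => \prod_(i <- r | P i) f i x : K^o).
Proof.
move=> oD Cf; elim: r => [|i r IH].
  by apply: Ck_eq (Ck_cst k D (1 : K^o)) => // x _; rewrite big_nil.
case: (boolP (P i)) => Pi; last by apply: Ck_eq IH => // x _; rewrite big_cons (negbTE Pi).
by apply: Ck_eq (CkM oD (Cf i) IH) => // x _; rewrite big_cons Pi.
Qed.

Lemma Ck_det E k (D : set E) n (A : E -> 'M[K]_n) : open D ->
  (forall i j, Ck k D (fun x => A x i j : K^o)) -> Ck k D (fun x => \det (A x) : K^o).
Proof.
move=> oD CA; apply: Ck_sum => // s; apply: CkM => //; first exact: Ck_cst.
by apply: Ck_prod.
Qed.

Lemma CkV E k (D : set E) (a : E -> K^o) : open D ->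
  (forall x, D x -> a x != 0) -> Ck k D a -> Ck k D (fun x => (a x)^-1 : K^o).
Proof.
move=> oD a0; elim: k a a0 => [|k IH] a a0 Ca.
  by move=> x Dx; apply: cvgV; [apply: a0|apply: Ca].
apply: (Ck_step (df := fun x v => - ((a x)^-1 * (a x)^-1) * 'd a x v)) => // [x Dx|v].
  have da : differentiable a x by have [] := Ck_diff Ca Dx.
  split; first by apply: differentiableV => //; apply: a0.
  rewrite diffV ?a0 //; apply/funext => h /=; rewrite -invfM -expr2; by [].
have Ci : Ck k D (fun x => (a x)^-1 : K^o) by apply: IH => //; apply: CkW.
apply: CkM => //; last exact: Ck_deriv.
by apply: CkN => //; apply: CkM.
Qed.

Lemma Ck_linear E F k (D : set E) (L : {linear E -> F}) :
  open D -> continuous L -> Ck k D L.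
Proof.
move=> oD Lc; case: k => [|k]; first by move=> x _; apply: Lc.
apply: (Ck_step (df := fun x v => L v)) => // [x Dx|v]; last exact: Ck_cst.
by split; [apply: linear_differentiable | rewrite diff_lin].
Qed.

Lemma Ck_linear_comp E F G k (D : set E) (L : {linear F -> G}) (f : E -> F) :
  open D -> continuous L -> Ck k D f -> Ck k D (fun x => L (f x)).
Proof.
move=> oD Lc; elim: k f => [|k IH] f Cf.
  by move=> x Dx; apply: continuous_comp; [apply: Cf|apply: Lc].
apply: (Ck_step (df := fun x v => L ('d f x v))) => // [x Dx|v]; last by apply: IH; apply: Ck_deriv.
have dL : is_diff (f x) L L.
  by split; [apply: linear_differentiable | rewrite diff_lin].
exact: is_diff_comp (Ck_diff Cf Dx) dL.
Qed.

Lemma is_diff_coord E m (f df : E -> 'rV[K]_m) x j :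
  is_diff x f df -> is_diff x (fun y => f y 0 j : K^o) (fun v => df v 0 j).
Proof.
move=> H; have cl : linear (fun N : 'rV[K]_m => N 0 j : K^o) by move=> a u v; rewrite !mxE.
pose LM := GRing.isLinear.Build _ _ _ _ _ cl.
pose L : {linear 'rV[K]_m -> K^o} := HB.pack (fun N : 'rV[K]_m => N 0 j : K^o) LM.
have Lc : continuous L by apply: coord_continuous.
have dL : is_diff (f x) L L.
  by split; [apply: linear_differentiable | rewrite diff_lin].
exact: is_diff_comp H dL.
Qed.

Lemma Ck_coord E m k (D : set E) (f : E -> 'rV[K]_m) j : open D ->
  Ck k D f -> Ck k D (fun x => f x 0 j : K^o).
Proof.
move=> oD; have cl : linear (fun N : 'rV[K]_m => N 0 j : K^o) by move=> a u v; rewrite !mxE.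
pose LM := GRing.isLinear.Build _ _ _ _ _ cl.
pose L : {linear 'rV[K]_m -> K^o} := HB.pack (fun N : 'rV[K]_m => N 0 j : K^o) LM.
apply: (Ck_linear_comp (L := L)) => //; exact: coord_continuous.
Qed.

Lemma Ck_row E m k (D : set E) (f : E -> 'rV[K]_m) : open D ->
  (forall j, Ck k D (fun x => f x 0 j : K^o)) -> Ck k D f.
Proof.
move=> oD Cf.
apply: (Ck_eq (f := fun x => \sum_j (f x 0 j : K^o) *: delta_mx 0 j)) => //.
  by move=> x _; rewrite [RHS]row_sum_delta.
by apply: Ck_sum => // j; apply: Ck_scale => //; apply: Ck_cst.
Qed.

(** [Ck] only controls derivatives in fixed directions, so a moving direction [w x] is expanded in
    the standard basis. *)
Lemma Ck_diff_apply E m k (D : set E) (F : normedModType K) (g : 'rV[K]_m -> F)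
    (w : E -> 'rV[K]_m) (f : E -> 'rV[K]_m) : open D ->
  (forall j, Ck k D (fun x => 'd g (f x) (delta_mx 0 j))) -> Ck k D w ->
  Ck k D (fun x => 'd g (f x) (w x)).
Proof.
move=> oD Cg Cw.
apply: (Ck_eq (f := fun x => \sum_j (w x 0 j : K^o) *: 'd g (f x) (delta_mx 0 j))) => //.
  move=> x _; rewrite {2}(row_sum_delta (w x)) linear_sum; apply: eq_bigr => j _.
  by rewrite linearZ.
by apply: Ck_sum => // j; apply: Ck_scale => //; apply: Ck_coord.
Qed.

(** The chain rule produces 'd g (f x) applied to the moving vector 'd f x v; expansion in a basis
    leaves the fixed-direction derivatives of [g] composed with [f], to which the induction
    applies. *)
Lemma Ck_comp E m (F : normedModType K) k (D : set E) (D' : set 'rV[K]_m)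
    (g : 'rV[K]_m -> F) (f : E -> 'rV[K]_m) : open D ->
  (forall x, D x -> D' (f x)) -> Ck k D' g -> Ck k D f -> Ck k D (fun x => g (f x)).
Proof.
move=> oD fD; elim: k F g => [|k IH] F g Cg Cf.
  by move=> x Dx; apply: continuous_comp; [apply: Cf|apply: Cg; apply: fD].
apply: (Ck_step (df := fun x v => 'd g (f x) ('d f x v))) => // [x Dx|v].
  exact: is_diff_comp (Ck_diff Cf Dx) (Ck_diff Cg (fD _ Dx)).
apply: Ck_diff_apply => //; last exact: Ck_deriv.
by move=> j; apply: (IH _ (fun y => 'd g y (delta_mx 0 j))); [apply: Ck_deriv|apply: CkW].
Qed.

Definition smooth E F (D : set E) (f : E -> F) : Prop := forall k, Ck k D f.

End CkCalculus.

(** * The inverse function theorem *)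

Section InverseFunction.
Context {K : numFieldType}.
Hypothesis Harch : archimedean_scalars K.
Hypothesis Hcomplete : seq_complete K^o.

Lemma row_norm_le n (W : normedModType K) (g : {linear 'rV[K]_n -> W}) (e : K) :
  (forall j, `|g (delta_mx 0 j)| <= e) -> forall v, `|g v| <= n%:R * e * `|v|.
Proof.
move=> H v; rewrite [v in leLHS]row_sum_delta linear_sum (le_trans (ler_norm_sum _ _ _)) //.
rewrite -[n in n%:R]card_ord -sum1_card natr_sum mulr_suml mulr_suml.
apply: ler_sum => j _; rewrite linearZ normrZ mul1r mulrC.
by rewrite ler_pM // ?H // norm_coord_le.
Qed.

Lemma row_linear_bounded n (W : normedModType K) (g : {linear 'rV[K]_n -> W}) :
  exists2 C : K, 0 <= C & forall v, `|g v| <= C * `|v|.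
Proof.
exists (n%:R * \sum_j `|g (delta_mx 0 j)|); first by rewrite mulr_ge0 // sumr_ge0.
by apply: row_norm_le => j; rewrite (bigD1 j) //= lerDl sumr_ge0.
Qed.

Lemma dist_lt_swap (V : normedModType K) (a b : V) (e : K) : `|a - b| < e -> `|b - a| < e.
Proof. by rewrite distrC. Qed.

Lemma dist_swap (V : normedModType K) (a b v : V) (e : K) :
  `|a - b| <= e -> b = v -> `|v - a| <= e.
Proof. by move=> H <-; rewrite distrC. Qed.

Lemma half_absorb (x y : K) : x <= y + 2^-1 * x -> x <= 2 * y.
Proof.
rewrite -lerBlDr -{1}[x]mul1r -mulrBl.
have -> : 1 - 2^-1 = 2^-1 :> K by rewrite [X in X - _]splitr mul1r addrK.
by rewrite ler_pdivrMl.
Qed.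

Lemma row_linear_continuous n (W : normedModType K) (g : {linear 'rV[K]_n -> W}) :
  continuous g.
Proof.
have [C C0 HC] := row_linear_bounded g.
apply/linear_bounded_continuous/linear_boundedP.
near=> r; move=> u; rewrite (le_trans (HC u)) // ler_wpM2r //.
by near: r; apply: nbhs_pinfty_ge; rewrite ger0_real.
Unshelve. all: by end_near. Qed.

Lemma row_linear_is_diff n (W : normedModType K) (g : {linear 'rV[K]_n -> W}) x :
  is_diff x g g.
Proof.
have Hc := @row_linear_continuous n W g.
by split; [apply: linear_differentiable | rewrite diff_lin].
Qed.

(** Continuity of the finitely many partial derivatives is upgraded to closeness in operator norm,
    at the price of a factor n. *)
Lemma Ck1_diff_near n (W : normedModType K) (D : set 'rV[K]_n) (f : 'rV[K]_n -> W) p (e : K) :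
  open D -> D p -> Ck 1 D f -> 0 < e -> exists2 d : K, 0 < d &
    forall x, `|x - p| < d -> D x /\ forall v, `|'d f x v - 'd f p v| <= e * `|v|.
Proof.
(* Dividing by n + 1 instead of n keeps the tolerance meaningful for n = 0. *)
move=> oD Dp Cf e0; have n0 : 0 < n%:R + 1 :> K by rewrite ltr_wpDl.
have e'0 := divr_gt0 e0 n0.
have near_j : \forall x \near p, D x /\ forall j : 'I_n,
    `|'d f x (delta_mx 0 j) - 'd f p (delta_mx 0 j)| < e / (n%:R + 1).
  apply: filterI; first exact: open_nbhs_nbhs.
  apply: (@filter_forall _ _ (fun (j : 'I_n) x =>
    `|'d f x (delta_mx 0 j) - 'd f p (delta_mx 0 j)| < e / (n%:R + 1)) (nbhs p) _) => j.
  have Cj : Ck 0 D (fun x => 'd f x (delta_mx 0 j)) by apply: Ck_deriv.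
  have := Cj p Dp; move/cvgrPdist_lt/(_ _ e'0); apply: filterS => x.
  exact: dist_lt_swap.
have /nbhs_normP[d d0 H] := near_j; exists d => // x xd.
have [|Dx Hx] := H x; first by rewrite /= distrC.
split; first exact: Dx.
move=> v; have := row_norm_le (g := 'd f x \- 'd f p) (fun j => ltW (Hx j)) v.
move/le_trans; apply.
rewrite ler_wpM2r // mulrCA ler_piMr ?(ltW e0) //.
by rewrite ler_pdivrMr // mul1r lerDl.
Qed.

Lemma open_norm_ball (V : normedModType K) (a : V) (s : K) : open [set y | `|y - a| < s].
Proof.
have -> : [set y | `|y - a| < s] = ball a s.
  by rewrite -ball_normE; apply/seteqP; split=> y /=; rewrite distrC.
exact: ball_open.
Qed.

Lemma open_preimage (V W : normedModType K) (D : set V) (f : V -> W) (B : set W) :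
  open D -> Ck 0 D f -> open B -> open (D `&` f @^-1` B).
Proof.
move=> oD Cf oB; rewrite openE => x [Dx Bx]; apply: filterI.
  exact: open_nbhs_nbhs.
by apply: (Cf x Dx); apply: open_nbhs_nbhs.
Qed.

(** Cramer's rule: the entries of the inverse are cofactors divided by the determinant. *)
Lemma Ck_invmx (E : normedModType K) n k (D : set E) (A : E -> 'M[K]_n) : open D ->
  (forall x, D x -> A x \in unitmx) ->
  (forall i j, Ck k D (fun x => A x i j : K^o)) ->
  forall i j, Ck k D (fun x => invmx (A x) i j : K^o).
Proof.
move=> oD Au CA i j.
apply: (Ck_eq (f := fun x => (\det (A x))^-1 * cofactor (A x) j i : K^o)) => //.
  by move=> x Dx; rewrite /invmx Au // !mxE.
apply: CkM => //.
  apply: CkV => //; last exact: Ck_det.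
  by move=> x Dx; have := Au x Dx; rewrite unitmxE unitfE.
apply: CkM => //; first exact: Ck_cst.
apply: Ck_det => // i' j'.
by apply: Ck_eq (CA (lift j i') (lift i j')) => // x _; rewrite !mxE.
Qed.

Lemma Ck_mulmx (E : normedModType K) n m k (D : set E) (v : E -> 'rV[K]_n)
    (A : E -> 'M[K]_(n, m)) : open D -> Ck k D v ->
  (forall i j, Ck k D (fun x => A x i j : K^o)) -> Ck k D (fun x => v x *m A x).
Proof.
move=> oD Cv CA; apply: Ck_row => // j.
apply: (Ck_eq (f := fun x => \sum_i (v x 0 i * A x i j) : K^o)) => //.
  by move=> x _; rewrite mxE.
by apply: Ck_sum => // i; apply: CkM => //; apply: Ck_coord.
Qed.

Lemma jacobian_mulE n m (f : 'rV[K]_n -> 'rV[K]_m) q v : v *m 'J f q = 'd f q v.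
Proof. exact: mul_rV_lin1. Qed.

Lemma jacobianE n m (f : 'rV[K]_n -> 'rV[K]_m) q i j :
  'J f q i j = 'd f q (delta_mx 0 i) 0 j.
Proof. by rewrite mxE. Qed.

Section DerivativeIdentity.
Variables (n : nat) (D : set 'rV[K]_n) (f : 'rV[K]_n -> 'rV[K]_n) (p : 'rV[K]_n).
Hypotheses (oD : open D) (Dp : D p) (smf : smooth D f) (dfp : forall v, 'd f p v = v).

Let near_identity : exists2 r : K, 0 < r & forall x, `|x - p| <= r ->
  D x /\ forall v, `|v - 'd f x v| <= 2^-1 * `|v|.
Proof.
have h0 : 0 < 2^-1 :> K by rewrite invr_gt0.
have [d d0 H] := Ck1_diff_near oD Dp (smf 1) h0.
exists (d / 2) => [|x xd]; first exact: half_gt0.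
have [|Dx Hx] := H x.
  by rewrite (le_lt_trans xd) // ltr_pdivrMr // ltr_pMr // ltr1n.
split; first exact: Dx.
by move=> v; exact: dist_swap (Hx v) (dfp v).
Qed.

(** The mean value inequality is applied to x - f x, whose differential has norm at most 1/2 near p.
    Thus [f] is the identity perturbed by a contraction, the source of both injectivity and the
    iteration that solves f q = y. *)
Lemma near_identity_lipschitz : exists2 r : K, 0 < r &
  (forall x, `|x - p| <= r -> D x /\ forall v, `|v - 'd f x v| <= 2^-1 * `|v|) /\
  forall a b, `|a - p| <= r -> `|b - p| <= r ->
    `|(b - f b) - (a - f a)| <= 2^-1 * `|b - a|.
Proof.
have [r r0 H] := near_identity; exists r => //; split=> // a b ar br.
apply: (@mean_value_le _ _ _ (fun x => x - f x) p r) => //.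
- exact: seq_complete_row.
move=> x /H[Dx Hx].
have dx : is_diff x (fun x => x - f x) (fun v => v - 'd f x v).
  exact: is_diffB (is_diff_id x) (Ck_diff (smf 1) Dx).
by split; [case: dx | rewrite (diff_val (is_diff_def := dx)); apply: Hx].
Qed.

Lemma inverse_function_id : exists (V : set 'rV[K]_n) (x : 'rV[K]_n -> 'rV[K]_n),
  [/\ open V, V p, V `<=` D & open (f @` V)] /\
  [/\ smooth (f @` V) x & forall q, V q -> x (f q) = q].
Proof.
have [r r0 [Hr Lip]] := near_identity_lipschitz.
have r20 := half_gt0 r0.
have inj a b : `|a - p| <= r -> `|b - p| <= r -> `|b - a| <= 2 * `|f b - f a|.
  move=> ar br; have := Lip _ _ ar br => L.
  have : `|b - a| <= `|f b - f a| + 2^-1 * `|b - a|.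
    rewrite -[b - a in leLHS](subrK (f b - f a)) addrC (le_trans (ler_normD _ _)) //.
    rewrite lerD2l (le_trans _ L) // le_eqVlt; apply/orP; left; apply/eqP; congr `|_|.
    by rewrite !opprD !opprK addrACA.
  exact: half_absorb.
have surj y : `|y - f p| < r / 2 -> exists2 q, `|q - p| < r & f q = y.
  (* The iteration u' = y + (u - f u) starts at p with a step of length |y - f p| = C/2, and each
     step at most halves; hence the total displacement is at most C < r. *)
  move=> yr; pose C := 2 * `|y - f p|.
  have C0 : 0 <= C by rewrite mulr_ge0.
  have Cr : C < r by rewrite /C mulrC -ltr_pdivlMr.
  pose u := fix u k := if k is k'.+1 then y + (u k' - f (u k')) else p.
  have h0 k : 0 <= 2^-1 ^+ k :> K by rewrite exprn_ge0.
  have uP k : `|u k - p| <= C - C * 2^-1 ^+ k /\ `|u k.+1 - u k| <= C * 2^-1 ^+ k.+1.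
    elim: k => [|k [IH1 IH2]].
      rewrite /= subrr normr0 expr0 mulr1 subrr; split=> //.
      by rewrite expr1 /C mulrC mulKf // addrCA addrAC subrr add0r.
    have bk : `|u k - p| <= r.
      by rewrite (le_trans IH1) // lerBlDr (le_trans (ltW Cr)) // lerDl mulr_ge0.
    have IH1' : `|u k.+1 - p| <= C - C * 2^-1 ^+ k.+1.
      rewrite (le_trans (ler_distD (u k) _ _)) // (le_trans (lerD IH2 IH1)) //.
      rewrite addrCA lerD2l exprSr mulrA -[X in _ - X](half_half (C * 2^-1 ^+ k)).
      by rewrite opprD addrA subrr add0r.
    have bk1 : `|u k.+1 - p| <= r.
      by rewrite (le_trans IH1') // lerBlDr (le_trans (ltW Cr)) // lerDl mulr_ge0.
    split=> //.
    have -> : u k.+2 - u k.+1 = (u k.+1 - f (u k.+1)) - (u k - f (u k)).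
      by rewrite [u k.+2]/(y + (u k.+1 - f (u k.+1))) [X in _ - X]/(y + (u k - f (u k))) opprD addrACA subrr add0r.
    rewrite (le_trans (Lip _ _ bk bk1)) // exprS mulrCA ler_wpM2l ?invr_ge0 //.
  have [l [_ Hl]] := geometric_lim Harch (seq_complete_row Hcomplete) C0 (fun k => (uP k).2).
  have lr : `|l - p| <= C by have := Hl 0%N; rewrite expr0 mulr1.
  exists l; first exact: le_lt_trans lr Cr.
  apply/eqP; rewrite -subr_eq0 -normr_eq0 eq_le normr_ge0 andbT.
  apply: le_of_le_add => e e0; rewrite add0r.
  have [N HN] := half_pow_eventually Harch C0 (half_gt0 e0); have {}HN := HN N (leqnn N).
  have bN : `|u N - p| <= r.
    by rewrite (le_trans (uP N).1) // lerBlDr (le_trans (ltW Cr)) // lerDl mulr_ge0.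
  (* The residual is split by u_(N+1) = y + (u_N - f u_N): the first difference is small by the rate
     of convergence, the second by the contraction estimate. *)
  have -> : f l - y = (l - u N.+1) - ((l - f l) - (u N - f (u N))).
    have gen (a b c d : 'rV[K]_n) : b - c = (a - (c + d)) - ((a - b) - d).
      by rewrite opprB opprD addrA addrA subrK opprB addrC addrA subrK.
    exact: gen.
  rewrite (le_trans (ler_normB _ _)) // -(half_half e) lerD //.
    rewrite (le_trans (Hl _)) // (le_trans _ (ltW HN)) // ler_wpM2l //.
    by rewrite ler_wiXn2l // invf_le1 // ler1n.
  rewrite (le_trans (Lip _ _ bN (le_trans lr (ltW Cr)))) //.
  rewrite (le_trans _ (ltW HN)) // (le_trans _ (Hl N)) // ler_piMl //.
  by rewrite invf_le1 // ler1n.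
(* [V] also restricts f q, so that its image is exactly the ball reached by [surj] and is open for
   that reason. *)
pose V := [set q | `|q - p| < r /\ `|f q - f p| < r / 2].
have fV : f @` V = [set y | `|y - f p| < r / 2].
  apply/seteqP; split=> [_ [q [_ qr] <-] //|y yr].
  by have [q qr fq] := surj y yr; exists q => //; split=> //; rewrite fq.
have VD : V `<=` D by move=> q [/ltW/Hr[]].
have Vo : open V.
  have -> : V = [set q | `|q - p| < r] `&` (D `&` f @^-1` [set y | `|y - f p| < r / 2]).
    apply/seteqP; split=> q /= [qr fq]; last by case: fq.
    by split=> //; split=> //; apply: VD; split.
  by apply: openI; [apply: open_norm_ball | apply: open_preimage => //; apply: open_norm_ball].
have fVo : open (f @` V) by rewrite fV; apply: open_norm_ball.
pose x y := xget p [set q | `|q - p| < r /\ f q = y].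
have xP y : (f @` V) y -> `|x y - p| < r /\ f (x y) = y.
  rewrite fV => /surj[q qr fq]; apply: (@xgetPex _ p [set q | `|q - p| < r /\ f q = y]).
  by exists q.
have xK q : V q -> x (f q) = q.
  move=> Vq; have [xr fx] := xP (f q) (imageP f Vq); have [qr _] := Vq.
  apply/eqP; rewrite -subr_eq0 -normr_le0 (le_trans (inj _ _ (ltW qr) (ltW xr))) //.
  by rewrite fx subrr normr0 mulr0.
(* A kernel vector v of the Jacobian would satisfy |v| <= |v|/2. *)
have Ju q : `|q - p| <= r -> 'J f q \in unitmx.
  move=> /Hr[_ Hq]; rewrite unitmxE unitfE; apply/det0P => -[v v0].
  rewrite jacobian_mulE => dv; have := Hq v; rewrite [X in `|_ - X|]dv subr0.
  move=> H; move: v0; rewrite -normr_gt0 => v0; move: H.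
  by rewrite -ler_pdivrMr // divff ?gt_eqF // => /le_gtF; rewrite invf_lt1 // ltr1n.
have dx w : (f @` V) w -> is_diff w x (fun v => v *m invmx ('J f (x w))).
  move=> Ww; have [xr fx] := xP w Ww.
  pose L := mulmxr (invmx ('J f (x w))) : {linear 'rV[K]_n -> 'rV[K]_n}.
  have [C C0 HC] := row_linear_bounded L.
  have Ll : linear (fun v : 'rV[K]_n => v *m invmx ('J f (x w))).
    by move=> a u v; rewrite mulmxDl scalemxAl.
  apply: (is_diff_of_epsilon Ll C0 HC).
  (* [C] bounds the inverse Jacobian and 2 is the Lipschitz constant of the local inverse; the
     remainder of [f] is multiplied by both. *)
  move=> e e0; have C1 : 0 < 2 * (C + 1) by rewrite mulr_gt0 // ltr_wpDl.
  have Dxw : D (x w) by have [] := Hr _ (ltW xr).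
  have [d d0 Hd] := is_diff_epsilon (Ck_diff (smf 1) Dxw) (divr_gt0 e0 C1).
  have [d' d'0 Hd'] := open_radius fVo Ww.
  have [d1 d10 dd1] := common_radius (half_gt0 d0) d'0.
  exists d1 => // k kd; have [kd2 kd'] := dd1 _ kd.
  have Wk : (f @` V) (w + k) by apply: Hd'; rewrite addrAC subrr add0r.
  have [xkr fxk] := xP _ Wk.
  pose h := x (w + k) - x w.
  have hk : `|h| <= 2 * `|k|.
    rewrite (le_trans (inj _ _ (ltW xr) (ltW xkr))) // fxk fx.
    by rewrite addrAC subrr add0r.
  have hd : `|h| < d by rewrite (le_lt_trans hk) // mulrC -ltr_pdivlMr.
  have := Hd _ hd; rewrite /h subrKC fxk fx -/h [w + k - w]addrAC subrr add0r => Hk.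
  have -> : h - k *m invmx ('J f (x w)) = - L (k - 'd f (x w) h).
    rewrite /= -jacobian_mulE mulmxBl mulmxK ?opprB //; apply: Ju; exact: ltW.
  rewrite normrN (le_trans (HC _)) // (le_trans (ler_wpM2l C0 Hk)) //.
  rewrite (@le_trans _ _ (C * (e / (2 * (C + 1)) * (2 * `|k|)))) //.
    by rewrite ler_wpM2l // ler_wpM2l // divr_ge0 // ltW.
  rewrite mulrA [X in X <= _]mulrA ler_wpM2r // mulrA -mulrA [_^-1 * 2]mulrC.
  rewrite invfM mulVKf ?pnatr_eq0 // mulrAC ler_piMl ?(ltW e0) //.
  by rewrite ler_pdivrMr ?mul1r ?lerDl // ltr_wpDl.
exists V, x; split; split=> //; first by split; rewrite subrr normr0.
(* Bootstrapping: the differential of [x] is the inverse Jacobian of [f] at x w, so if [x] is C^k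
   then so is its differential. *)
elim=> [w Ww|k IH].
  by apply: differentiable_continuous; have [] := dx w Ww.
apply: Ck_step dx _ => // v; apply: Ck_mulmx => //; first exact: Ck_cst.
apply: Ck_invmx => // [w Ww|i j].
  by apply: Ju; apply: ltW; have [] := xP w Ww.
apply: (Ck_eq (f := fun w => 'd f (x w) (delta_mx 0 i) 0 j : K^o)) => //.
  by move=> w _; rewrite jacobianE.
apply: Ck_coord => //.
apply: (Ck_comp (D' := D) (g := fun y => 'd f y (delta_mx 0 i))) => //.
  by move=> w Ww; have [xr _] := xP w Ww; have [] := Hr _ (ltW xr).
exact: Ck_deriv (smf k.+1).
Qed.

End DerivativeIdentity.

(** Composing [f] with the inverse of its Jacobian at p reduces to a differential equal to the
    identity; the linear factor is then undone on the image. *)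
Theorem inverse_function n (D : set 'rV[K]_n) (f : 'rV[K]_n -> 'rV[K]_n) p :
  open D -> D p -> smooth D f -> 'J f p \in unitmx ->
  exists (V : set 'rV[K]_n) (x : 'rV[K]_n -> 'rV[K]_n),
  [/\ open V, V p, V `<=` D & open (f @` V)] /\
  [/\ smooth (f @` V) x & forall q, V q -> x (f q) = q].
Proof.
move=> oD Dp smf Ju.
pose L := mulmxr (invmx ('J f p)) : {linear 'rV[K]_n -> 'rV[K]_n}.
pose L' := mulmxr ('J f p) : {linear 'rV[K]_n -> 'rV[K]_n}.
pose g y := L (f y).
have smg : smooth D g by move=> k; apply: Ck_linear_comp => //; apply: row_linear_continuous.
have dg v : 'd g p v = v.
  have H : is_diff p g (fun v => L ('d f p v)).
    exact: is_diff_comp (Ck_diff (smf 1) Dp) (row_linear_is_diff L (f p)).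
  by rewrite (diff_val (is_diff_def := H)) /= -jacobian_mulE mulmxK.
have [V [x [[Vo Vp VD gVo] [smx xK]]]] := inverse_function_id oD Dp smg dg.
have LK y : L' (L y) = y by rewrite /= mulmxKV.
have LK' y : L (L' y) = y by rewrite /= mulmxK.
have fV : f @` V = L @^-1` (g @` V).
  apply/seteqP; split=> [_ [q Vq <-]|y [q Vq E]]; first by exists q.
  by exists q => //; rewrite -(LK y) -E LK.
have fVo : open (f @` V).
  have -> : f @` V = setT `&` L @^-1` (g @` V) by rewrite fV setTI.
  apply: (@open_preimage _ _ setT L (g @` V) openT) gVo.
  by move=> y _; apply: row_linear_continuous.
exists V, (x \o L); split; split=> //.
  move=> k; apply: (Ck_comp (D' := g @` V)) => //; first by rewrite fV.
  by apply: Ck_linear => //; apply: row_linear_continuous.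

Qed.

End InverseFunction.

(** * Integrals along segments as limits of dyadic midpoint sums *)

Section SegmentIntegral.
Context {K : numClosedFieldType}.
Hypothesis Harch : archimedean_scalars K.
Hypothesis Hcomplete : seq_complete (K : numFieldType)^o.
Implicit Types (phi psi : K -> K) (a b w : K).

(* Midpoint sums over dyadic subdivisions: additive under bisection by
   definition, and exact for affine functions. *)
Fixpoint seg_sum (m : nat) phi a b : K :=
  match m with
  | 0 => phi ((a + b) / 2) * (b - a)
  | m'.+1 => seg_sum m' phi a ((a + b) / 2) + seg_sum m' phi ((a + b) / 2) b
  end.

(** The closed disc having the segment as a diameter. It contains the discs of both halves, so
    hypotheses on it survive bisection without any parametrization of the segment. *)
Definition seg_ball a b w : Prop := `|w - (a + b) / 2| <= `|b - a| / 2.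

Definition continuous_at_eps phi w : Prop :=
  forall e : K, 0 < e -> exists2 d : K, 0 < d &
    forall y, `|y - w| < d -> `|phi y - phi w| <= e.

Lemma norm_half (x : K) : `|x / 2| = `|x| / 2.
Proof. by rewrite normrM normfV (ger0_norm (ler0n _ 2)). Qed.

Lemma sub_mid_l a b : (a + b) / 2 - a = (b - a) / 2.
Proof. by field. Qed.

Lemma sub_mid_r a b : b - (a + b) / 2 = (b - a) / 2.
Proof. by field. Qed.

Lemma seg_ball_mid a b : seg_ball a b ((a + b) / 2).
Proof. by rewrite /seg_ball subrr normr0 divr_ge0. Qed.

Lemma seg_ball_l a b w : seg_ball a ((a + b) / 2) w -> seg_ball a b w.
Proof.
rewrite /seg_ball sub_mid_l norm_half => H.
rewrite (le_trans (ler_distD ((a + (a + b) / 2) / 2) _ _)) //.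
rewrite -[X in _ <= X]half_half lerD //.
have -> : (a + (a + b) / 2) / 2 - (a + b) / 2 = - ((b - a) / 2 / 2) by field.
by rewrite normrN !norm_half.
Qed.

Lemma seg_ball_r a b w : seg_ball ((a + b) / 2) b w -> seg_ball a b w.
Proof.
rewrite /seg_ball sub_mid_r norm_half => H.
rewrite (le_trans (ler_distD (((a + b) / 2 + b) / 2) _ _)) //.
rewrite -[X in _ <= X]half_half lerD //.
have -> : ((a + b) / 2 + b) / 2 - (a + b) / 2 = (b - a) / 2 / 2 by field.
by rewrite !norm_half.
Qed.

Lemma seg_sum_le m phi a b (M : K) :
  (forall w, seg_ball a b w -> `|phi w| <= M) -> `|seg_sum m phi a b| <= M * `|b - a|.
Proof.
elim: m a b => [|m IH] a b H /=.
  by rewrite normrM ler_wpM2r // H //; apply: seg_ball_mid.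
rewrite (le_trans (ler_normD _ _)) // -(half_half (M * `|b - a|)) lerD //.
  rewrite (le_trans (IH _ _ _)) // ?sub_mid_l ?norm_half ?mulrA // => w Hw.
  by apply: H; apply: seg_ball_l.
rewrite (le_trans (IH _ _ _)) // ?sub_mid_r ?norm_half ?mulrA // => w Hw.
by apply: H; apply: seg_ball_r.
Qed.

Lemma seg_sumD m phi psi a b :
  seg_sum m (fun w => phi w + psi w) a b = seg_sum m phi a b + seg_sum m psi a b.
Proof.
by elim: m a b => [|m IH] a b /=; [rewrite mulrDl | rewrite !IH addrACA].
Qed.

Lemma seg_sumZ m (c : K) phi a b :
  seg_sum m (fun w => c * phi w) a b = c * seg_sum m phi a b.
Proof.
by elim: m a b => [|m IH] a b /=; [rewrite mulrA | rewrite !IH mulrDr].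
Qed.

Lemma seg_sum_affine m (c d : K) a b :
  seg_sum m (fun w => c + d * w) a b = c * (b - a) + d * (b ^+ 2 - a ^+ 2) / 2.
Proof. by elim: m a b => [|m IH] a b /=; [field | rewrite !IH; field]. Qed.

Lemma seg_sum_cst m (c : K) a b : seg_sum m (fun=> c) a b = c * (b - a).
Proof. by elim: m a b => [|m IH] a b //=; rewrite !IH; field. Qed.

Lemma seg_sum_rev m phi a b : seg_sum m phi b a = - seg_sum m phi a b.
Proof.
elim: m a b => [|m IH] a b /=; first by rewrite [b + a]addrC -mulrN opprB.
by rewrite [b + a]addrC (IH ((a + b) / 2) b) (IH a) opprD; exact: addrC.
Qed.

Lemma seg_sum_eq m phi psi a b :
  (forall w, seg_ball a b w -> phi w = psi w) -> seg_sum m phi a b = seg_sum m psi a b.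
Proof.
elim: m a b => [|m IH] a b H /=; first by rewrite H //; apply: seg_ball_mid.
congr (_ + _); apply: IH => w Hw; apply: H; first exact: seg_ball_l.
exact: seg_ball_r.
Qed.

Lemma seg_sum_mul m phi (u : K) a b :
  seg_sum m phi (u * a) (u * b) = u * seg_sum m (fun w => phi (u * w)) a b.
Proof.
have E x y : (u * x + u * y) / 2 = u * ((x + y) / 2) by field.
elim: m a b => [|m IH] a b /=; first by rewrite E -mulrBr mulrCA.
by rewrite E !IH mulrDr.
Qed.

(** Bisection replaces uniform continuity: on small segments around a point [l] all sums are close
    to the constant value phi l times the length, on which every depth agrees. *)
Lemma seg_sum_oscillation phi a b : (forall w, seg_ball a b w -> continuous_at_eps phi w) ->
  forall e, 0 < e -> exists N, forall m p, (N <= m)%N -> (N <= p)%N ->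
    `|seg_sum m phi a b - seg_sum p phi a b| <= e * `|b - a|.
Proof.
move=> Hc e e0; pose mid (x : K * K) := (x.1 + x.2) / 2.
pose rad (x : K * K) := `|x.2 - x.1| / 2.
pose child (x y : K * K) := y = (x.1, mid x) \/ y = (mid x, x.2).
pose osc (x : K * K) := exists N, forall m p, (N <= m)%N -> (N <= p)%N ->
    `|seg_sum m phi x.1 x.2 - seg_sum p phi x.1 x.2| <= e * `|x.2 - x.1|.
apply: contrapT => nosc.
have := @bisection _ (K : numFieldType)^o (K * K) mid rad osc child (a, b) Harch Hcomplete.
case=> //; first by rewrite divr_ge0.
- move=> x nx; apply: contrapT => H; apply: nx.
  have [N HN] : osc (x.1, mid x).
    by apply: contrapT => nx; apply: H; exists (x.1, mid x) => //; left.
  have [N' HN'] : osc (mid x, x.2).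
    by apply: contrapT => nx; apply: H; exists (mid x, x.2) => //; right.
  (* One more level: depth m + 1 on the segment is depth m on each half. *)
  exists (maxn N N').+1 => -[//|m] [//|p]; rewrite !ltnS !geq_max.
  move=> /andP[Nm N'm] /andP[Np N'p] /=.
  have := HN _ _ Nm Np; have := HN' _ _ N'm N'p; rewrite /= /mid sub_mid_l sub_mid_r.
  rewrite norm_half => H1 H2; rewrite opprD addrACA (le_trans (ler_normD _ _)) //.
  by rewrite (le_trans (lerD H2 H1)) // -mulrDr half_half.
- move=> x y [] ->; rewrite /rad /mid /=.
    rewrite sub_mid_l norm_half; split=> //.
    have -> : (x.1 + (x.1 + x.2) / 2) / 2 - (x.1 + x.2) / 2 = - ((x.2 - x.1) / 2 / 2).
      by field.
    by rewrite normrN !norm_half.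
  rewrite sub_mid_r norm_half; split=> //.
  have -> : ((x.1 + x.2) / 2 + x.2) / 2 - (x.1 + x.2) / 2 = (x.2 - x.1) / 2 / 2.
    by field.
  by rewrite !norm_half.
move=> u [l [u0 cu nu radu lu]].
have bl : seg_ball a b l by have := lu 0%N; rewrite u0.
have [d d0 Hd] := Hc _ bl _ (half_gt0 e0).
have [|N HN] := @half_pow_eventually _ Harch (2 * rad (a, b)) d _ d0.
  by rewrite mulr_ge0 // divr_ge0.
apply: (nu N); exists 0%N => m p _ _; set x := u N.
have near_l w : seg_ball x.1 x.2 w -> `|phi w + - phi l| <= e / 2.
  move=> Hw; apply: Hd; rewrite (le_lt_trans _ (HN N (leqnn N))) // -mulrA -radu.
  rewrite (le_trans (ler_distD (mid x) _ _)) // mulr2n mulrDl mul1r lerD //.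
  by have := lu N; rewrite distrC.
have E k : `|seg_sum k phi x.1 x.2 - phi l * (x.2 - x.1)| <= e / 2 * `|x.2 - x.1|.
  rewrite (le_trans _ (seg_sum_le k near_l)) // seg_sumD.
  by rewrite seg_sum_cst mulNr.
rewrite (le_trans (ler_distD (phi l * (x.2 - x.1)) _ _)) //.
by rewrite -[e in X in _ <= X]half_half mulrDl lerD // distrC.
Qed.

(** The default value 0 is taken when the sums have no limit; continuity on the disc excludes this
    case. *)
Definition seg_int phi a b : K :=
  xget 0 [set I | @seq_lim _ (K : numFieldType)^o (fun m => seg_sum m phi a b) I].

Definition seg_continuous phi a b : Prop :=
  forall w, seg_ball a b w -> continuous_at_eps phi w.

Lemma seg_intP phi a b : seg_continuous phi a b ->
  @seq_lim _ (K : numFieldType)^o (fun m => seg_sum m phi a b) (seg_int phi a b).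
Proof.
move=> Hc; apply: (@xgetPex _ 0 [set I | @seq_lim _ (K : numFieldType)^o _ I]).
apply: Hcomplete => e e0; have b0 : 0 < `|b - a| + 1 by rewrite ltr_wpDl.
have [N HN] := seg_sum_oscillation Hc (divr_gt0 e0 b0).
exists N => m p Nm Np; rewrite (le_lt_trans (HN _ _ Nm Np)) //.
by rewrite mulrAC ltr_pdivrMr // ltr_pM2l // ltrDl.
Qed.

Lemma seg_int_lim phi a b I :
  @seq_lim _ (K : numFieldType)^o (fun m => seg_sum m phi a b) I -> seg_int phi a b = I.
Proof.
move=> H; apply: (seq_lim_unique _ H).
by apply: (@xgetPex _ 0 [set I | @seq_lim _ (K : numFieldType)^o _ I]); exists I.
Qed.

Lemma seg_continuous_l phi a b : seg_continuous phi a b -> seg_continuous phi a ((a + b) / 2).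
Proof. by move=> H w /seg_ball_l/H. Qed.

Lemma seg_continuous_r phi a b : seg_continuous phi a b -> seg_continuous phi ((a + b) / 2) b.
Proof. by move=> H w /seg_ball_r/H. Qed.

(** Sums of depth m + 1 split at the midpoint by definition. Additivity is thus available at
    midpoints only, which is why the contours below are cut into squares by halving edges. *)
Lemma seg_int_split phi a b c : c = (a + b) / 2 -> seg_continuous phi a b ->
  seg_int phi a b = seg_int phi a c + seg_int phi c b.
Proof.
move=> -> Hc; apply: (@seq_lim_unique _ (K : numFieldType)^o _ _ _ (seq_lim_shift (seg_intP Hc))).
by apply: seq_limD; apply: seg_intP; [apply: seg_continuous_l|apply: seg_continuous_r].
Qed.

Lemma seg_int_rev phi a b : seg_continuous phi a b -> seg_int phi b a = - seg_int phi a b.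
Proof.
move=> Hc; apply: seg_int_lim; rewrite -mulN1r => e.
move=> /(seq_limZ (-1) (seg_intP Hc))[N HN]; exists N => m /HN.
by rewrite (seg_sum_rev m phi a b) -[- seg_sum _ _ _ _]mulN1r.
Qed.

Lemma seg_intD phi psi a b : seg_continuous phi a b -> seg_continuous psi a b ->
  seg_int (fun w => phi w + psi w) a b = seg_int phi a b + seg_int psi a b.
Proof.
move=> H1 H2; apply: seg_int_lim => e /(seq_limD (seg_intP H1) (seg_intP H2))[N HN].
by exists N => m /HN; rewrite seg_sumD.
Qed.

Lemma seg_intZ (c : K) phi a b : seg_continuous phi a b ->
  seg_int (fun w => c * phi w) a b = c * seg_int phi a b.
Proof.
move=> H1; apply: seg_int_lim => e /(seq_limZ c (seg_intP H1))[N HN].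
by exists N => m /HN; rewrite seg_sumZ.
Qed.

Lemma seg_int_eq phi psi a b :
  (forall w, seg_ball a b w -> phi w = psi w) -> seg_int phi a b = seg_int psi a b.
Proof.
move=> H; rewrite /seg_int; congr xget; apply/seteqP.
by split=> I HI e /HI[N HN]; exists N => m /HN; rewrite (seg_sum_eq m H).
Qed.

Lemma seg_int_le phi a b (M : K) : seg_continuous phi a b ->
  (forall w, seg_ball a b w -> `|phi w| <= M) -> `|seg_int phi a b| <= M * `|b - a|.
Proof.
move=> Hc HM; rewrite -[seg_int _ _ _]subr0.
apply: (seq_lim_le (seg_intP Hc)) => m; rewrite subr0; exact: seg_sum_le.
Qed.

Lemma seg_int_affine (c d : K) a b :
  seg_int (fun w => c + d * w) a b = c * (b - a) + d * (b ^+ 2 - a ^+ 2) / 2.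
Proof.
apply: seg_int_lim => e e0; exists 0%N => m _.
by rewrite seg_sum_affine subrr normr0.
Qed.

Lemma seg_int_mul phi (u : K) a b : seg_continuous (fun w => phi (u * w)) a b ->
  seg_int phi (u * a) (u * b) = u * seg_int (fun w => phi (u * w)) a b.
Proof.
move=> H1; apply: seg_int_lim => e /(seq_limZ u (seg_intP H1))[N HN].
by exists N => m /HN; rewrite seg_sum_mul.
Qed.

End SegmentIntegral.

(** * Goursat's lemma for squares *)

Section Goursat.
Context {K : numClosedFieldType}.
Hypothesis Harch : archimedean_scalars K.
Hypothesis Hcomplete : seq_complete (K : numFieldType)^o.
Implicit Types (phi psi : K -> K) (a b w : K).
Local Notation I := (@seg_int K).

Lemma differentiable_eps phi w :
  differentiable (phi : (K : numFieldType)^o -> (K : numFieldType)^o) w ->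
  continuous_at_eps phi w.
Proof.
move=> /differentiable_continuous H e e0.
have /nbhs_normP[d d0 Hd] : \forall y \near (w : (K : numFieldType)^o), `|phi w - phi y| < e.
  by move/cvgrPdist_lt: H => /(_ e e0).
exists d => // y yd; rewrite distrC ltW //; apply: Hd.
by rewrite /= distrC.
Qed.

Lemma differentiable_scalar phi w :
  differentiable (phi : (K : numFieldType)^o -> (K : numFieldType)^o) w ->
  exists L : K, is_diff w (phi : (K : numFieldType)^o -> (K : numFieldType)^o) (fun h => h * L).
Proof.
move=> H; exists ('d (phi : (K : numFieldType)^o -> (K : numFieldType)^o) w (1 : K)).
split=> //; apply/funext => h.
rewrite -[h in LHS]mulr1 -[h * 1]/((h : (K : numFieldType)) *: (1 : (K : numFieldType)^o)).
by rewrite linearZ.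
Qed.

Lemma continuous_eps_cst (c w : K) : continuous_at_eps (fun=> c) w.
Proof. by move=> e e0; exists 1 => // y _; rewrite subrr normr0 ltW. Qed.

Lemma continuous_epsD phi psi w : continuous_at_eps phi w -> continuous_at_eps psi w ->
  continuous_at_eps (fun y => phi y + psi y) w.
Proof.
move=> H1 H2 e e0; have [d d0 Hd] := H1 _ (half_gt0 e0).
have [d' d'0 Hd'] := H2 _ (half_gt0 e0); have [d1 d10 dd] := common_radius d0 d'0.
exists d1 => // y /dd[/Hd h1 /Hd' h2]; rewrite opprD addrACA -(half_half e).
by rewrite (le_trans (ler_normD _ _)) // lerD.
Qed.

Lemma continuous_epsZ (c : K) phi w : continuous_at_eps phi w ->
  continuous_at_eps (fun y => c * phi y) w.
Proof.
move=> H1 e e0; have c0 : 0 < `|c| + 1 by rewrite ltr_wpDl.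
have [d d0 Hd] := H1 _ (divr_gt0 e0 c0); exists d => // y /Hd h1.
rewrite -mulrBr normrM (@le_trans _ _ ((`|c| + 1) * `|phi y - phi w|)) //.
  by rewrite ler_wpM2r // lerDl.
by rewrite mulrC -ler_pdivlMr.
Qed.

(* The side [h] may be any scalar, so that rotated squares are covered. *)
Definition square_int phi (m h : K) : K :=
  let c1 := m - h / 2 - 'i * (h / 2) in let c2 := m + h / 2 - 'i * (h / 2) in
  let c3 := m + h / 2 + 'i * (h / 2) in let c4 := m - h / 2 + 'i * (h / 2) in
  I phi c1 c2 + I phi c2 c3 + I phi c3 c4 + I phi c4 c1.

(** Radius |h| is what the discs on the four edges require: their centres are at distance |h|/2 from
    [m] and their radii are |h|/2. *)
Definition ball_differentiable phi (m h : K) : Prop := forall w, `|w - m| <= `|h| ->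
  differentiable (phi : (K : numFieldType)^o -> (K : numFieldType)^o) w.

Lemma edge_ball (m h u : K) a b w : `|u| = 1 -> (a + b) / 2 = m + u * (h / 2) ->
  `|b - a| = `|h| -> seg_ball a b w -> `|w - m| <= `|h|.
Proof.
move=> u1 E1 E2; rewrite /seg_ball E1 E2 => H.
rewrite (le_trans (ler_distD (m + u * (h / 2)) _ _)) // -[leRHS]half_half lerD //.
by rewrite addrAC subrr add0r normrM u1 mul1r norm_half.
Qed.

Lemma square_edges (m h : K) w :
  let c1 := m - h / 2 - 'i * (h / 2) in let c2 := m + h / 2 - 'i * (h / 2) in
  let c3 := m + h / 2 + 'i * (h / 2) in let c4 := m - h / 2 + 'i * (h / 2) in
  [\/ seg_ball c1 c2 w, seg_ball c2 c3 w, seg_ball c3 c4 w | seg_ball c4 c1 w] ->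
  `|w - m| <= `|h|.
Proof.
move=> c1 c2 c3 c4 [].
- apply: (@edge_ball m h (- 'i)); rewrite ?normrN ?normCi //; first by rewrite /c1 /c2; field.
  by congr `|_|; rewrite /c1 /c2; field.
- apply: (@edge_ball m h 1); rewrite ?normr1 //; first by rewrite /c3 /c2; field.
  by rewrite -[RHS]mul1r -normCi -normrM; congr `|_|; rewrite /c3 /c2; field.
- apply: (@edge_ball m h 'i); rewrite ?normCi //; first by rewrite /c3 /c4; field.
  by rewrite -[RHS]normrN; congr `|_|; rewrite /c3 /c4; field.
- apply: (@edge_ball m h (- 1)); rewrite ?normrN1 //; first by rewrite /c1 /c4; field.
  by rewrite -[RHS]mul1r -normCi -normrM -normrN; congr `|_|; rewrite /c1 /c4; field.
Qed.

Definition square_continuous phi (m h : K) : Prop :=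
  forall w, `|w - m| <= `|h| -> continuous_at_eps phi w.

Lemma square_seg_continuous phi (m h : K) : square_continuous phi m h ->
  let c1 := m - h / 2 - 'i * (h / 2) in let c2 := m + h / 2 - 'i * (h / 2) in
  let c3 := m + h / 2 + 'i * (h / 2) in let c4 := m - h / 2 + 'i * (h / 2) in
  [/\ seg_continuous phi c1 c2, seg_continuous phi c2 c3,
      seg_continuous phi c3 c4 & seg_continuous phi c4 c1].
Proof.
move=> H c1 c2 c3 c4; split=> w Hw; apply/H/square_edges.
- by apply: Or41.
- by apply: Or42.
- by apply: Or43.
- by apply: Or44.
Qed.

Lemma square_intD phi psi m h : square_continuous phi m h -> square_continuous psi m h ->
  square_int (fun w => phi w + psi w) m h = square_int phi m h + square_int psi m h.
Proof.
move=> /square_seg_continuous[a1 a2 a3 a4] /square_seg_continuous[b1 b2 b3 b4].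
rewrite /square_int !seg_intD //.
by rewrite -!addrA; congr (_ + _); rewrite addrCA; congr (_ + _); rewrite [RHS]addrCA; ring.
Qed.

Lemma square_int_affine (c d m h : K) : square_int (fun w => c + d * w) m h = 0.
Proof. by rewrite /square_int !seg_int_affine //; field. Qed.

Lemma square_int_le phi m h (M : K) : square_continuous phi m h ->
  (forall w, `|w - m| <= `|h| -> `|phi w| <= M) -> `|square_int phi m h| <= 4 * M * `|h|.
Proof.
move=> Hc HM; have [a1 a2 a3 a4] := square_seg_continuous Hc.
have nrm (x : K) : x = h \/ x = 'i * h \/ x = - h \/ x = - ('i * h) -> `|x| = `|h|.
  by move=> [->|[->|[->|->]]]; rewrite ?normrN ?normrM ?normCi ?mul1r.
have bnd a b : seg_continuous phi a b -> `|b - a| = `|h| ->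
    (forall w, seg_ball a b w -> `|w - m| <= `|h|) -> `|I phi a b| <= M * `|h|.
  by move=> Hab E Hb; rewrite -E; apply: seg_int_le => // w /Hb; apply: HM.
have -> : 4 * M * `|h| = M * `|h| + M * `|h| + M * `|h| + M * `|h| by ring.
rewrite /square_int (le_trans (ler_normD _ _)) // lerD //.
  rewrite (le_trans (ler_normD _ _)) // lerD //.
    rewrite (le_trans (ler_normD _ _)) // lerD //.
      apply: bnd => // [|w Hw]; first by apply: nrm; left; field.
      by apply: square_edges; apply: Or41.
    apply: bnd => // [|w Hw]; first by apply: nrm; right; left; field.
    by apply: square_edges; apply: Or42.
  apply: bnd => // [|w Hw]; first by apply: nrm; right; right; left; field.
  by apply: square_edges; apply: Or43.
apply: bnd => // [|w Hw]; first by apply: nrm; right; right; right; field.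
by apply: square_edges; apply: Or44.
Qed.

(** The outer edges are cut at their midpoints, and the four inner edges meeting at [m] are run
    through once in each direction. *)
Lemma square_int_split phi m h : square_continuous phi m h ->
  square_int phi m h =
    square_int phi (m - h / 4 - 'i * (h / 4)) (h / 2) +
    square_int phi (m + h / 4 - 'i * (h / 4)) (h / 2) +
    square_int phi (m + h / 4 + 'i * (h / 4)) (h / 2) +
    square_int phi (m - h / 4 + 'i * (h / 4)) (h / 2).
Proof.
move=> Hc; have [a1 a2 a3 a4] := square_seg_continuous Hc.
set c1 := m - h / 2 - 'i * (h / 2) in a1 a4; set c2 := m + h / 2 - 'i * (h / 2) in a1 a2.
set c3 := m + h / 2 + 'i * (h / 2) in a2 a3; set c4 := m - h / 2 + 'i * (h / 2) in a3 a4.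
pose e1 := m - 'i * (h / 2); pose e2 := m + h / 2.
pose e3 := m + 'i * (h / 2); pose e4 := m - h / 2.
have rev (u e : K) : `|u| = 1 -> e = m + u * (h / 2) -> I phi m e = - I phi e m.
  move=> u1 ->; apply: seg_int_rev => // w Hw; apply: Hc.
  have h2 : `|h / 2| <= `|h| by rewrite norm_half ler_pdivrMr // ler_peMr // ler1n.
  apply: le_trans h2; apply: (@edge_ball m (h / 2) u) Hw => //; first by field.
  by rewrite opprD addNKr normrN normrM u1 mul1r.
have r1 := @rev (- 'i) e1; have r2 := @rev 1 e2; have r3 := @rev 'i e3.
have r4 := @rev (- 1) e4.
have -> : square_int phi m h = I phi c1 e1 + I phi e1 c2 + (I phi c2 e2 + I phi e2 c3)
    + (I phi c3 e3 + I phi e3 c4) + (I phi c4 e4 + I phi e4 c1).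
  rewrite /square_int -/c1 -/c2 -/c3 -/c4.
  rewrite (@seg_int_split _ Harch Hcomplete _ c1 c2 e1) //; last by rewrite /c1 /c2 /e1; field.
  rewrite (@seg_int_split _ Harch Hcomplete _ c2 c3 e2) //; last by rewrite /c3 /c2 /e2; field.
  rewrite (@seg_int_split _ Harch Hcomplete _ c3 c4 e3) //; last by rewrite /c3 /c4 /e3; field.
  by rewrite (@seg_int_split _ Harch Hcomplete _ c4 c1 e4) //; rewrite /c1 /c4 /e4; field.
have -> : square_int phi (m - h / 4 - 'i * (h / 4)) (h / 2) =
    I phi c1 e1 + I phi e1 m + I phi m e4 + I phi e4 c1.
  by rewrite /square_int; congr (_ + _ + _ + _); congr (I phi _ _);
     rewrite /c1 /e1 /e4; field.
have -> : square_int phi (m + h / 4 - 'i * (h / 4)) (h / 2) =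
    I phi e1 c2 + I phi c2 e2 + I phi e2 m + I phi m e1.
  by rewrite /square_int; congr (_ + _ + _ + _); congr (I phi _ _);
     rewrite /c2 /e1 /e2; field.
have -> : square_int phi (m + h / 4 + 'i * (h / 4)) (h / 2) =
    I phi m e2 + I phi e2 c3 + I phi c3 e3 + I phi e3 m.
  by rewrite /square_int; congr (_ + _ + _ + _); congr (I phi _ _);
     rewrite /c3 /e3 /e2; field.
have -> : square_int phi (m - h / 4 + 'i * (h / 4)) (h / 2) =
    I phi e4 m + I phi m e3 + I phi e3 c4 + I phi c4 e4.
  by rewrite /square_int; congr (_ + _ + _ + _); congr (I phi _ _);
     rewrite /c4 /e3 /e4; field.
rewrite r1 ?normrN ?normCi //; last by rewrite /e1; field.
rewrite r2 ?normr1 //; last by rewrite /e2; field.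
rewrite r3 ?normCi // r4 ?normrN1 //; last by rewrite /e4; field.
by ring.
Qed.

(** The allowed error e |h|^2 scales like the area, so a bad square has a bad quarter. At the limit
    point [phi] is affine up to o(|h|), and affine functions have integral 0 by the explicit formula
    for [seg_int]. *)
Theorem goursat phi m h : ball_differentiable phi m h -> square_int phi m h = 0.
Proof.
move=> Hdiff; apply/eqP; rewrite -normr_eq0 eq_le normr_ge0 andbT.
apply: le_of_le_add => e0' e0'0; rewrite add0r.
have h20 : 0 < `|h| ^+ 2 + 1 by rewrite ltr_wpDl // exprn_ge0.
have e0 := divr_gt0 e0'0 h20; set e := e0' / _ in e0.
suff : `|square_int phi m h| <= e * `|h| ^+ 2.
  move=> /le_trans; apply; rewrite /e mulrAC ler_pdivrMr // ler_pM2l //.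
  by rewrite lerDl.
pose P (x : K * K) := ball_differentiable phi x.1 x.2 ->
  `|square_int phi x.1 x.2| <= e * `|x.2| ^+ 2.
pose child (x y : K * K) := y.2 = x.2 / 2 /\ `|y.1 - x.1| <= `|x.2| / 2.
suff : P (m, h) by apply.
apply: contrapT => nP.
have sub x y : child x y -> ball_differentiable phi x.1 x.2 -> ball_differentiable phi y.1 y.2.
  move=> [E D] H w Hw; apply: H; rewrite (le_trans (ler_distD y.1 _ _)) //.
  by rewrite -[leRHS]half_half lerD // (le_trans Hw) // E norm_half.
have cont x : ball_differentiable phi x.1 x.2 -> square_continuous phi x.1 x.2.
  by move=> H w /H/differentiable_eps.
have := @bisection _ (K : numFieldType)^o (K * K) fst (fun x => `|x.2|) P child (m, h)
  Harch Hcomplete (normr_ge0 _).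
case=> // [x nx|x y [-> Hy]|u [l [u0 cu nu radu lu]]]; last first.
- have dball k : ball_differentiable phi (u k).1 (u k).2.
    by elim: k => [|k IH]; [rewrite u0 | apply: sub IH].
  have dl := dball 0%N l (lu 0%N).
  have [L dL] := differentiable_scalar dl.
  (* Tolerance e/8: on a square of side h the points are within 2 |h| of [l], so the remainder is at
     most (e/4) |h|, and the four edges contribute 4 |h| times this. *)
  have [d d0 Hd] := is_diff_epsilon dL (half_gt0 (half_gt0 (half_gt0 e0))).
  have [|N HN] := @half_pow_eventually _ Harch (2 * `|h|) d _ d0; first by rewrite mulr_ge0.
  apply: (nu N) => Hb; set x := u N in Hb *.
  pose R w := phi w + ((L * l - phi l) + - L * w).
  have cR w : `|w - x.1| <= `|x.2| -> continuous_at_eps R w.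
    move=> Hw; apply: continuous_epsD; first exact: (cont _ Hb).
    apply: continuous_epsD; first exact: continuous_eps_cst.
    apply: continuous_epsZ => e1 e10; exists e1 => // y; exact: ltW.
  have cA : square_continuous (fun w => (phi l - L * l) + L * w) x.1 x.2.
    move=> w Hw; apply: continuous_epsD; first exact: continuous_eps_cst.
    apply: continuous_epsZ => e1 e10; exists e1 => // y; exact: ltW.
  have -> : square_int phi x.1 x.2 = square_int R x.1 x.2.
    rewrite -[RHS]addr0 -(square_int_affine (phi l - L * l) L x.1 x.2) -square_intD //.
    have gen (A B Y Z : K) : A = A + ((Y - B) + - L * Z) + ((B - Y) + L * Z) by ring.
    have E : phi = (fun w => R w + ((phi l - L * l) + L * w)).
      by apply/funext => w; exact: (gen (phi w) (phi l) (L * l) w).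
    exact: (congr1 (fun F => square_int F x.1 x.2) E).
  have R_le w : `|w - x.1| <= `|x.2| -> `|R w| <= e / 4 * `|x.2|.
    move=> Hw; have wl : `|w - l| <= 2 * `|x.2|.
      rewrite (le_trans (ler_distD x.1 _ _)) // mulr2n mulrDl mul1r lerD //.
      by have := lu N; rewrite distrC.
    have wd : `|w - l| < d.
      by rewrite (le_lt_trans wl) // radu mulrA; apply: HN.
    have := Hd _ wd; rewrite subrKC.
    have gen (A B Y Z : K) : A - B - (Z - Y) * L = A + ((L * Y - B) + - L * Z) by ring.
    have -> : phi w - phi l - (w - l) * L = R w by exact: (gen (phi w) (phi l) l w).
    move=> /le_trans; apply.
    apply: (le_trans (ler_wpM2l (ltW (half_gt0 (half_gt0 (half_gt0 e0)))) wl)).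
    by rewrite mulrA ler_wpM2r // le_eqVlt; apply/orP; left; apply/eqP; field.
  have := square_int_le cR R_le => /le_trans; apply.
  by rewrite le_eqVlt; apply/orP; left; apply/eqP; field.
- by rewrite norm_half; split.
apply: contrapT => H; apply: nx => Hx.
have hh (y : K * K) : child x y -> `|square_int phi y.1 y.2| <= e * `|x.2| ^+ 2 / 4.
  move=> cy; have Py : P y by apply: contrapT => nPy; apply: H; exists y.
  have := Py (sub _ _ cy Hx); have [-> _] := cy; rewrite norm_half => /le_trans; apply.
  by rewrite le_eqVlt; apply/orP; left; apply/eqP; field.
have q (s t : K) : `|s| = 1 -> `|t| = 1 -> child x (x.1 + s * (x.2 / 4) + t * ('i * (x.2 / 4)), x.2 / 2).
  move=> s1 t1; split=> //=.
  have gen (X A B : K) : X + A + B - X = A + B by ring.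
  rewrite gen.
  rewrite (le_trans (ler_normD _ _)) // !normrM s1 t1 normCi !mul1r normfV.
  by rewrite (ger0_norm (ler0n _ 4)) le_eqVlt; apply/orP; left; apply/eqP; field.
rewrite square_int_split; last exact: cont.
have h1 := hh _ (q (-1) (-1) (normrN1 _) (normrN1 _)).
have h2 := hh _ (q 1 (-1) (normr1 _) (normrN1 _)).
have h3 := hh _ (q 1 1 (normr1 _) (normr1 _)).
have h4 := hh _ (q (-1) 1 (normrN1 _) (normr1 _)).
rewrite /= !mul1r !mulN1r in h1 h2 h3 h4.
have -> : e * `|x.2| ^+ 2 = e * `|x.2| ^+ 2 / 4 + e * `|x.2| ^+ 2 / 4 +
    e * `|x.2| ^+ 2 / 4 + e * `|x.2| ^+ 2 / 4 by field.
rewrite (le_trans (ler_normD _ _)) // lerD // (le_trans (ler_normD _ _)) // lerD //.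
by rewrite (le_trans (ler_normD _ _)) // lerD.
Qed.

End Goursat.

(** * The mean value property around a puncture *)

Section MeanValueProperty.
Context {K : numClosedFieldType}.
Hypothesis Harch : archimedean_scalars K.
Hypothesis Hcomplete : seq_complete (K : numFieldType)^o.
Implicit Types (phi psi : K -> K) (a b w : K).
Local Notation I := (@seg_int K).
Local Notation Kdiff psi w :=
  (differentiable (psi : (K : numFieldType)^o -> (K : numFieldType)^o) w).

(* The contour integral of [psi w / w] over the boundary of the square with
   vertices +-1 +-i: the part on the right side is [side_int psi], the other
   three are obtained by rotation, which preserves dw / w. *)
Definition side_int psi : K :=
  I (fun w => psi w / w) (1 - 'i) 1 + I (fun w => psi w / w) 1 (1 + 'i).

Definition rotate psi : K -> K := fun w => psi ('i * w).

Definition contour_int psi : K :=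
  side_int psi + side_int (rotate psi) + side_int (rotate (rotate psi)) +
  side_int (rotate (rotate (rotate psi))).

(** The annulus contains the discs on the two halves of the right side: centres 1 + i/2 and 1 - i/2,
    radius 1/2. It is invariant under rotation. *)
Definition annulus_continuous psi : Prop :=
  forall w, 2^-1 <= `|w| -> `|w| <= 2 -> continuous_at_eps psi w.

Definition punctured_differentiable psi : Prop :=
  forall w, w != 0 -> `|w| <= 2 -> Kdiff psi w.

Lemma norm_real_le (x y : K) : x \is Num.real -> y \is Num.real -> `|x| <= `|x + 'i * y|.
Proof.
move=> xR yR; rewrite -ler_sqr ?nnegrE // normC2_rect // real_normK // lerDl.
by rewrite real_exprn_even_ge0.
Qed.

Lemma continuous_eps_div psi w : w != 0 -> continuous_at_eps psi w ->
  continuous_at_eps (fun w => psi w / w) w.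
Proof.
move=> w0 cpsi e e0; pose r := `|w|; have r0 : 0 < r by rewrite normr_gt0.
(* Once |y| >= r/2, the quotient changes by at most e' (r + |psi w|) / (r/2 * r); the denominator of
   [e'] is this factor plus 1. *)
have N0 : 0 < 2 * (r + `|psi w|) / r ^+ 2 + 1.
  by rewrite ltr_wpDl // divr_ge0 ?exprn_ge0 // ?mulr_ge0 ?addr_ge0 // ltW.
have e'0 := divr_gt0 e0 N0; set e' := e / _ in e'0.
have [d d0 Hd] := cpsi _ e'0; have [d1 d10 dd1] := common_radius d0 (half_gt0 r0).
have [d2 d20 dd2] := common_radius d10 e'0.
exists d2 => // y yw; have [yd1 ye] := dd2 _ yw; have [yd yr] := dd1 _ yd1.
have yr2 : r / 2 <= `|y|.
  rewrite -(lerD2r (r / 2)) half_half /r -[w in leLHS](subrK y) addrC.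
  by rewrite (le_trans (ler_normD _ _)) // lerD2l distrC ltW.
have y0 : y != 0 by rewrite -normr_gt0 (lt_le_trans _ yr2) // half_gt0.
have -> : psi y / y - psi w / w = ((psi y - psi w) * w - psi w * (y - w)) / (y * w).
  by field; rewrite y0 w0.
rewrite normrM normfV normrM -/r.
have D0 : 0 < `|y| * r by rewrite mulr_gt0 // normr_gt0.
rewrite ler_pdivrMr // (le_trans (ler_normB _ _)) // !normrM -/r.
rewrite (@le_trans _ _ (e' * (r + `|psi w|))) //.
  rewrite mulrDr lerD //; first by rewrite ler_wpM2r ?Hd // ltW.
  by rewrite mulrC ler_wpM2r // ltW.
rewrite (@le_trans _ _ (e * (r / 2 * r))) //; last first.
  by rewrite ler_wpM2l ?(ltW e0) // ler_wpM2r // ltW.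
rewrite /e' -mulrA ler_wpM2l ?(ltW e0) // mulrC ler_pdivrMr //.
rewrite mulrDr mulr1 -[leLHS]addr0 lerD //; last by rewrite mulr_ge0 ?ltW // half_gt0.
by rewrite le_eqVlt; apply/orP; left; apply/eqP; field; exact: lt0r_neq0.
Qed.

Lemma ball_norm (m w s : K) : `|w - m| <= s -> `|m| <= `|w| + s /\ `|w| <= `|m| + s.
Proof.
move=> H; split.
  rewrite -[m in leLHS](subrK w) addrC (le_trans (ler_normD _ _)) // lerD2l.
  by rewrite distrC.
by rewrite -[w in leLHS](subrK m) addrC (le_trans (ler_normD _ _)) // lerD2l.
Qed.

Lemma norm_half_one : `|2^-1 : K| = 2^-1.
Proof. by rewrite normfV (ger0_norm (ler0n _ 2)). Qed.

Lemma half_ball (y : K) w : y \is Num.real -> `|y| = 2^-1 ->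
  `|w - (1 + 'i * y)| <= 2^-1 -> 2^-1 <= `|w| /\ `|w| <= 2.
Proof.
move=> yR ny /ball_norm[h1 h2].
have m1 : `|1 : K| <= `|1 + 'i * y| by apply: norm_real_le; rewrite ?rpred1.
have m2 : `|1 + 'i * y| <= 1 + 2^-1.
  by rewrite (le_trans (ler_normD _ _)) // normrM normCi normr1 mul1r ny.
have half1 : 2^-1 + 2^-1 = 1 :> K by rewrite [RHS]splitr !mul1r.
split.
  by rewrite -(lerD2r 2^-1) half1 (le_trans _ h1) // (le_trans _ m1) // normr1.
by rewrite (le_trans h2) // (le_trans (lerD m2 (lexx _))) // -addrA half1 -natr1.
Qed.

Lemma half_real : (2^-1 : K) \is Num.real.
Proof. by rewrite rpredV realn. Qed.

Lemma seg_ball_upper w : seg_ball 1 (1 + 'i) w -> 2^-1 <= `|w| /\ `|w| <= 2.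
Proof.
rewrite /seg_ball.
have -> : (1 + (1 + 'i)) / 2 = 1 + 'i * 2^-1 :> K by field.
have -> : 1 + 'i - 1 = 'i :> K by ring.
by rewrite normCi mul1r; apply: half_ball; rewrite ?half_real ?norm_half_one.
Qed.

Lemma seg_ball_lower w : seg_ball (1 - 'i) 1 w -> 2^-1 <= `|w| /\ `|w| <= 2.
Proof.
rewrite /seg_ball.
have -> : (1 - 'i + 1) / 2 = 1 + 'i * (- 2^-1) :> K by field.
have -> : 1 - (1 - 'i) = 'i :> K by ring.
by rewrite normCi mul1r; apply: half_ball; rewrite ?rpredN ?half_real ?normrN ?norm_half_one.
Qed.

Lemma annulus_neq0 w : 2^-1 <= `|w| -> w != 0.
Proof. by move=> H; rewrite -normr_gt0 (lt_le_trans _ H) // invr_gt0. Qed.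

Lemma annulus_seg_continuous psi : annulus_continuous psi ->
  seg_continuous (fun w => psi w / w) (1 - 'i) 1 /\
  seg_continuous (fun w => psi w / w) 1 (1 + 'i).
Proof.
move=> H; split=> w; [move=> /seg_ball_lower[h1 h2]|move=> /seg_ball_upper[h1 h2]].
  by apply: continuous_eps_div; [apply: annulus_neq0|apply: H].
by apply: continuous_eps_div; [apply: annulus_neq0|apply: H].
Qed.

Lemma side_intD phi psi : annulus_continuous phi -> annulus_continuous psi ->
  side_int (fun w => phi w + psi w) = side_int phi + side_int psi.
Proof.
move=> /annulus_seg_continuous[a1 a2] /annulus_seg_continuous[b1 b2].
rewrite /side_int addrACA -!seg_intD //; congr (_ + _); apply: seg_int_eq => w _;
  by rewrite mulrDl.
Qed.

Lemma side_intZ (c : K) psi : annulus_continuous psi ->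
  side_int (fun w => c * psi w) = c * side_int psi.
Proof.
move=> /annulus_seg_continuous[a1 a2].
rewrite /side_int mulrDr -!seg_intZ //; congr (_ + _); apply: seg_int_eq => w _;
  by rewrite mulrA.
Qed.

(** On the annulus |1/w| <= 2, and the side has length 2. *)
Lemma side_int_le psi (M : K) : annulus_continuous psi ->
  (forall w, 2^-1 <= `|w| -> `|w| <= 2 -> `|psi w| <= M) -> `|side_int psi| <= 4 * M.
Proof.
move=> /annulus_seg_continuous[a1 a2] H.
have bnd w : 2^-1 <= `|w| -> `|w| <= 2 -> `|psi w / w| <= 2 * M.
  move=> h1 h2; have w0 : 0 < `|w| by rewrite normr_gt0 annulus_neq0.
  have M0 : 0 <= M by rewrite (le_trans _ (H w h1 h2)).
  rewrite normrM normfV ler_pdivrMr // (le_trans (H w h1 h2)) // mulrAC.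
  by rewrite ler_peMl // mulrC -ler_pdivrMr // mul1r.
have -> : 4 * M = 2 * M * `|1 - (1 - 'i)| + 2 * M * `|1 + 'i - 1|.
  have -> : 1 - (1 - 'i) = 'i :> K by ring.
  have -> : 1 + 'i - 1 = 'i :> K by ring.
  by rewrite normCi; ring.
rewrite /side_int (le_trans (ler_normD _ _)) // lerD //; apply: seg_int_le => // w.
  by move=> /seg_ball_lower[h1 h2]; apply: bnd.
by move=> /seg_ball_upper[h1 h2]; apply: bnd.
Qed.

Lemma annulus_rotate psi : annulus_continuous psi -> annulus_continuous (rotate psi).
Proof.
move=> H w h1 h2 e e0; have iw : `|'i * w| = `|w| by rewrite normrM normCi mul1r.
have [||d d0 Hd] := H ('i * w) _ _ e e0; rewrite ?iw //.
by exists d => // y yd; apply: Hd; rewrite -mulrBr normrM normCi mul1r.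
Qed.

Lemma contour_intD phi psi : annulus_continuous phi -> annulus_continuous psi ->
  contour_int (fun w => phi w + psi w) = contour_int phi + contour_int psi.
Proof.
move=> a0 b0; have a1 := annulus_rotate a0; have b1 := annulus_rotate b0.
have a2 := annulus_rotate a1; have b2 := annulus_rotate b1.
have a3 := annulus_rotate a2; have b3 := annulus_rotate b2.
rewrite /contour_int side_intD // [X in _ + X + _ + _]side_intD //.
rewrite [X in _ + _ + X + _]side_intD // [X in _ + _ + _ + X]side_intD //.
by ring.
Qed.

Lemma contour_intZ (c : K) psi : annulus_continuous psi ->
  contour_int (fun w => c * psi w) = c * contour_int psi.
Proof.
move=> a0; have a1 := annulus_rotate a0; have a2 := annulus_rotate a1.
have a3 := annulus_rotate a2.
rewrite /contour_int side_intZ // [X in _ + X + _ + _]side_intZ //.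
rewrite [X in _ + _ + X + _]side_intZ // [X in _ + _ + _ + X]side_intZ //.
by ring.
Qed.

Lemma contour_int_le psi (M : K) : annulus_continuous psi ->
  (forall w, 2^-1 <= `|w| -> `|w| <= 2 -> `|psi w| <= M) -> `|contour_int psi| <= 16 * M.
Proof.
move=> a0 H; have a1 := annulus_rotate a0; have a2 := annulus_rotate a1.
have a3 := annulus_rotate a2.
have rot (phi : K -> K) : (forall w, 2^-1 <= `|w| -> `|w| <= 2 -> `|phi w| <= M) ->
    (forall w, 2^-1 <= `|w| -> `|w| <= 2 -> `|rotate phi w| <= M).
  by move=> Hp w h1 h2; apply: Hp; rewrite normrM normCi mul1r.
have H1 := rot _ H; have H2 := rot _ H1; have H3 := rot _ H2.
have -> : 16 * M = 4 * M + 4 * M + 4 * M + 4 * M by ring.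
rewrite /contour_int (le_trans (ler_normD _ _)) // lerD //; last first.
  exact: side_int_le.
rewrite (le_trans (ler_normD _ _)) // lerD //; last first.
  exact: side_int_le.
by rewrite (le_trans (ler_normD _ _)) // lerD //; apply: side_int_le.
Qed.

(** The form dw/w is invariant under the scaling w -> u w. *)
Lemma seg_int_dlog psi (u : K) a b : u != 0 ->
  seg_continuous (fun w => psi (u * w) / w) a b ->
  I (fun w => psi w / w) (u * a) (u * b) = I (fun w => psi (u * w) / w) a b.
Proof.
move=> u0 H.
have E : (fun w => psi (u * w) / (u * w)) = (fun w => u^-1 * (psi (u * w) / w)).
  by apply/funext => w; rewrite invfM mulrCA.
rewrite seg_int_mul //; last first.
  by rewrite E => w /H; apply: continuous_epsZ.
by rewrite E seg_intZ // mulVKf.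
Qed.

Lemma punctured_continuous psi : punctured_differentiable psi -> annulus_continuous psi.
Proof. by move=> H w h1 h2; apply/differentiable_eps/H => //; apply: annulus_neq0. Qed.

Lemma punctured_mul psi (u : K) : u != 0 -> `|u| <= 1 -> punctured_differentiable psi ->
  punctured_differentiable (fun w => psi (u * w)).
Proof.
move=> u0 u1 H w w0 w2; have uw0 : u * w != 0 by rewrite mulf_neq0.
have uw2 : `|u * w| <= 2 by rewrite normrM (le_trans _ w2) // ler_piMl.
have d1 : is_diff (w : (K : numFieldType)^o)
    ((fun w => u * w) : (K : numFieldType)^o -> (K : numFieldType)^o) ( *%R u).
  exact: (@is_diffZ _ _ _ id id u w (is_diff_id _)).
have [dd _] := is_diff_comp d1 (differentiableP (H _ uw0 uw2)); exact: dd.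
Qed.

Lemma punctured_rotate psi : punctured_differentiable psi ->
  punctured_differentiable (rotate psi).
Proof. by apply: punctured_mul; rewrite ?neq0Ci ?normCi. Qed.

Lemma punctured_div psi w : punctured_differentiable psi -> w != 0 -> `|w| <= 2 ->
  Kdiff (fun w => psi w / w) w.
Proof.
move=> H w0 w2; exact: (differentiableM (H w w0 w2) (differentiable_Rinv w0)).
Qed.

(** The centre has real part 3/4 and the disc used by Goursat has radius 1/2, so it stays away from
    0; the bound on [y] keeps it inside |w| <= 2. *)
Lemma strip_square psi (y : K) : punctured_differentiable psi ->
  y \is Num.real -> `|y| <= 3 / 4 ->
  ball_differentiable (fun w => psi w / w) (3 / 4 + 'i * y) 2^-1.
Proof.
move=> H yR y34 w; rewrite norm_half_one => /ball_norm[h1 h2].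
have p34 : `|3 / 4 : K| = 3 / 4 by rewrite ger0_norm // divr_ge0.
have m1 : `|3 / 4 : K| <= `|3 / 4 + 'i * y|.
  by apply: norm_real_le => //; rewrite rpred_div // realn.
have m2 : `|3 / 4 + 'i * y| <= 3 / 4 + 3 / 4.
  by rewrite (le_trans (ler_normD _ _)) // p34 lerD2l normrM normCi mul1r.
apply: punctured_div => //.
  rewrite -normr_gt0 -(ltrD2r 2^-1) add0r (lt_le_trans _ h1) // (lt_le_trans _ m1) // p34.
  have -> : 3 / 4 = 2^-1 + 4^-1 :> K by field.
  by rewrite ltrDl invr_gt0.
rewrite (le_trans h2) // (le_trans (lerD m2 (lexx _))) //.
by rewrite le_eqVlt; apply/orP; left; apply/eqP; field.
Qed.

(* The outer and the inner square boundary differ by four rotated copies of a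
   strip made of three squares of side 1/2, on each of which Goursat applies. *)
Lemma strip_identity psi : punctured_differentiable psi ->
  side_int psi - side_int (fun w => psi (2^-1 * w)) =
  I (fun w => psi w / w) (1 - 'i) (1 - 'i / 2)
    - I (fun w => rotate psi w / w) (1 - 'i) (1 - 'i / 2)
    - I (fun w => psi w / w) (2^-1 - 'i / 2) (1 - 'i / 2)
    + I (fun w => rotate psi w / w) (2^-1 - 'i / 2) (1 - 'i / 2).
Proof.
move=> H; pose phi w := psi w / w.
(* The A's have real part 1/2 and the B's real part 1, at heights -1/2, 0, 1/2, 1; [B'] is the lower
   right corner. The strip reaches the top of the outer square but not its bottom: four quarter
   turns of it tile the region between the two squares as a pinwheel. *)
pose A0 : K := 2^-1 - 'i / 2; pose A1 : K := 2^-1; pose A2 : K := 2^-1 + 'i / 2.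
pose A3 : K := 2^-1 + 'i; pose B0 : K := 1 - 'i / 2; pose B1 : K := 1.
pose B2 : K := 1 + 'i / 2; pose B3 : K := 1 + 'i; pose B' : K := 1 - 'i.
have ii : 'i * 'i = -1 :> K by rewrite -expr2 sqrCi.
have strip (chi : K -> K) (y : K) (P Q R S : K) : punctured_differentiable chi ->
    y \is Num.real -> `|y| <= 3 / 4 ->
    P = 2^-1 + 'i * (y - 4^-1) -> Q = 1 + 'i * (y - 4^-1) ->
    R = 1 + 'i * (y + 4^-1) -> S = 2^-1 + 'i * (y + 4^-1) ->
    let chi' w := chi w / w in
    I chi' P Q + I chi' Q R + I chi' R S + I chi' S P = 0 /\
    [/\ seg_continuous chi' P Q, seg_continuous chi' Q R,
        seg_continuous chi' R S & seg_continuous chi' S P].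
  move=> Hchi yR y34 EP EQ ER ES chi'; have Hb := strip_square Hchi yR y34.
  have Hc : square_continuous chi' (3 / 4 + 'i * y) 2^-1.
    by move=> w /Hb; apply: differentiable_eps.
  have := goursat Harch Hcomplete Hb; have := square_seg_continuous Hc.
  rewrite /square_int.
  have -> : 3 / 4 + 'i * y - 2^-1 / 2 - 'i * (2^-1 / 2) = P by rewrite EP; field.
  have -> : 3 / 4 + 'i * y + 2^-1 / 2 - 'i * (2^-1 / 2) = Q by rewrite EQ; field.
  have -> : 3 / 4 + 'i * y + 2^-1 / 2 + 'i * (2^-1 / 2) = R by rewrite ER; field.
  have -> : 3 / 4 + 'i * y - 2^-1 / 2 + 'i * (2^-1 / 2) = S by rewrite ES; field.
  by [].
have q4R : (4^-1 : K) \is Num.real by rewrite rpredV realn.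
have n4 : `|4^-1 : K| = 4^-1 by rewrite normfV (ger0_norm (ler0n _ 4)).
have q4le : 4^-1 <= 3 / 4 :> K by rewrite ler_peMl ?invr_ge0 // ler1n.
have [S1 [c1 c2 c3 c4]] := strip psi (- 4^-1) A0 B0 B1 A1 H ltac:(by rewrite rpredN)
  ltac:(by rewrite normrN n4) ltac:(by rewrite /A0; field) ltac:(by rewrite /B0; field)
  ltac:(by rewrite /B1; field) ltac:(by rewrite /A1; field).
have [S2 [d1 d2 d3 d4]] := strip psi 4^-1 A1 B1 B2 A2 H q4R
  ltac:(by rewrite n4) ltac:(by rewrite /A1; field) ltac:(by rewrite /B1; field)
  ltac:(by rewrite /B2; field) ltac:(by rewrite /A2; field).
have [S3 [e1 e2 e3 e4]] := strip psi (3 / 4) A2 B2 B3 A3 H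
  ltac:(by rewrite rpred_div // realn)
  ltac:(by rewrite ger0_norm // divr_ge0) ltac:(by rewrite /A2; field) ltac:(by rewrite /B2; field)
  ltac:(by rewrite /B3; field) ltac:(by rewrite /A3; field).
have Hr := punctured_rotate H.
have [_ [r1 _ _ _]] := strip (rotate psi) (- 4^-1) A0 B0 B1 A1 Hr ltac:(by rewrite rpredN)
  ltac:(by rewrite normrN n4) ltac:(by rewrite /A0; field) ltac:(by rewrite /B0; field)
  ltac:(by rewrite /B1; field) ltac:(by rewrite /A1; field).
have [s1 s2] := annulus_seg_continuous (punctured_continuous H).
have [t1 t2] := annulus_seg_continuous (punctured_continuous Hr).
have Hh : punctured_differentiable (fun w => psi (2^-1 * w)).
  by apply: punctured_mul => //; rewrite norm_half_one invf_le1 // ler1n.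
have [h1 h2] := annulus_seg_continuous (punctured_continuous Hh).
have half0 : 2^-1 != 0 :> K by rewrite invr_eq0.
have E1 : I (fun w => psi (2^-1 * w) / w) (1 - 'i) 1 = I phi A0 A1.
  rewrite -(seg_int_dlog half0 h1); congr (I _ _ _); first by rewrite /A0; field.
  by rewrite /A1; field.
have E2 : I (fun w => psi (2^-1 * w) / w) 1 (1 + 'i) = I phi A1 A2.
  rewrite -(seg_int_dlog half0 h2); congr (I _ _ _); first by rewrite /A1; field.
  by rewrite /A2; field.
have B0E : B0 = (1 - 'i + 1) / 2 by rewrite /B0; field.
(* Multiplication by i sends [B'] to [B3] and [B0] to [A3]: the top edge of the strip, read for
   [psi], is a segment of the right-hand strip read for [rotate psi]. This form lets the terms
   telescope over the rotations. *)
have E3 : I (fun w => rotate psi w / w) (1 - 'i) (1 - 'i / 2) = I phi B3 A3.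
  have t1' : seg_continuous (fun w => rotate psi w / w) B' B0.
    by rewrite B0E; apply: seg_continuous_l.
  rewrite -/B' -/B0 -(seg_int_dlog (neq0Ci K) t1'); congr (I _ _ _).
    by rewrite /B3 /B' mulrBr ii; ring.
  by rewrite /A3 /B0 mulrBr mulrA ii; field.
have E4 : I (fun w => rotate psi w / w) (2^-1 - 'i / 2) (1 - 'i / 2) = I phi A2 A3.
  rewrite -/A0 -/B0 -(seg_int_dlog (neq0Ci K) r1); congr (I _ _ _).
    by rewrite /A0 /A2 mulrBr mulrA ii; field.
  by rewrite /A3 /B0 mulrBr mulrA ii; field.
rewrite E3 E4 -/A0 -/B0 -/B' {2}/side_int E1 E2 /side_int -/phi -/B' -/B1 -/B3.
rewrite (@seg_int_split _ Harch Hcomplete phi B' B1 B0) //.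
rewrite (@seg_int_split _ Harch Hcomplete phi B1 B3 B2) //; last by rewrite /B1 /B2 /B3; field.
have R1 : I phi A0 A1 = - I phi A1 A0 by apply: seg_int_rev.
have R2 : I phi A1 A2 = - I phi A2 A1 by apply: seg_int_rev.
have R3 : I phi A2 A3 = - I phi A3 A2 by apply: seg_int_rev.
have R4 : I phi B1 A1 = - I phi A1 B1 by apply: seg_int_rev.
have R5 : I phi B2 A2 = - I phi A2 B2 by apply: seg_int_rev.
rewrite R4 in S1; rewrite R5 in S2; rewrite R1 R2 R3.
apply/eqP; rewrite -subr_eq0; apply/eqP.
rewrite -/phi in S1 S2 S3.
transitivity ((I phi A0 B0 + I phi B0 B1 + - I phi A1 B1 + I phi A1 A0) +
  (I phi A1 B1 + I phi B1 B2 + - I phi A2 B2 + I phi A2 A1) +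
  (I phi A2 B2 + I phi B2 B3 + I phi B3 A3 + I phi A3 A2)); first by ring.
by rewrite S1 S2 S3 !addr0.
Qed.

Lemma rotate4 psi : rotate (rotate (rotate (rotate psi))) = psi.
Proof.
apply/funext => w; rewrite /rotate !mulrA; congr psi.
have ii : 'i * 'i = -1 :> K by rewrite -expr2 sqrCi.
by rewrite ii mulN1r mulNr ii opprK mul1r.
Qed.

(** In the sum of the strip identities over the four rotations the boundary terms cancel cyclically,
    because four quarter turns give the identity. *)
Lemma contour_int_half psi : punctured_differentiable psi ->
  contour_int psi = contour_int (fun w => psi (2^-1 * w)).
Proof.
move=> H; have H1 := punctured_rotate H; have H2 := punctured_rotate H1.
have H3 := punctured_rotate H2.
have S0 := strip_identity H; have S1 := strip_identity H1.
have S2 := strip_identity H2; have S3 := strip_identity H3.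
rewrite rotate4 in S3.
have rh (chi : K -> K) : rotate (fun w => chi (2^-1 * w)) = (fun w => rotate chi (2^-1 * w)).
  by apply/funext => w; rewrite /rotate mulrCA.
apply/eqP; rewrite -subr_eq0; apply/eqP; rewrite /contour_int !rh.
have -> (a b c d a' b' c' d' : K) : a + b + c + d - (a' + b' + c' + d') =
  (a - a') + (b - b') + (c - c') + (d - d') by ring.
by rewrite S0 S1 S2 S3; ring.
Qed.

(** The value for complex scalars is i pi/2; a crude approximation by 2i suffices to exclude 0, and
    it comes from replacing 1/w by a constant on each half of the side. *)
Lemma side_int_one : `|side_int (fun=> 1) - 2 * 'i| <= 1.
Proof.
(* Inversion maps the disc with centre c and radius r to the one with centre c^*/(|c|^2 - r^2) and
   radius r/(|c|^2 - r^2); here |c|^2 - r^2 = 1, so the image is the conjugate disc. *)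
have disc (y : K) w : y \is Num.real -> `|y| = 2^-1 -> `|w - (1 + 'i * y)| <= 2^-1 ->
    `|1 / w - (1 - 'i * y)| <= 2^-1.
  move=> yR ny H; have [h1 h2] := half_ball yR ny H; have w0 := annulus_neq0 h1.
  have yC : y^* = y by apply/CrealP.
  have y2 : y * y = 4^-1.
    by have := normCK y; rewrite yC ny => <-; field.
  have -> : 1 / w - (1 - 'i * y) = (1 - w * (1 - 'i * y)) / w by field.
  rewrite normrM normfV ler_pdivrMr ?normr_gt0 // -ler_sqr ?nnegrE ?mulr_ge0 //.
  pose d := w - (1 + 'i * y); have dE : w = 1 + 'i * y + d by rewrite /d; ring.
  have d2 : d * d^* <= 4^-1.
    rewrite -normCK -/d in H *; have -> : 4^-1 = 2^-1 ^+ 2 :> K by field.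
    by rewrite ler_sqr ?nnegrE.
  have ii : 'i * 'i = -1 :> K by rewrite -expr2 sqrCi.
  clearbody d; rewrite exprMn !normCK !(rmorphB, rmorphM, rmorphD, rmorph1) /= conjCi yC dE.
  rewrite !(rmorphB, rmorphM, rmorphD, rmorph1) /= conjCi yC.
  rewrite -subr_ge0; pose P := 'i * y.
  have PP : P * P = - 4^-1 by rewrite /P mulrACA ii y2 mulN1r.
  have F1 : 1 - (1 + P + d) * (1 - P) = - 4^-1 - d * (1 - P).
    have -> : 1 - (1 + P + d) * (1 - P) = P * P - d * (1 - P) by ring.
    by rewrite PP.
  have F2 : 1 - (1 - P + d^*) * (1 + P) = - 4^-1 - d^* * (1 + P).
    have -> : 1 - (1 - P + d^*) * (1 + P) = P * P - d^* * (1 + P) by ring.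
    by rewrite PP.
  rewrite mulNr opprK -/P F1 F2.
  have -> : 2^-1 ^+ 2 * ((1 + P + d) * (1 - P + d^*)) -
     (- 4^-1 - d * (1 - P)) * (- 4^-1 - d^* * (1 + P)) =
     4^-1 - d * d^* + (4^-1 + P * P) * (d * d^* - 4^-1) by field.
  by rewrite PP subrr mul0r addr0 subr_ge0.
have cont1 := annulus_seg_continuous (fun w _ _ => continuous_eps_cst 1 w).
have half a b (C : K) : seg_continuous (fun w => 1 / w) a b -> b - a = 'i ->
    (forall w, seg_ball a b w -> `|1 / w - C| <= 2^-1) ->
    `|I (fun w => 1 / w) a b - C * 'i| <= 2^-1.
  move=> Hab ba HC.
  have cc : seg_continuous (fun=> - C) a b by move=> w _; apply: continuous_eps_cst.
  have -> : I (fun w => 1 / w) a b - C * 'i = I (fun w => 1 / w + - C) a b.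
    rewrite seg_intD //; congr (_ + _).
    have -> : (fun=> - C) = (fun w => - C + 0 * w) by apply/funext => w; rewrite mul0r addr0.
    by rewrite seg_int_affine // ba !mul0r addr0 mulNr.
  have cs : seg_continuous (fun w => 1 / w + - C) a b.
    by move=> w Hw; apply: continuous_epsD; [apply: Hab|apply: cc].
  by have := seg_int_le Harch Hcomplete cs HC; rewrite ba normCi mulr1.
have [k1 k2] := cont1.
have e1 : `|I (fun w => 1 / w) (1 - 'i) 1 - (1 - 'i * (- 2^-1)) * 'i| <= 2^-1.
  apply: half => //; first by ring.
  move=> w; rewrite /seg_ball.
  have -> : (1 - 'i + 1) / 2 = 1 + 'i * (- 2^-1) :> K by field.
  have -> : 1 - (1 - 'i) = 'i :> K by ring.
  by rewrite normCi (mul1r 2^-1); apply: disc; rewrite ?rpredN ?half_real ?normrN ?norm_half_one.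
have e2 : `|I (fun w => 1 / w) 1 (1 + 'i) - (1 - 'i * 2^-1) * 'i| <= 2^-1.
  apply: half => //; first by ring.
  move=> w; rewrite /seg_ball.
  have -> : (1 + (1 + 'i)) / 2 = 1 + 'i * 2^-1 :> K by field.
  have -> : 1 + 'i - 1 = 'i :> K by ring.
  by rewrite normCi (mul1r 2^-1); apply: disc; rewrite ?half_real ?norm_half_one.
rewrite /side_int; set X := I _ _ _ in e1 *; set Y := I _ _ _ in e2 *.
have -> : X + Y - 2 * 'i = (X - (1 - 'i * (- 2^-1)) * 'i) + (Y - (1 - 'i * 2^-1) * 'i).
  by ring.
rewrite (le_trans (ler_normD _ _)) // (le_trans (lerD e1 e2)) //.
by rewrite [leRHS]splitr !mul1r.
Qed.

Lemma contour_int_one : contour_int (fun=> 1) != 0.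
Proof.
have -> : contour_int (fun=> 1) = 4 * side_int (fun=> 1) by rewrite /contour_int /rotate; ring.
rewrite mulf_neq0 ?pnatr_eq0 //; apply/eqP => E; have := side_int_one.
rewrite E sub0r normrN normrM normCi mulr1 (ger0_norm (ler0n _ 2)).
by rewrite lern1.
Qed.

(** Dividing by the integral of dw/w plays the part of the factor 1/(2 pi i) in Cauchy's formula. *)
Definition circle_mean psi : K := contour_int psi / contour_int (fun=> 1).

(** The contour integral does not change when [psi] is precomposed with halving; iterating, only
    values near 0 matter, and continuity at 0 identifies the limit. Allowing a puncture at 0 is
    essential: the formula is applied to difference quotients. *)
Theorem mean_value_property psi : punctured_differentiable psi ->
  continuous_at_eps psi 0 -> circle_mean psi = psi 0.
Proof.
move=> H Hc; pose f k (w : K) := psi (2^-1 ^+ k * w).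
have h1 : `|2^-1 : K| <= 1 by rewrite norm_half_one invf_le1 // ler1n.
have h0 : 2^-1 != 0 :> K by rewrite invr_eq0.
have fS k : f k.+1 = (fun w => f k (2^-1 * w)).
  by apply/funext => w; rewrite /f exprSr mulrA.
have pf k : punctured_differentiable (f k).
  elim: k => [|k IH]; first by have -> : f 0%N = psi by apply/funext => w; rewrite /f mul1r.
  by rewrite fS; apply: punctured_mul.
have Ef k : contour_int (f k) = contour_int psi.
  elim: k => [|k IH]; first by congr contour_int; apply/funext => w; rewrite /f mul1r.
  by rewrite fS -contour_int_half.
suff E : contour_int psi = psi 0 * contour_int (fun=> 1).
  by rewrite /circle_mean E mulfK // contour_int_one.
apply/eqP; rewrite -subr_eq0 -normr_eq0 eq_le normr_ge0 andbT.
apply: le_of_le_add => e e0; rewrite add0r.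
(* 16 is the constant of [contour_int_le]. *)
have e16 : 0 < e / 16 by rewrite divr_gt0.
have [d d0 Hd] := Hc _ e16.
have [N HN] := half_pow_eventually Harch (ler0n K 2) d0.
have c1 : annulus_continuous (fun=> 1) by move=> w _ _; apply: continuous_eps_cst.
have cf := punctured_continuous (pf N).
have cg : annulus_continuous (fun w => - psi 0 * 1) by move=> w _ _; apply: continuous_eps_cst.
rewrite -(Ef N) -mulNr -contour_intZ // -contour_intD //.
have -> : e = 16 * (e / 16) by field.
apply: contour_int_le => [w w1 w2|w w1 w2].
  by apply: continuous_epsD; [apply: cf|apply: cg].
rewrite mulr1; apply: Hd; rewrite subr0 normrM normrX norm_half_one.
rewrite (le_lt_trans _ (HN N (leqnn N))) // mulrC ler_wpM2r // exprn_ge0 //.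
Qed.

Lemma circle_mean_le psi (M : K) : annulus_continuous psi ->
  (forall w, 2^-1 <= `|w| -> `|w| <= 2 -> `|psi w| <= M) ->
  `|circle_mean psi| <= 16 / `|contour_int (fun=> 1)| * M.
Proof.
move=> Hc HM; rewrite normrM normfV mulrAC.
by rewrite ler_wpM2r ?invr_ge0 // contour_int_le.
Qed.

Lemma circle_mean_eq phi psi :
  (forall w, 2^-1 <= `|w| -> `|w| <= 2 -> phi w = psi w) -> circle_mean phi = circle_mean psi.
Proof.
move=> H; have rot (f g : K -> K) : (forall w, 2^-1 <= `|w| -> `|w| <= 2 -> f w = g w) ->
    forall w, 2^-1 <= `|w| -> `|w| <= 2 -> rotate f w = rotate g w.
  by move=> fg w h1 h2; apply: fg; rewrite normrM normCi mul1r.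
have side (f g : K -> K) : (forall w, 2^-1 <= `|w| -> `|w| <= 2 -> f w = g w) ->
    side_int f = side_int g.
  move=> fg; congr (_ + _); apply: seg_int_eq => w.
    by move=> /seg_ball_lower[h1 h2]; rewrite fg.
  by move=> /seg_ball_upper[h1 h2]; rewrite fg.
have H1 := rot _ _ H; have H2 := rot _ _ H1; have H3 := rot _ _ H2.
rewrite /circle_mean; congr (_ / _).
by congr (_ + _ + _ + _); apply: side.
Qed.

Lemma circle_meanD phi psi : annulus_continuous phi -> annulus_continuous psi ->
  circle_mean (fun w => phi w + psi w) = circle_mean phi + circle_mean psi.
Proof. by move=> H1 H2; rewrite /circle_mean contour_intD // mulrDl. Qed.

Lemma circle_meanZ (c : K) psi : annulus_continuous psi ->
  circle_mean (fun w => c * psi w) = c * circle_mean psi.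
Proof. by move=> H1; rewrite /circle_mean contour_intZ // mulrA. Qed.

End MeanValueProperty.

(** * Differentiability of the derivative of a complex differentiable function *)

Section HolomorphicSmooth.
Context {K : numClosedFieldType}.
Hypothesis Harch : archimedean_scalars K.
Hypothesis Hcomplete : seq_complete (K : numFieldType)^o.
Local Notation KK := (K : numFieldType).
Context {E : normedModType KK}.
Hypothesis HE : seq_complete E.
Variables (D : set E) (f : E -> KK^o).
Hypothesis df : forall x, D x -> differentiable f x.

Let f' x : E -> K := 'd f x.

Let f'P x : D x -> is_diff x f (f' x).
Proof. by move=> Dx; apply: differentiableP; apply: df. Qed.

Let f'D x u v : f' x (u + v) = f' x u + f' x v.
Proof. exact: (linearD ('d f x)). Qed.

Let f'Z x (a : K) u : f' x (a *: u) = a * f' x u.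
Proof. by rewrite /f' linearZ. Qed.

Let Lam := @circle_mean K.
Let B := 16 / `|contour_int (fun=> (1 : K))|.

Let B0 : 0 <= B. Proof. by rewrite divr_ge0. Qed.

(** Each use of the mean value formula visits x + w u with |w| <= 2 and |u| <= r, which costs 2r: a
    bound on [f] at distance 7r bounds the derivative at distance 5r and makes it Lipschitz at
    distance 3r. *)
Variables (x0 : E) (r M : K).
Hypotheses (r0 : 0 < r) (M0 : 0 <= M).
Hypothesis Hball : forall x, `|x - x0| <= 7 * r -> D x /\ `|f x| <= M.

Let shift_ball (s t : K) x u w : `|x - x0| <= s * r -> `|u| <= r -> `|w| <= 2 -> s + 2 <= t ->
  `|x + w *: u - x0| <= t * r.
Proof.
move=> xs ur w2 st; rewrite addrAC (le_trans (ler_normD _ _)) //.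
rewrite (@le_trans _ _ ((s + 2) * r)) //; last by rewrite ler_wpM2r // ltW.
by rewrite mulrDl lerD // normrZ ler_pM.
Qed.

Let is_diff_ray x u w : D (x + w *: u) ->
  is_diff (w : KK^o) ((fun w => f (x + w *: u)) : KK^o -> KK^o) (fun t => f' (x + w *: u) (t *: u)).
Proof.
move=> Dx; have d1 : is_diff (w : KK^o) ((fun w => x + w *: u) : KK^o -> E) (fun t => 0 + t *: u).
  apply: is_diffD; exact: is_diff_scalel.
have d2 := is_diff_comp d1 (f'P Dx).
by apply: is_diff_eq d2 _; apply/funext => t /=; rewrite add0r.
Qed.

Let ray_continuous x u w : D (x + w *: u) -> continuous_at_eps (fun w => f (x + w *: u)) w.
Proof. by move=> /is_diff_ray[H _]; exact: differentiable_eps H. Qed.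

Let quotient_continuous (g : K -> K) : (forall w, `|w| <= 2 -> continuous_at_eps g w) ->
  annulus_continuous (fun w => g w / w).
Proof.
by move=> H w w1 w2; apply: continuous_eps_div; [apply: annulus_neq0|apply: H].
Qed.

Let quotient_le (g : K -> K) (N w : K) : (forall w, `|w| <= 2 -> `|g w| <= N) ->
  2^-1 <= `|w| -> `|w| <= 2 -> `|g w / w| <= 2 * N.
Proof.
move=> H w1 w2; have w0 : 0 < `|w| by rewrite normr_gt0 annulus_neq0.
have N0 : 0 <= N by rewrite (le_trans _ (H w w2)).
rewrite normrM normfV ler_pdivrMr // (le_trans (H w w2)) // mulrAC ler_peMl //.
by rewrite mulrC -ler_pdivrMr // mul1r.
Qed.

Let Lam_quotient_le (g : K -> K) (N : K) : (forall w, `|w| <= 2 -> continuous_at_eps g w) ->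
  (forall w, `|w| <= 2 -> `|g w| <= N) -> `|Lam (fun w => g w / w)| <= B * (2 * N).
Proof.
move=> Hc HN; apply: circle_mean_le => //; first exact: quotient_continuous.
by move=> w; apply: quotient_le.
Qed.

(** The difference quotient in w, completed by f' x u at w = 0, is differentiable off 0 and
    continuous at 0; its mean is therefore its value at 0. The derivative becomes a mean of values
    of [f]. *)
Let cauchy_derivative x u : `|x - x0| <= 5 * r -> `|u| <= r ->
  f' x u = Lam (fun w => (f (x + w *: u) - f x) / w).
Proof.
move=> xr ur.
have inD w : `|w| <= 2 -> D (x + w *: u).
  move=> w2; have [] // := Hball (shift_ball xr ur w2 _).
  by rewrite -natrD.
pose psi (w : K) := if w == 0 then f' x u else (f (x + w *: u) - f x) / w.
have E0 : Lam psi = psi 0.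
  apply: mean_value_property => // [w w0 w2|e e0].
    have oN : open [set y : KK^o | y != 0].
      rewrite openE => y y0; apply/nbhs_normP; exists `|y|; first by rewrite /= normr_gt0.
      move=> z /=; apply: contraTneq => ->; by rewrite subr0 ltxx.
    have dq : is_diff (w : KK^o) ((fun w => (f (x + w *: u) - f x) / w) : KK^o -> KK^o)
        ('d ((fun w => (f (x + w *: u) - f x) / w) : KK^o -> KK^o) w).
      apply: differentiableP.
      have [dr _] := is_diff_ray (inD w w2).
      exact: (differentiableM (differentiableB dr (differentiable_cst (f x) w)) (differentiable_Rinv w0)).
    have Eq (y : KK^o) : [set y : KK^o | y != 0] y -> (f (x + y *: u) - f x) / y = psi y.
      by move=> y0; rewrite /psi (negbTE y0).
    have [H _] := is_diff_eq_open oN w0 Eq dq; exact: H.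
  have Dx : D x by have := inD 0; rewrite normr0 scale0r addr0; apply.
  have u1 : 0 < `|u| + 1 by rewrite ltr_wpDl.
  have [d d0 Hd] := is_diff_epsilon (f'P Dx) (divr_gt0 e0 u1).
  exists (d / (`|u| + 1)); first by rewrite divr_gt0.
  move=> w; rewrite subr0 /psi eqxx => wd.
  have [_|w0] := eqVneq w 0; first by rewrite subrr normr0 ltW.
  have wu : `|w *: u| < d.
    rewrite normrZ (le_lt_trans _ (_ : `|w| * (`|u| + 1) < d)) //.
      by rewrite ler_wpM2l // lerDl.
    by rewrite -ltr_pdivlMr.
  have := Hd _ wu; rewrite f'Z => H.
  have -> : (f (x + w *: u) - f x) / w - f' x u = (f (x + w *: u) - f x - w * f' x u) / w.
    by field.
  rewrite normrM normfV ler_pdivrMr ?normr_gt0 // (le_trans H) // normrZ.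
  rewrite [`|w| * _]mulrC mulrA ler_wpM2r // mulrAC ler_pdivrMr // ler_wpM2l ?(ltW e0) //.
  by rewrite lerDl.
have -> : f' x u = psi 0 by rewrite /psi eqxx.
rewrite -E0; apply: circle_mean_eq => w /annulus_neq0 w0 _.
by rewrite /psi (negbTE w0).
Qed.

(** By homogeneity, rescaling [v] to norm [r] turns a bound on the ball into an operator bound. *)
Let bound_scale (g : E -> K) (N : K) v : (forall (a : K) u, g (a *: u) = a * g u) ->
  (forall u, `|u| <= r -> `|g u| <= N) -> `|g v| <= N / r * `|v|.
Proof.
move=> gZ gN; have [->|v0] := eqVneq v 0.
  by have := gZ 0 0; rewrite scale0r mul0r => ->; rewrite !normr0 mulr0.
have nv0 : 0 < `|v| by rewrite normr_gt0.
have u_r : `|(r / `|v|) *: v| <= r.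
  rewrite normrZ (ger0_norm (divr_ge0 (ltW r0) (ltW nv0))) divfK //; exact: lt0r_neq0.
have := gN _ u_r; rewrite gZ normrM (ger0_norm (divr_ge0 (ltW r0) (ltW nv0))).
rewrite -ler_pdivlMl ?divr_gt0 // invf_div => /le_trans; apply.
by rewrite le_eqVlt; apply/orP; left; apply/eqP; ring.
Qed.

Let C1 := B * (2 * (M + M)) / r.

Let C10 : 0 <= C1.
Proof. by rewrite divr_ge0 ?(ltW r0) // !mulr_ge0 // addr_ge0. Qed.

Let derivative_le x v : `|x - x0| <= 5 * r -> `|f' x v| <= C1 * `|v|.
Proof.
move=> xr; apply: bound_scale => [a u|u ur]; first exact: f'Z.
have inball w : `|w| <= 2 -> D (x + w *: u) /\ `|f (x + w *: u)| <= M.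
  move=> w2; apply: Hball; apply: (shift_ball xr ur w2); by rewrite -natrD.
rewrite cauchy_derivative //; apply: Lam_quotient_le => w w2.
  apply: continuous_epsD; last exact: continuous_eps_cst.
  by apply: ray_continuous; have [] := inball w w2.
rewrite (le_trans (ler_normB _ _)) // lerD //; first by have [] := inball w w2.
by have [_] := inball 0 ltac:(by rewrite normr0); rewrite scale0r addr0.
Qed.

Let in5_D x : `|x - x0| <= 5 * r -> D x.
Proof.
move=> xr; have [] // := @Hball x.
by rewrite (le_trans xr) // ler_wpM2r ?(ltW r0) // ler_nat.
Qed.

Let lipschitz5 x y : `|x - x0| <= 5 * r -> `|y - x0| <= 5 * r ->
  `|f y - f x| <= C1 * `|y - x|.
Proof.
move=> xr yr; apply: (mean_value_le (c := x0) (r := 5 * r)) => //.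
  by rewrite mulr_ge0.
move=> z zr; split; first by apply: df; apply: in5_D.
exact: derivative_le.
Qed.

Let C2 := B * (2 * (C1 + C1)) / r.

Let C20 : 0 <= C2.
Proof. by rewrite divr_ge0 ?(ltW r0) // !mulr_ge0 // addr_ge0. Qed.

Let C2_ge0 a b : 0 <= a -> 0 <= b -> 0 <= C2 * a * b.
Proof. by move=> a0 b0; apply: mulr_ge0 b0; apply: mulr_ge0 a0; apply: C20. Qed.

Let in3_in5 x : `|x - x0| <= 3 * r -> `|x - x0| <= 5 * r.
Proof. by move=> xr; rewrite (le_trans xr) // ler_wpM2r ?(ltW r0) // ler_nat. Qed.

(** Two instances of the mean formula are subtracted, and the Lipschitz bound on [f] is inserted
    under the mean. *)
Let derivative_lipschitz x y v : `|x - x0| <= 3 * r -> `|y - x0| <= 3 * r ->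
  `|f' x v - f' y v| <= C2 * `|x - y| * `|v|.
Proof.
move=> xr yr.
have -> : C2 * `|x - y| = B * (2 * (C1 * `|x - y| + C1 * `|x - y|)) / r.
  by rewrite /C2; field; apply: lt0r_neq0.
apply: (@bound_scale (fun v => f' x v - f' y v)) => [a u|u ur].
  by rewrite !f'Z mulrBr.
have in5 z w : `|z - x0| <= 3 * r -> `|w| <= 2 -> `|z + w *: u - x0| <= 5 * r.
  by move=> zr w2; apply: (shift_ball zr ur w2); rewrite -natrD.
rewrite !cauchy_derivative ?in3_in5 // /Lam -[- circle_mean _]mulN1r -circle_meanZ //; last first.
  apply: quotient_continuous => w w2; apply: continuous_epsD; last exact: continuous_eps_cst.
  by apply: ray_continuous; apply: in5_D; apply: in5.
have cx w : `|w| <= 2 -> continuous_at_eps (fun w => f (x + w *: u) - f x) w.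
  move=> w2; apply: continuous_epsD; last exact: continuous_eps_cst.
  by apply: ray_continuous; apply: in5_D; apply: in5.
have cy w : `|w| <= 2 -> continuous_at_eps (fun w => -1 * (f (y + w *: u) - f y)) w.
  move=> w2; apply: continuous_epsZ; apply: continuous_epsD; last exact: continuous_eps_cst.
  by apply: ray_continuous; apply: in5_D; apply: in5.
have -> : (fun w => -1 * ((f (y + w *: u) - f y) / w)) =
    (fun w => -1 * (f (y + w *: u) - f y) / w).
  by apply/funext => w; rewrite mulrA.
rewrite -circle_meanD //; try exact: quotient_continuous.
have -> : (fun w => (f (x + w *: u) - f x) / w + -1 * (f (y + w *: u) - f y) / w) =
    (fun w => ((f (x + w *: u) - f x) + -1 * (f (y + w *: u) - f y)) / w).
  have gen (a b c : K) : a / c + b / c = (a + b) / c by rewrite mulrDl.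
  by apply/funext => w; exact: gen.
apply: Lam_quotient_le => w w2; first by apply: continuous_epsD; [apply: cx|apply: cy].
have gen (a b c d : K) : a - b + -1 * (c - d) = (a - c) - (b - d) by ring.
rewrite gen (le_trans (ler_normB _ _)) // lerD //.
  have := lipschitz5 (in5 y w yr w2) (in5 x w xr w2).
  by rewrite opprD addrACA subrr addr0.
by apply: lipschitz5; apply: in3_in5.
Qed.

Let linear_is_diff x y : D x -> is_diff y (f' x : E -> KK^o) (f' x).
Proof.
move=> Dx; have Hc : continuous ('d f x) by apply: diff_continuous; apply: df.
by split; [exact: linear_differentiable | exact: diff_lin].
Qed.

(** The mean value inequality is applied to f - f' x on the ball of radius |h| about x, where the
    differential is at most C2 |h| in norm. *)
Let remainder_le x h : `|x - x0| <= 2 * r -> `|h| <= r ->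
  `|f (x + h) - f x - f' x h| <= C2 * `|h| * `|h|.
Proof.
move=> xr hr; have x3 : `|x - x0| <= 3 * r.
  by rewrite (le_trans xr) // ler_wpM2r ?(ltW r0) // ler_nat.
have Dx : D x by apply/in5_D/in3_in5.
pose g y : KK^o := f y - f' x y.
have -> : f (x + h) - f x - f' x h = g (x + h) - g x.
  rewrite /g f'D; have gen (a b c d : K) : a - b - c = a - (d + c) - (b - d) by ring.
  exact: gen.
have := @mean_value_le _ _ _ g x `|h| (C2 * `|h| * `|h|) x (x + h) Harch HE.
rewrite subrr normr0 [x + h - x]addrAC subrr add0r; apply => //.
  exact: C2_ge0.
move=> y yh; have y3 : `|y - x0| <= 3 * r.
  rewrite (le_trans (ler_distD x _ _)) // -natr1 addrC mulrDl mul1r lerD //.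
  exact: le_trans yh hr.
have dg : is_diff y g (fun v => f' y v - f' x v).
  apply: is_diffB; first by apply/f'P/in5_D/in3_in5.
  exact: linear_is_diff.
split; first by case: dg.
rewrite (diff_val (is_diff_def := dg)) (le_trans (derivative_lipschitz _ y3 x3)) //.
by rewrite ler_wpM2r // ler_wpM2l // C20.
Qed.

(** The mean formula for f' x u is differentiated in x under the mean; uniform second-order
    remainders of [f] control the error. *)
Lemma derivative_differentiable_small u : `|u| <= r -> differentiable (fun x => 'd f x u) x0.
Proof.
move=> ur.
have x00 : `|x0 - x0| <= 0 * r by rewrite subrr normr0 mul0r.
have in2 w : `|w| <= 2 -> `|x0 + w *: u - x0| <= 2 * r.
  by move=> w2; apply: (shift_ball x00 ur w2); rewrite add0r.
have x0s s : 0 <= s -> `|x0 - x0| <= s * r by move=> s0; rewrite subrr normr0 mulr_ge0 ?(ltW r0).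
pose g h w := f' (x0 + w *: u) h - f' x0 h.
have cg h w : `|w| <= 2 -> continuous_at_eps (g h) w.
  move=> w2 e e0; have C0 : 0 < C2 * `|u| * `|h| + 1 by rewrite ltr_wpDl // C2_ge0.
  have [d d0 dd] := common_radius (ltr01 : 0 < 1 :> K) (divr_gt0 e0 C0).
  exists d => // y /dd[y1 ye]; have y3 : `|y| <= 3.
    by rewrite -[y](subrK w) (le_trans (ler_normD _ _)) // -natr1 addrC lerD // ltW.
  have in3 z : `|z| <= 3 -> `|x0 + z *: u - x0| <= 3 * r.
    by move=> z3; rewrite addrAC subrr add0r normrZ ler_pM.
  have w3 : `|w| <= 3 by rewrite (le_trans w2) // ler_nat.
  have -> : g h y - g h w = f' (x0 + y *: u) h - f' (x0 + w *: u) h.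
    by rewrite /g; ring.
  rewrite (le_trans (derivative_lipschitz _ (in3 _ y3) (in3 _ w3))) //.
  rewrite opprD addrACA subrr add0r -scalerBl normrZ.
  have -> : C2 * (`|y - w| * `|u|) * `|h| = `|y - w| * (C2 * `|u| * `|h|) by ring.
  rewrite (@le_trans _ _ (`|y - w| * (C2 * `|u| * `|h| + 1))) //.
    by rewrite ler_wpM2l // lerDl.
  by rewrite -ler_pdivlMr // ltW.
have gle h w : `|w| <= 2 -> `|g h w| <= C2 * (2 * r) * `|h|.
  move=> w2; have w2r := in2 _ w2.
  have w3r : `|x0 + w *: u - x0| <= 3 * r.
    by rewrite (le_trans w2r) // ler_wpM2r ?(ltW r0) // ler_nat.
  rewrite (le_trans (derivative_lipschitz _ w3r (x0s _ (ler0n _ 3)))) //.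
  by rewrite ler_wpM2r // ler_wpM2l // C20.
(* The candidate second derivative: the mean formula for f' x0 u with f replaced by its differential
   in the direction [h]. *)
pose L h : KK^o := Lam (fun w => g h w / w).
have Llin : linear L.
  move=> a h k; rewrite /L.
  have -> : (fun w => g (a *: h + k) w / w) = (fun w => a * (g h w / w) + g k w / w).
    have gen (s1 s2 t1 t2 v : K) : (a * s1 + s2 - (a * t1 + t2)) / v =
      a * ((s1 - t1) / v) + (s2 - t2) / v by ring.
    by apply/funext => w; rewrite /g !f'D !f'Z; exact: gen.
  have a1 := quotient_continuous (fun w => @cg h w).
  have a2 := quotient_continuous (fun w => @cg k w).
  have a3 : annulus_continuous (fun w => a * (g h w / w)).
    by move=> w w1 w2; apply: continuous_epsZ; apply: a1.
  rewrite /Lam (circle_meanD Harch Hcomplete a3 a2) (circle_meanZ Harch Hcomplete _ a1).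
  by [].
pose CL := B * (2 * (C2 * (2 * r))).
have CL0 : 0 <= CL.
  apply: mulr_ge0 => //; apply: mulr_ge0 => //; rewrite mulrA; apply: C2_ge0 => //; exact: ltW.
have Lbound h : `|L h| <= CL * `|h|.
  have -> : CL * `|h| = B * (2 * (C2 * (2 * r) * `|h|)) by rewrite /CL; ring.
  by apply: Lam_quotient_le => w; [apply: cg|apply: gle].
suff H : is_diff x0 (fun x => f' x u : KK^o) L by have [] := H.
apply: (is_diff_of_epsilon Llin CL0 Lbound) => e e0.
have C0 : 0 < B * (2 * (C2 + C2)) + 1 by rewrite ltr_wpDl //; apply: mulr_ge0 => //; apply: mulr_ge0 => //; apply: addr_ge0; apply: C20.
have [d d0 dd] := common_radius r0 (divr_gt0 e0 C0).
exists d => // h /dd[hr he].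
have x0h s : 1 <= s -> `|x0 + h - x0| <= s * r.
  move=> s1; rewrite addrAC subrr add0r (le_trans (ltW hr)) // ler_peMl // ltW //.
have in5h w : `|w| <= 2 -> `|x0 + h + w *: u - x0| <= 5 * r.
  move=> w2; apply: (shift_ball (x0h 1 (lexx _)) ur w2).
  by rewrite -(natrD _ 1 2) ler_nat.
have in50 w : `|w| <= 2 -> `|x0 + w *: u - x0| <= 5 * r.
  by move=> w2; rewrite (le_trans (in2 _ w2)) // ler_wpM2r ?(ltW r0) // ler_nat.
pose q1 w := f (x0 + h + w *: u) - f (x0 + h).
pose q0 w := f (x0 + w *: u) - f x0.
have cq1 w : `|w| <= 2 -> continuous_at_eps q1 w.
  move=> w2; apply: continuous_epsD; last exact: continuous_eps_cst.
  by apply: ray_continuous; apply: in5_D; apply: in5h.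
have cq0 w : `|w| <= 2 -> continuous_at_eps q0 w.
  move=> w2; apply: continuous_epsD; last exact: continuous_eps_cst.
  by apply: ray_continuous; apply: in5_D; apply: in50.
pose G w := q1 w + (-1 * q0 w + -1 * g h w).
have cG0 w : `|w| <= 2 -> continuous_at_eps (fun w => -1 * q0 w + -1 * g h w) w.
  by move=> w2; apply: continuous_epsD; apply: continuous_epsZ; [apply: cq0|apply: cg].
have -> : f' (x0 + h) u - f' x0 u - L h = Lam (fun w => G w / w).
  rewrite !cauchy_derivative //; last first.
  - by apply: x0h; rewrite ler1n.
  - exact: x0s.
  have -> : (fun w => G w / w) = (fun w => q1 w / w + (-1 * (q0 w / w) + -1 * (g h w / w))).
    by apply/funext => w; rewrite /G; ring.
  have a1 := quotient_continuous cq1; have a0 := quotient_continuous cq0.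
  have ag := quotient_continuous (fun w => @cg h w).
  have b0 : annulus_continuous (fun w => -1 * (q0 w / w)).
    by move=> w w1 w2; apply: continuous_epsZ; apply: a0.
  have bg : annulus_continuous (fun w => -1 * (g h w / w)).
    by move=> w w1 w2; apply: continuous_epsZ; apply: ag.
  rewrite /Lam circle_meanD //; last by move=> w w1 w2; apply: continuous_epsD; [apply: b0|apply: bg].
  by rewrite circle_meanD // !circle_meanZ // !mulN1r addrA.
have Gle w : `|w| <= 2 -> `|G w| <= C2 * `|h| * `|h| + C2 * `|h| * `|h|.
  move=> w2; have r1 := remainder_le (in2 _ w2) (ltW hr).
  have r2 := remainder_le (x0s _ (ler0n _ 2)) (ltW hr).
  (* The integrand of the error is the difference of the remainders of [f] at x0 + w u and at x0,
     each of order |h|^2. *)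
  have -> : G w = (f (x0 + w *: u + h) - f (x0 + w *: u) - f' (x0 + w *: u) h) -
      (f (x0 + h) - f x0 - f' x0 h).
    rewrite /G /q1 /q0 /g [x0 + w *: u + h]addrAC.
    have gen (a1 a2 b1 b2 s t : K) : a1 - a2 + (-1 * (b1 - b2) + -1 * (s - t)) =
      a1 - b1 - s - (a2 - b2 - t) by ring.
    exact: gen.
  by rewrite (le_trans (ler_normB _ _)) // lerD.
have cG w : `|w| <= 2 -> continuous_at_eps G w.
  by move=> w2; apply: continuous_epsD; [apply: cq1|apply: cG0].
rewrite (le_trans (Lam_quotient_le cG Gle)) //.
have -> : B * (2 * (C2 * `|h| * `|h| + C2 * `|h| * `|h|)) =
  `|h| * (B * (2 * (C2 + C2))) * `|h| by ring.
rewrite ler_wpM2r // (@le_trans _ _ (`|h| * (B * (2 * (C2 + C2)) + 1))) //.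
  by rewrite ler_wpM2l // lerDl.
by rewrite -ler_pdivlMr // ltW.
Qed.

End HolomorphicSmooth.

Section HolomorphicCk.
Context {K : numClosedFieldType}.
Hypothesis Harch : archimedean_scalars K.
Hypothesis Hcomplete : seq_complete (K : numFieldType)^o.
Local Notation KK := (K : numFieldType).
Context {E : normedModType KK}.
Hypothesis HE : seq_complete E.

Lemma holomorphic_derivative (D : set E) (f : E -> KK^o) : open D ->
  (forall x, D x -> differentiable f x) ->
  forall v x, D x -> differentiable (fun x => 'd f x v) x.
Proof.
move=> oD df v x Dx.
have [d1 d10 H1] := open_radius oD Dx.
have cf : \forall y \near x, `|f x - f y| < 1.
  by have := differentiable_continuous (df x Dx) => /cvgrPdist_lt/(_ 1 ltr01).
have /nbhs_normP[d2 d20 H2] := cf.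
have [d d0 dd] := common_radius d10 d20.
(* With r = d/8 the ball of radius 7r stays strictly inside radius d. *)
pose r : K := d / 8; have r0 : 0 < r by rewrite divr_gt0.
have ball7 y : `|y - x| <= 7 * r -> D y /\ `|f y| <= `|f x| + 1.
  move=> yr; have yd : `|y - x| < d.
    rewrite (le_lt_trans yr) // /r mulrA mulrAC gtr_pMl // ltr_pdivrMr // mul1r.
    by rewrite ltr_nat.
  have [y1 y2] := dd _ yd; split; first exact: H1.
  have fy := H2 y; rewrite /= distrC in fy; have {}fy := fy y2.
  rewrite -[f y](subrK (f x)) addrC (le_trans (ler_normD _ _)) // lerD2l.
  by rewrite distrC ltW.
have small u : `|u| <= r -> differentiable (fun y => 'd f y u) x.
  have fx1 : 0 <= `|f x| + 1 by rewrite addr_ge0.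
  exact: (derivative_differentiable_small Harch Hcomplete HE df r0 fx1 ball7).
have v1 : 0 < `|v| + 1 by rewrite ltr_wpDl.
(* Linearity in the direction reduces an arbitrary [v] to one of norm at most [r]. *)
pose t : KK := r / (`|v| + 1); have t0 : 0 < t by rewrite divr_gt0.
have tv : `|t *: v| <= r.
  rewrite normrZ (ger0_norm (ltW t0)) /t mulrAC ler_pdivrMr // ler_wpM2l ?(ltW r0) //.
  by rewrite lerDl.
have -> : (fun y => 'd f y v) = t^-1 \*: (fun y => 'd f y (t *: v) : KK^o).
  apply/funext => y /=; rewrite linearZ -[_ *: _]/(t^-1 * (t * 'd f y v)) mulKf //.
  exact: lt0r_neq0.
exact: differentiableZ (small _ tv).
Qed.

Lemma holomorphic_Ck_scalar k (D : set E) (f : E -> KK^o) : open D ->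
  (forall x, D x -> differentiable f x) -> Ck k D f.
Proof.
move=> oD; elim: k f => [|k IH] f df.
  by move=> x Dx; apply: differentiable_continuous; apply: df.
by split=> // v; apply: IH => x Dx; apply: holomorphic_derivative Dx.
Qed.

Theorem holomorphic_smooth m (D : set E) (f : E -> 'rV[KK]_m) : open D ->
  (forall x, D x -> differentiable f x) -> smooth D f.
Proof.
move=> oD df k; apply: Ck_row => // j; apply: holomorphic_Ck_scalar => // x Dx.
by have [] := is_diff_coord j (differentiableP (df x Dx)).
Qed.

End HolomorphicCk.

(** * One notion of smoothness for both fields *)

Section Kdifferentiability.
Context {R : realType} {c : scalar_kind}.
Local Notation K := (scalars R c).

Lemma smooth_Kdifferentiable (E F : normedModType K) (D : set E) (f : E -> F) :
  smooth D f -> Kdifferentiable D f.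
Proof. by case: c E F D f => E F D f Hf /=; [exact: Hf|case: (Hf 1%N)]. Qed.

(** Only the complex case has content: it is where Goursat's lemma enters the geometry. *)
Lemma Kdifferentiable_smooth n m (D : set 'rV[K]_n) (f : 'rV[K]_n -> 'rV[K]_m) :
  open D -> Kdifferentiable D f -> smooth D f.
Proof.
case: c D f => D f oD Hf; first exact: Hf.
apply: (@holomorphic_smooth (R[i] : numClosedFieldType)) => //.
- exact: archimedean_complex.
- exact: seq_complete_complex.
- apply: seq_complete_row; exact: seq_complete_complex.
Qed.

End Kdifferentiability.

(** * Straightening a submersion *)

Section ImplicitFunction.
Context {K : numFieldType}.
Hypothesis Harch : archimedean_scalars K.
Hypothesis Hcomplete : seq_complete K^o.

Lemma is_diff_mulmxr n m (E : normedModType K) (g dg : E -> 'rV[K]_n) (A : 'M[K]_(n, m)) x :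
  is_diff x g dg -> is_diff x (fun y => g y *m A) (fun v => dg v *m A).
Proof.
by move=> H; exact: is_diff_comp H (row_linear_is_diff (mulmxr A : {linear _ -> _}) (g x)).
Qed.

Lemma smooth_mulmxr n m (E : normedModType K) (D : set E) (g : E -> 'rV[K]_n) (A : 'M[K]_(n, m)) :
  open D -> smooth D g -> smooth D (fun y => g y *m A).
Proof.
move=> oD Hg k; apply: (Ck_linear_comp (L := mulmxr A : {linear _ -> _})) => //.
exact: row_linear_continuous.
Qed.

Lemma smooth_diff (E F : normedModType K) (D : set E) (f : E -> F) x :
  smooth D f -> D x -> is_diff x f ('d f x).
Proof. by move=> Hf; apply: Ck_diff (Hf 1%N). Qed.

Lemma smooth_id n (D : set 'rV[K]_n) : open D -> smooth D (fun x => x).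
Proof.
by move=> oD k; apply: (@Ck_linear _ _ _ k D (idfun : {linear 'rV[K]_n -> 'rV[K]_n})) => // x; apply: cvg_id.
Qed.

Lemma smooth_sub_cst n (D : set 'rV[K]_n) m (g : 'rV[K]_n -> 'rV[K]_m) (a : 'rV[K]_m) :
  open D -> smooth D g -> smooth D (fun x => g x - a).
Proof. by move=> oD Hg k; apply: CkD => //; apply: Ck_cst. Qed.

(* If B is a left inverse of the Jacobian A of F at p, then
   psi x = (x - p) + (F x - F p - (x - p) A) B is a local diffeomorphism that
   straightens F: psi x *m A = F x - F p. *)
Theorem straightening n j (D : set 'rV[K]_n) (F : 'rV[K]_n -> 'rV[K]_j) p (B : 'M[K]_(j, n)) :
  open D -> D p -> smooth D F -> B *m 'J F p = 1%:M ->
  exists (N : set 'rV[K]_n) (psi x : 'rV[K]_n -> 'rV[K]_n),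
  [/\ open N, N p, N `<=` D & open (psi @` N)] /\
  [/\ smooth N psi, smooth (psi @` N) x, forall q, N q -> x (psi q) = q &
      forall q, psi q *m 'J F p = F q - F p].
Proof.
move=> oD Dp smF BA; set A := 'J F p in BA *.
pose psi q := (q - p) + (F q - F p - (q - p) *m A) *m B.
have smpsi : smooth D psi.
  have s1 : smooth D (fun q => q - p) by apply: smooth_sub_cst => //; apply: smooth_id.
  have s2 : smooth D (fun q => F q - F p) by apply: smooth_sub_cst.
  have s3 : smooth D (fun q => (F q - F p) - (q - p) *m A).
    move=> k; apply: CkD => //; apply: CkN => //; exact: smooth_mulmxr.
  by move=> k; apply: CkD => //; apply: smooth_mulmxr.
have dpsi : is_diff p psi (fun v => v).
  have d1 : is_diff p (fun q => q - p) (fun v => v - 0).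
    exact: (is_diffB (is_diff_id p) (is_diff_cst p p)).
  have d2 : is_diff p (fun q => F q - F p) (fun v => 'd F p v - 0).
    exact: (is_diffB (smooth_diff smF Dp) (is_diff_cst (F p) p)).
  have d3 := is_diffD d1 (is_diff_mulmxr B (is_diffB d2 (is_diff_mulmxr A d1))).
  apply: is_diff_eq d3 _; apply/funext => v.
  change ((v - 0) + (('d F p v - 0) - (v - 0) *m A) *m B = v).
  by rewrite !subr0 /A jacobian_mulE subrr mul0mx addr0.
have Ju : 'J psi p \in unitmx.
  have -> : 'J psi p = 1%:M.
    apply/row_matrixP => i; rewrite rowE jacobian_mulE (diff_val (is_diff_def := dpsi)).
    by rewrite row1.
  exact: unitmx1.
have [N [x [[No Np ND oN] [smx xK]]]] := inverse_function Harch Hcomplete oD Dp smpsi Ju.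
exists N, psi, x; split=> //; split=> // [k|q].
  exact: Ck_sub ND (smpsi k).
rewrite /psi mulmxDl -mulmxA BA mulmx1 addrC subrK //.
Qed.

Lemma inverse_diff_cancel n (N : set 'rV[K]_n) (psi x : 'rV[K]_n -> 'rV[K]_n) q v :
  open N -> N q -> open (psi @` N) -> smooth N psi -> smooth (psi @` N) x ->
  (forall q, N q -> x (psi q) = q) -> 'd x (psi q) ('d psi q v) = v.
Proof.
move=> oN Nq opN smpsi smx xK.
have Wq : (psi @` N) (psi q) by exists q.
have d1 := is_diff_comp (smooth_diff smpsi Nq) (smooth_diff smx Wq).
have d2 : is_diff q (x \o psi) (fun v => v).
  by apply: (is_diff_eq_open oN Nq (f := fun y => y)) => y Ny; rewrite /= xK.
by have := congr1 (fun g => g v) (etrans (esym (diff_val (is_diff_def := d1))) (diff_val (is_diff_def := d2))).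
Qed.

Lemma inverse_diff_cancel_r n (N : set 'rV[K]_n) (psi x : 'rV[K]_n -> 'rV[K]_n) q v :
  open N -> N q -> open (psi @` N) -> smooth N psi -> smooth (psi @` N) x ->
  (forall q, N q -> x (psi q) = q) -> 'd psi q ('d x (psi q) v) = v.
Proof.
move=> oN Nq opN smpsi smx xK.
have Wq : (psi @` N) (psi q) by exists q.
have E : x (psi q) = q by apply: xK.
have dpsi : is_diff (x (psi q)) psi ('d psi q) by rewrite E; apply: smooth_diff smpsi Nq.
have d1 := is_diff_comp (smooth_diff smx Wq) dpsi.
have d2 : is_diff (psi q) (psi \o x) (fun v => v).
  by apply: (is_diff_eq_open opN Wq (f := fun y => y)) => y [z Nz <-]; rewrite /= xK.
by have := congr1 (fun g => g v) (etrans (esym (diff_val (is_diff_def := d1))) (diff_val (is_diff_def := d2))).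
Qed.

End ImplicitFunction.

(** * Tangent spaces defined by curves *)

Section TangentSpaces.
Context {R : realType} {c : scalar_kind}.
Local Notation K := (scalars R c).

Lemma Kdifferentiable_sub (E F : normedModType K) (D D' : set E) (g : E -> F) :
  D' `<=` D -> Kdifferentiable D g -> Kdifferentiable D' g.
Proof.
case: c E F D D' g => E F D D' g sD H; first by move=> k; apply: Ck_sub sD (H k).
by move=> x /sD; apply: H.
Qed.

Lemma Kdifferentiable_diff (E F : normedModType K) (D : set E) (g : E -> F) x :
  Kdifferentiable D g -> D x -> differentiable g x.
Proof.
case: c E F D g x => E F D g x H Dx; last exact: H.
by have [Hd _] := H 1%N; apply: Hd.
Qed.

Lemma tangent_space_local (m : nat) (S S' N : set 'rV[K]_m) q v : open N -> N q ->
  (forall y, N y -> S y -> S' y) -> tangent_space S q v -> tangent_space S' q v.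
Proof.
move=> oN Nq sub [D [g [[oD D0 Dg Sg] [g0 dg]]]].
exists (D `&` g @^-1` N), g; split=> //; split.
- apply: open_preimage => // t Dt; apply: differentiable_continuous.
  exact: Kdifferentiable_diff Dt.
- by split=> //; rewrite /preimage /= g0.
- by apply: Kdifferentiable_sub Dg => t [].
- by move=> t [Dt Nt]; apply: sub => //; apply: Sg.
Qed.

Lemma tangent_space_zero (m : nat) (S N : set 'rV[K]_m) (F : 'rV[K]_m -> K^o) q v :
  open N -> N q -> (forall y, N y -> S y -> F y = 0) -> differentiable F q ->
  tangent_space S q v -> 'd F q v = 0.
Proof.
move=> oN Nq F0 dF Tv.
have [D [g [[oD D0 Dg Sg] [g0 dg]]]] : tangent_space (S `&` N) q v.
  by apply: (tangent_space_local oN Nq _ Tv) => y Ny Sy; split.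
have dg0 : is_diff (0 : K^o) g ('d g 0) by apply/differentiableP/(Kdifferentiable_diff Dg).
have dFg : is_diff (g 0) F ('d F q) by rewrite g0; apply: differentiableP.
have d1 := is_diff_comp dg0 dFg.
have d2 : is_diff (0 : K^o) (F \o g) (fun=> 0).
  by apply: (is_diff_eq_open oD D0 (f := fun=> 0)) => t /Sg[St Nt]; rewrite /= F0.
have := congr1 (fun h => h (1 : K^o)) (etrans (esym (diff_val (is_diff_def := d1))) (diff_val (is_diff_def := d2))).
by rewrite /= dg.
Qed.

(** The curve is a line t -> psi q + t w carried back by the inverse chart; [F] is constant along it
    because w lies in the kernel of the Jacobian at p. The set [S] is only asked to contain the
    zeros of [F] near p, so that the result applies to sets whose equations hold locally. *)
Theorem implicit_tangent (n j : nat) (D : set 'rV[K]_n) (F : 'rV[K]_n -> 'rV[K]_j) p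
    (B : 'M[K]_(j, n)) :
  open D -> D p -> smooth D F -> B *m 'J F p = 1%:M ->
  exists N : set 'rV[K]_n, [/\ open N, N p, N `<=` D &
    forall (S : set 'rV[K]_n) q v, (forall y, N y -> F y = 0 -> S y) -> N q -> F q = 0 ->
      'd F q v = 0 -> tangent_space S q v].
Proof.
move=> oD Dp smF BA.
have Harch := @archimedean_scalarsP R c; have Hc := @seq_complete_scalars R c.
have [N [psi [x [[oN Np ND opN] [smpsi smx xK psiA]]]]] := straightening Harch Hc oD Dp smF BA.
exists N; split=> // S q v FS Nq Fq dFv.
pose w := 'd psi q v.
pose line (t : K^o) := psi q + t *: w.
have dline t : is_diff (t : K^o) line (fun s => s *: w).
  have := is_diffD (is_diff_cst (psi q) t) (is_diff_scalel t w).
  by move/is_diff_eq; apply; apply/funext => s; rewrite /= add0r.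
have smline (Dt : set K^o) : open Dt -> smooth Dt line.
  move=> oDt [|k]; first by move=> t _; apply: differentiable_continuous; case: (dline t).
  apply: (@Ck_step _ _ _ k Dt line (fun _ s => s *: w) oDt) => v'.
  exact: Ck_cst.
pose Dt := line @^-1` (psi @` N).
have oDt : open Dt.
  have -> : Dt = setT `&` line @^-1` (psi @` N) by rewrite setTI.
  apply: open_preimage => //; first exact: openT.
  exact: (smline setT openT 0%N).
(* Differentiating the identity psi *m 'J F p = F - F p at q moves the condition on dF at q to the
   fixed matrix at p. *)
have wA : w *m 'J F p = 0.
  have d1 := is_diff_mulmxr ('J F p) (smooth_diff smpsi Nq).
  have d2 : is_diff q (fun y => psi y *m 'J F p) ('d F q).
    have -> : (fun y => psi y *m 'J F p) = (fun y => F y - F p).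
      by apply/funext => y; rewrite psiA.
    have := is_diffB (smooth_diff smF (ND _ Nq)) (is_diff_cst (F p) q).
    by move/is_diff_eq; apply; apply/funext => s; rewrite /= subr0.
  have := congr1 (fun g => g v) (etrans (esym (diff_val (is_diff_def := d1))) (diff_val (is_diff_def := d2))).
  by rewrite /= dFv.
have line0 : line 0 = psi q by rewrite /line scale0r addr0.
have D0 : Dt 0 by rewrite /Dt /preimage /= line0; exists q.
exists Dt, (fun t => x (line t)); split; split=> //.
- apply: smooth_Kdifferentiable => k.
  apply: (Ck_comp (D' := psi @` N)) => //; exact: smline.
- move=> t [y Ny Ey]; rewrite -Ey xK //; apply: FS => //.
  have : psi y *m 'J F p = psi q *m 'J F p.
    by rewrite Ey /line mulmxDl -scalemxAl wA scaler0 addr0.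
  by rewrite !psiA Fq => /addIr.
- by rewrite line0 xK.
have Wq : (psi @` N) (line 0) by rewrite line0; exists q.
have d1 := is_diff_comp (dline 0) (smooth_diff smx Wq).
rewrite (diff_val (is_diff_def := d1)) /= scale1r line0.
exact: (inverse_diff_cancel v oN Nq opN smpsi smx xK).
Qed.

End TangentSpaces.

(** * Consequences of d lambda being non-zero at p *)

Section SingularPoints.
Context {K : numFieldType}.

Lemma open_neq0 : open [set y : K^o | y != 0].
Proof.
rewrite openE => y y0; apply/nbhs_normP; exists `|y|; first by rewrite /= normr_gt0.
by move=> z /=; apply: contraTneq => ->; rewrite subr0 ltxx.
Qed.

Lemma is_diff_sum (E F : normedModType K) (I : Type) (r : seq I) (f df : I -> E -> F) x :
  (forall i, is_diff x (f i) (df i)) ->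
  is_diff x (fun y => \sum_(i <- r) f i y) (fun v => \sum_(i <- r) df i v).
Proof.
move=> H; elim: r => [|i r IH].
  have := is_diff_cst (0 : F) x; congr is_diff_def; apply/funext => y; by rewrite big_nil.
have := is_diffD (H i) IH; congr is_diff_def; apply/funext => y; by rewrite big_cons.
Qed.

Lemma is_diff_dot (E : normedModType K) m (g w dg dw : E -> 'rV[K]_m) x :
  is_diff x g dg -> is_diff x w dw ->
  is_diff x (fun y => \sum_j g y 0 j * w y 0 j : K^o)
    (fun v => \sum_j (g x 0 j * dw v 0 j + dg v 0 j * w x 0 j)).
Proof.
move=> dg' dw'; apply: is_diff_sum => j.
exact: is_diff_scale (is_diff_coord j dg') (is_diff_coord j dw').
Qed.

Lemma rank_of_cofactor m (A : 'M[K]_m) i j : cofactor A i j != 0 -> (m.-1 <= \rank A)%N.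
Proof.
rewrite /cofactor mulf_eq0 signr_eq0 /= => H.
have Hu : row' i (col' j A) \in unitmx by rewrite unitmxE unitfE.
rewrite -(mxrank_unit Hu).
have row'_le p q (B : 'M[K]_(p, q)) k : (\rank (row' k B) <= \rank B)%N.
  rewrite mxrankS //; apply/row_subP => l.
  have -> : row l (row' k B) = row (lift k l) B by apply/rowP => t; rewrite !mxE.
  exact: row_sub.
apply: leq_trans (row'_le _ _ _ _) _.
by rewrite -mxrank_tr tr_col' (leq_trans (row'_le _ _ _ _)) // mxrank_tr.
Qed.

Lemma smooth_col_mx n (V : set 'rV[K]_n) (f : 'rV[K]_n -> 'rV[K]_(n + 1)) (nu : 'rV[K]_n -> 'rV[K]_(n + 1))
    i j : open V -> smooth V f -> smooth V nu ->
  smooth V (fun x => col_mx ('J f x) (nu x) i j : K^o).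
Proof.
move=> oV smf smnu k; rewrite -(splitK i); case: (fintype.split i) => l /=.
  apply: (Ck_eq (f := fun x => 'd f x (delta_mx 0 l) 0 j : K^o)) => //.
    by move=> x _; rewrite col_mxEu jacobianE.
  by apply: Ck_coord => //; exact: Ck_deriv (smf k.+1).
apply: (Ck_eq (f := fun x => nu x 0 j : K^o)) => //.
  by move=> x _; rewrite col_mxEd (ord1 l).
exact: Ck_coord.
Qed.

Theorem nondegenerate_rank n (V : set 'rV[K]_n) (f : 'rV[K]_n -> 'rV[K]_(n + 1))
    (nu : 'rV[K]_n -> 'rV[K]_(n + 1)) p u v :
  open V -> V p -> smooth V f -> smooth V nu ->
  (forall x w, V x -> \sum_j 'd f x w 0 j * nu x 0 j = 0) ->
  nu p != 0 -> u != 0 -> 'd f p u = 0 ->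
  'd ((fun q => \det (col_mx ('J f q) (nu q))) : 'rV[K]_n -> K^o) p v != 0 ->
  \rank ('J f p) = n.-1 /\ \sum_j nu p 0 j * nu p 0 j != 0.
Proof.
move=> oV Vp smf smnu orth nu0 u0 dfu dlam.
pose A x := col_mx ('J f x) (nu x).
have /rV0Pn[i0 ui0] := u0.
(* The cofactors of the row indexed by a non-zero coordinate [i0] of the null vector [u]. *)
pose kap x : 'rV[K]_(n + 1) := \row_j cofactor (A x) (lshift 1 i0) j.
have smA i j : smooth V (fun x => A x i j : K^o) by apply: smooth_col_mx.
have smkap : smooth V kap.
  move=> k; apply: Ck_row => // j.
  apply: (Ck_eq (f := fun x => cofactor (A x) (lshift 1 i0) j : K^o)).
  - by [].
  - by move=> x _; rewrite mxE.
  apply: CkM => //; first exact: Ck_cst.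
  apply: Ck_det => // s t.
  apply: (Ck_eq (f := fun x => A x (lift (lshift 1 i0) s) (lift j t) : K^o)) => //.
    by move=> x _; rewrite !mxE.
  exact: smA.
pose h x := 'd f x u.
have smh : smooth V h by move=> k; apply: Ck_deriv (smf k.+1).
pose rho := 'd h p v.
have lamE x : \sum_j h x 0 j * kap x 0 j = u 0 i0 * \det (A x).
  have E : row_mx u 0 *m A x = h x.
    by rewrite /A mul_row_col mul0mx addr0 jacobian_mulE.
  have := congr1 (mulmx (row_mx u (0 : 'rV[K]_1))) (mul_mx_adj (A x)).
  rewrite mulmxA E mul_mx_scalar => /(congr1 (fun M : 'rV[K]_(n + 1) => M 0 (lshift 1 i0))).
  rewrite !mxE; case: splitP => [i Ei|i Ei]; last first.
    by have := ltn_ord i0; rewrite -[i0 : nat]/(lshift 1 i0 : nat) Ei -ltn_subRL subnn.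
  have -> : i = i0 by apply/val_inj; rewrite /= -Ei.
  rewrite mulrC => <-; apply: eq_bigr => j _; by rewrite !mxE.
have dh := smooth_diff smh Vp; have dkap := smooth_diff smkap Vp.
have dnu := smooth_diff smnu Vp.
have h0 j : h p 0 j = 0 by rewrite /h dfu mxE.
(* Since h = df(u) vanishes at p, differentiating a product with [h] leaves only the term containing
   [rho], the derivative of [h] along [v]. *)
have Erho (w : 'rV[K]_n -> 'rV[K]_(n + 1)) (dw : 'rV[K]_n -> 'rV[K]_(n + 1)) : is_diff p w dw ->
    'd ((fun y => \sum_j h y 0 j * w y 0 j) : 'rV[K]_n -> K^o) p v = \sum_j rho 0 j * w p 0 j.
  move=> dwp; have dd := is_diff_dot dh dwp.
  rewrite (diff_val (is_diff_def := dd)); apply: eq_bigr => j _.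
  by rewrite h0 mul0r add0r.
have rho_kap : \sum_j rho 0 j * kap p 0 j != 0.
  rewrite -(Erho _ _ dkap).
  have -> : (fun y => \sum_j h y 0 j * kap y 0 j) = (u 0 i0 : K) \*: ((fun q => \det (A q)) : 'rV[K]_n -> K^o).
    by apply/funext => y; rewrite lamE.
  have dA : differentiable ((fun q => \det (A q)) : 'rV[K]_n -> K^o) p.
    have [H _] : Ck 1 V ((fun q => \det (A q)) : 'rV[K]_n -> K^o).
      by apply: Ck_det => // i j; apply: smA.
    exact: H.
  by rewrite diffZ //= mulf_neq0.
have rho_nu : \sum_j rho 0 j * nu p 0 j = 0.
  rewrite -(Erho _ _ dnu).
  have d0 : is_diff p ((fun y => \sum_j h y 0 j * nu y 0 j) : 'rV[K]_n -> K^o) (fun=> 0).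
    by apply: (is_diff_eq_open oV Vp (f := fun=> 0)) => y Vy; rewrite orth.
  by rewrite (diff_val (is_diff_def := d0)).
have [j0 kapj0] : exists j, kap p 0 j != 0.
  apply: contrapT => H; move/eqP: rho_kap; apply; rewrite big1 // => j _.
  have [->|kj] := eqVneq (kap p 0 j) 0; first by rewrite mulr0.
  by case: H; exists j.
have rA : (n <= \rank (A p))%N.
  have H := kapj0; rewrite mxE in H; have := rank_of_cofactor H.
  by have -> : (n + 1).-1 = n by rewrite addn1.
have n_gt0 : (0 < n)%N by apply: leq_trans (ltn_ord i0).
have uJ : u *m 'J f p = 0 by rewrite jacobian_mulE.
have rJ1 : (\rank ('J f p) <= n.-1)%N.
  rewrite -ltnS prednK // ltn_neqAle rank_leq_row andbT; apply/negP => /eqP E.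
  have : row_free ('J f p) by apply/eqP.
  by move=> /row_freeP[Y JY]; case/negP: u0; rewrite -[u]mulmx1 -JY mulmxA uJ mul0mx.
have rA2 : (\rank (A p) <= \rank ('J f p) + 1)%N.
  by rewrite /A -addsmxE (leq_trans (mxrank_adds_leqif _ _)) // leq_add2l rank_leq_row.
have rJ : \rank ('J f p) = n.-1.
  apply/eqP; rewrite eqn_leq rJ1 /= -ltnS prednK // -addn1.
  exact: leq_trans rA rA2.
(* If <nu, nu> = 0 then nu and [kap] both lie in the kernel of the matrix (df; nu) acting on
   columns, a line, so nu = s kap; but [rho] is orthogonal to nu and not to [kap], which forces s =
   0 and nu = 0. *)
split=> //; apply/negP => /eqP nunu.
have rAn : \rank (A p) = n.
  apply/eqP; rewrite eqn_leq rA andbT (leq_trans rA2) // rJ addn1 prednK //.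
have in_ker (w : 'rV[K]_(n + 1)) : A p *m w^T = 0 -> (w <= kermx (A p)^T)%MS.
  by move=> E; apply/sub_kermxP; rewrite -[w]trmxK -trmx_mul E trmx0.
have kapker : (kap p <= kermx (A p)^T)%MS.
  apply: in_ker; apply/colP => i.
  have := congr1 (fun M : 'M[K]_(n + 1) => M i (lshift 1 i0)) (mul_mx_adj (A p)).
  have -> : \det (A p) = 0.
    by apply: (mulfI ui0); rewrite mulr0 -lamE big1 // => j _; rewrite h0 mul0r.
  rewrite !mxE mul0rn => E; rewrite -[RHS]E; apply: eq_bigr => j _.
  by rewrite !mxE.
have nuker : (nu p <= kermx (A p)^T)%MS.
  apply: in_ker; rewrite /A mul_col_mx -[0]vsubmxK; congr col_mx; apply/matrixP => i j.
    rewrite !mxE -[RHS](orth p (delta_mx 0 i) Vp); apply: eq_bigr => l _.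
    by rewrite !mxE (ord1 j).
  rewrite !mxE -[RHS]nunu; apply: eq_bigr => l _; by rewrite !mxE (ord1 i) (ord1 j).
have kap_n0 : kap p != 0 by apply/negP => /eqP E; case/negP: kapj0; rewrite E mxE.
have kerkap : (kermx (A p)^T <= kap p)%MS.
  by rewrite -(geq_leqif (mxrank_leqif_sup kapker)) mxrank_ker mxrank_tr rAn rank_rV kap_n0 addKn.
have /sub_rVP[s Es] := submx_trans nuker kerkap.
have s0 : s = 0.
  apply/eqP; have := rho_nu; rewrite Es.
  have -> : \sum_j rho 0 j * (s *: kap p) 0 j = s * \sum_j rho 0 j * kap p 0 j.
    by rewrite mulr_sumr; apply: eq_bigr => j _; rewrite !mxE mulrCA.
  by move/eqP; rewrite mulf_eq0 (negbTE rho_kap) orbF.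
by case/negP: nu0; rewrite Es s0 scale0r.
Qed.

(** Appending the column selecting a non-zero coordinate [i0] of [u] makes the Jacobian injective at
    p. Injectivity persists nearby, being detected by a determinant, so a null vector is determined
    by its coordinate [i0]. *)
Lemma null_line_near n (V : set 'rV[K]_n) (f : 'rV[K]_n -> 'rV[K]_(n + 1)) p u :
  open V -> V p -> smooth V f -> u != 0 -> 'd f p u = 0 -> \rank ('J f p) = n.-1 ->
  exists N : set 'rV[K]_n, [/\ open N, N p, N `<=` V &
    forall q w w', N q -> 'd f q w = 0 -> 'd f q w' = 0 -> w != 0 -> exists s, w' = s *: w].
Proof.
move=> oV Vp smf u0 dfu rJ.
have /rV0Pn[i0 ui0] := u0.
have n_gt0 : (0 < n)%N by apply: leq_trans (ltn_ord i0).
pose b : 'cV[K]_n := delta_mx i0 0.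
have bE (w : 'rV[K]_n) : w *m b = (w 0 i0)%:M.
  by rewrite /b -colE; apply/matrixP => i j; rewrite !mxE !ord1.
pose T x := row_mx ('J f x) b.
have uker : (u <= kermx ('J f p))%MS by apply/sub_kermxP; rewrite jacobian_mulE.
have keru : (kermx ('J f p) <= u)%MS.
  rewrite -(geq_leqif (mxrank_leqif_sup uker)) mxrank_ker rJ rank_rV u0.
  by rewrite -{1}(prednK n_gt0) subSnn.
have freeT : row_free (T p).
  apply: inj_row_free => w; rewrite /T mul_mx_row -[0]hsubmxK => /eq_row_mx[].
  rewrite linear0 => wJ; rewrite linear0 bE => wb.
  have /sub_rVP[s Es] : (w <= u)%MS by apply: submx_trans keru; apply/sub_kermxP.
  have := congr1 (fun M : 'M[K]_1 => M 0 0) wb; rewrite !mxE eqxx mulr1n Es mxE.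
  by move/eqP; rewrite mulf_eq0 (negbTE ui0) orbF => /eqP ->; rewrite scale0r.
have [Y TY] := row_freeP freeT.
pose g x : K^o := \det (T x *m Y).
have smg : smooth V g.
  move=> k; apply: Ck_det => // i j.
  apply: (Ck_eq (f := fun x => \sum_l T x i l * Y l j : K^o)) => //.
    by move=> x _; rewrite mxE.
  apply: Ck_sum => // l; apply: CkM => //; last exact: Ck_cst.
  rewrite -(splitK l); case: (fintype.split l) => l' /=.
    apply: (Ck_eq (f := fun x => 'd f x (delta_mx 0 i) 0 l' : K^o)) => //.
      by move=> x _; rewrite row_mxEl jacobianE.
    by apply: Ck_coord => //; exact: Ck_deriv (smf k.+1).
  apply: (Ck_eq (f := fun=> b i l' : K^o)) => //; last exact: Ck_cst.
  by move=> x _; rewrite row_mxEr.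
exists (V `&` g @^-1` [set y | y != 0]); split.
- exact: open_preimage oV (smg 0%N) open_neq0.
- by split=> //; rewrite /preimage /= /g TY det1 oner_neq0.
- by move=> x [].
move=> q w w' [Vq gq] dw dw' w0.
have Tu : T q *m Y \in unitmx by rewrite unitmxE unitfE.
have inj x : 'd f q x = 0 -> x 0 i0 = 0 -> x = 0.
  move=> dx xi; have xT : x *m T q = 0.
    rewrite /T mul_mx_row jacobian_mulE dx bE xi -[RHS]hsubmxK !linear0.
    by congr row_mx; apply/matrixP => i j; rewrite !mxE mul0rn.
  by rewrite -[x](mulmxK Tu) mulmxA xT !mul0mx.
have wi : w 0 i0 != 0 by apply: contraNneq w0 => wi; rewrite (inj w).
exists (w' 0 i0 / w 0 i0); apply/eqP; rewrite -subr_eq0; apply/eqP; apply: inj.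
  by rewrite -jacobian_mulE mulmxBl -scalemxAl !jacobian_mulE dw dw' scaler0 subrr.
by rewrite !mxE divfK // subrr.
Qed.

End SingularPoints.

(** * Linear algebra of the frame and of the affine map *)

Section AdaptedFrames.
Context {F : fieldType}.

(** The pairings of the vectors [vs] with the columns of [P] form a triangular matrix with non-zero
    diagonal. *)
Lemma triangular_left_inverse n j (P : 'M[F]_(n, j)) (vs : nat -> 'rV[F]_n) :
  (forall i : 'I_j, (vs i *m P) 0 i != 0 /\ forall l : 'I_j, (l < i)%N -> (vs i *m P) 0 l = 0) ->
  exists B : 'M[F]_(j, n), B *m P = 1%:M.
Proof.
move=> Hvs; pose G : 'M[F]_(j, n) := \matrix_i vs i.
have LE i l : (G *m P) i l = (vs i *m P) 0 l.
  have -> : (G *m P) i l = (row i (G *m P)) 0 l by rewrite [RHS]mxE.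
  by rewrite row_mul rowK.
have Lu : G *m P \in unitmx.
  rewrite unitmxE unitfE -det_tr det_trig.
    by apply/prodf_neq0 => i _; rewrite mxE LE; have [] := Hvs i.
  by apply/is_trig_mxP => i l il; rewrite mxE LE; have [_] := Hvs l; exact.
by exists (invmx (G *m P) *m G); rewrite -mulmxA mulVmx.
Qed.

Lemma row_n0_gt0 n (u : 'rV[F]_n) : u != 0 -> (0 < n)%N.
Proof. by case: n u => [|//] u; rewrite thinmx0 eqxx. Qed.

Lemma rank_ker_row n (u : 'rV[F]_n) : u != 0 -> \rank (kermx u^T) = n.-1.
Proof. by move=> u0; rewrite mxrank_ker mxrank_tr rank_rV u0 subn1. Qed.

(** Columns are covectors. Those of [P] lie in the annihilator of [u], are completed there to a
    basis, and [b] supplies the missing direction since it does not kill [u]. *)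
Lemma complete_basis n m (P : 'M[F]_(n, m)) (B : 'M[F]_(m, n)) (u : 'rV[F]_n) (b : 'cV[F]_n) :
  B *m P = 1%:M -> u *m P = 0 -> u *m b = 1%:M ->
  exists M : 'M[F]_n, [/\ M \in unitmx,
    forall (i : 'I_n) (l : 'I_m), i = l :> nat -> col i M = col l P,
    forall i : 'I_n, i = n.-1 :> nat -> col i M = b &
    forall i : 'I_n, (i < n.-1)%N -> u *m col i M = 0].
Proof.
move=> BP uP ub.
have u0 : u != 0.
  apply/eqP => u0; move: ub; rewrite u0 mul0mx => /matrixP/(_ 0 0); rewrite !mxE /=.
  by move/esym/eqP; rewrite oner_eq0.
pose W := kermx u^T.
have PW : (P^T <= W)%MS by apply/sub_kermxP; rewrite -trmx_mul uP trmx0.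
have rP : \rank P^T = m.
  by apply/eqP; apply/row_freeP; exists B^T; rewrite -trmx_mul BP trmx1.
have [r [D [DW freeD En]]] : exists r (D : 'M[F]_(r, n)),
    [/\ (D <= W)%MS, row_free (col_mx P^T D) & n = (m + r + 1)%N].
  exists (\rank (W :\: P^T)%MS), (row_base (W :\: P^T)%MS).
  have rD : (m + \rank (W :\: P^T)%MS)%N = n.-1.
    by rewrite -(rank_ker_row u0) -(mxrank_cap_compl W P^T) (capmx_idPr PW) rP.
  split; first by rewrite eq_row_base diffmxSl.
    rewrite /row_free -addsmxE (adds_eqmx (eqmx_refl _) (eq_row_base _)).
    by rewrite mxrank_disjoint_sum ?rP // capmxC capmx_diff.
  by rewrite rD addn1 prednK // (row_n0_gt0 u0).
subst n; pose T := col_mx (col_mx P^T D) b^T.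
have Du : D *m u^T = 0 by apply/sub_kermxP.
have Pu : P^T *m u^T = 0 by rewrite -trmx_mul uP trmx0.
have bu : b^T *m u^T = 1%:M by rewrite -trmx_mul ub trmx1.
have uT : T \in unitmx.
  (* Pairing a vanishing combination with [u] isolates the coefficient of [b]. *)
  rewrite -row_free_unit; apply: inj_row_free => y; rewrite -[y]hsubmxK mul_row_col => E.
  have y2 : rsubmx y = 0.
    have := congr1 (mulmx^~ u^T) E.
    by rewrite mulmxDl -!mulmxA bu mul_col_mx Pu Du col_mx0 mulmx0 add0r mulmx1 mul0mx.
  move: E; rewrite y2 mul0mx addr0 => E.
  by rewrite (row_free_inj freeD (etrans E (esym (mul0mx _ _)))) row_mx0.
exists T^T; split; first by rewrite unitmx_tr.
- move=> i l il; rewrite -tr_row -[P]trmxK -tr_row; congr _^T.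
  have -> : i = lshift 1 (lshift r l) by apply/val_inj.
  by rewrite /T !rowKu.
- have E1 : (m + r + 1).-1 = (m + r)%N by rewrite addn1.
  move=> i; rewrite E1 => il; rewrite -tr_row -[b]trmxK; congr _^T.
  have -> : i = rshift (m + r) (0 : 'I_1) by apply/val_inj; rewrite /= addn0.
  by rewrite rowKd row_id.
move=> i il; rewrite -tr_row -[u]trmxK -trmx_mul -row_mul /T !mul_col_mx Pu Du bu.
rewrite -[RHS]trmx0; congr _^T; apply/rowP => j; rewrite !mxE.
case: splitP => [i' Ei|i' Ei]; first by rewrite mxE; case: splitP => ? _; rewrite mxE.
by move: il; rewrite Ei (ord1 i') addn0 addn1 ltnn.
Qed.

(** The columns of [A] are the normal, a second vector of the kernel of [J], and preimages under [J]
    of the columns of [M] other than the last. Independence follows by applying [J] first, which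
    leaves a relation between the two kernel vectors. *)
Lemma adapted_frame n N (J : 'M[F]_(n, N)) (u : 'rV[F]_n) (nu0 : 'rV[F]_N) (M : 'M[F]_n) :
  N = n.+1 -> \rank J = n.-1 -> u != 0 -> u *m J = 0 -> nu0 != 0 -> J *m nu0^T = 0 ->
  M \in unitmx -> (forall i : 'I_n, (i < n.-1)%N -> u *m col i M = 0) ->
  exists A : 'M[F]_N, [/\ A \in unitmx,
    forall j : 'I_N, j = 0%N :> nat -> col j A = nu0^T,
    forall j : 'I_N, (j < 2)%N -> J *m col j A = 0 &
    forall (j : 'I_N) (i : 'I_n), (i < n.-1)%N -> j = i.+2 :> nat -> J *m col j A = col i M].
Proof.
move=> EN; subst N => rJ u0 uJ nu0' Jnu uM uMi.
have n_gt0 := row_n0_gt0 u0; case: n n_gt0 => // n _ in J u nu0 M rJ u0 uJ nu0' Jnu uM uMi *.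
(* The image of [J] on columns lies in the annihilator of [u] and has the same rank, so the
   preimages exist. From here on the [n] of the statement is [n.+1]. *)
have JW : (kermx u^T <= J^T)%MS.
  have JW : (J^T <= kermx u^T)%MS by apply/sub_kermxP; rewrite -trmx_mul uJ trmx0.
  by rewrite -(geq_leqif (mxrank_leqif_sup JW)) rank_ker_row // mxrank_tr rJ.
have alphaK (i : 'I_n.+1) : (i < n)%N -> (col i M)^T *m pinvmx J^T *m J^T = (col i M)^T.
  move=> /uMi uM0; apply: mulmxKpV; apply: submx_trans JW; apply/sub_kermxP.
  by rewrite -trmx_mul uM0 trmx0.
have nuk : (nu0 <= kermx J^T)%MS.
  by apply/sub_kermxP; rewrite -[nu0]trmxK -trmx_mul Jnu trmx0.
(* The kernel has dimension 2, so some vector in it is not proportional to the normal. *)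
have /row_subPn[i0 c2n] : ~~ (kermx J^T <= nu0)%MS.
  apply/negP => /mxrankS; rewrite mxrank_ker mxrank_tr rJ rank_rV nu0' /=.
  by rewrite subSn ?subSnn // ltnW.
pose c2 := row i0 (kermx J^T).
have c2J : c2 *m J^T = 0 by rewrite -row_mul mulmx_ker row0.
pose ro (j : 'I_n.+2) : 'rV[F]_n.+2 := if j == 0 :> nat then nu0 else if j == 1%N :> nat then c2
  else (col (inord j.-2) M)^T *m pinvmx J^T.
pose T : 'M[F]_n.+2 := \matrix_j ro j.
have TJ (j : 'I_n.+2) : (j < 2)%N -> row j T *m J^T = 0.
  case: j => -[|[|//]] lj _; rewrite rowK /ro //=.
  by rewrite -[nu0]trmxK -trmx_mul Jnu trmx0.
have TJ2 (j : 'I_n.+2) (i : 'I_n.+1) : (i < n)%N -> j = i.+2 :> nat ->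
    row j T *m J^T = (col i M)^T.
  move=> il ji; rewrite rowK /ro ji /= inord_val; exact: alphaK.
have uT : T \in unitmx.
  rewrite -row_free_unit; apply: inj_row_free => y yT.
  (* The coefficients of the non-kernel columns, padded by 0 at the last column of [M], which has no
     preimage among the columns of [A]. *)
  pose y' : 'rV[F]_n.+1 := \row_i (if (i < n)%N then y 0 (inord i.+2) else 0).
  have y'0 : y' = 0.
    have : y' *m M^T = y *m T *m J^T.
      rewrite -mulmxA [LHS]mulmx_sum_row [RHS]mulmx_sum_row big_ord_recr /= mxE ltnn scale0r addr0.
      rewrite !big_ord_recl !row_mul !TJ // !scaler0 !add0r.
      apply: eq_bigr => i _; rewrite row_mul mxE /= ltn_ord -tr_col (TJ2 _ (widen_ord (leqnSn n) i) (ltn_ord i)) //.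
      by congr (y 0 _ *: _); apply/val_inj; rewrite /= inordK //= !ltnS.
    rewrite yT mul0mx => E; have uMT : M^T \in unitmx by rewrite unitmx_tr.
    by rewrite -[y'](mulmxK uMT) E mul0mx.
  have y2 (j : 'I_n.+2) : (1 < j)%N -> y 0 j = 0.
    move=> j1; have [i Ei] : exists i : 'I_n, j = i.+2 :> nat.
      by case: j j1 => -[|[|j]] //= lj _; exists (Ordinal (lj : j < n)%N).
    have := congr1 (fun w : 'rV[F]_n.+1 => w 0 (widen_ord (leqnSn n) i)) y'0.
    rewrite !mxE /= ltn_ord => <-; congr (y 0 _); apply/val_inj.
    by rewrite /= inordK // !ltnS.
  have y01 : y 0 0 *: nu0 + y 0 (lift ord0 ord0) *: c2 = 0.
    rewrite -[RHS]yT mulmx_sum_row !big_ord_recl !rowK /ro /= big1 ?addr0 // => i _.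
    by rewrite y2 // scale0r.
  have y1 : y 0 (lift ord0 ord0) = 0.
    apply/eqP; apply: contraNT c2n => y1; apply/sub_rVP.
    exists (- (y 0 (lift ord0 ord0))^-1 * y 0 0).
    apply: (scalerI y1); rewrite scalerA mulrA mulrN mulfV // mulN1r scaleNr.
    by apply/eqP; rewrite -addr_eq0 addrC y01.
  move: y01; rewrite y1 scale0r addr0 => /eqP; rewrite scaler_eq0 (negbTE nu0') orbF => /eqP y0.
  apply/rowP => -[[|[|j]] lj]; rewrite mxE; last by apply: y2.
    by rewrite -[RHS]y0; congr (y 0 _); apply/val_inj.
  by rewrite -[RHS]y1; congr (y 0 _); apply/val_inj.
have colT j : col j T^T = (row j T)^T by rewrite tr_row.
exists T^T; split; first by rewrite unitmx_tr.
- by move=> j j0; rewrite colT rowK /ro j0.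
- by move=> j j2; rewrite colT -[J]trmxK -trmx_mul TJ // trmx0.
by move=> j i il ji; rewrite colT -[J]trmxK -trmx_mul (TJ2 _ _ il ji) trmxK.
Qed.

End AdaptedFrames.

(** * The strata S_j as zero sets and their tangent spaces *)

Section Strata.
Context {R : realType} {c : scalar_kind} {n : nat}.
Local Notation K := (scalars R c).

Lemma singular_set_le U (f : 'rV[K]_n -> 'rV[K]_(n + 1)) i j :
  (i <= j)%N -> singular_set U f j `<=` singular_set U f i.
Proof.
by move=> /subnKC <-; elim: (j - i)%N => [|d IH] q; rewrite ?addn0 ?addnS //= => -[/IH].
Qed.

Lemma smooth_lambda (V : set 'rV[K]_n) (f nu : 'rV[K]_n -> 'rV[K]_(n + 1)) eta l :
  open V -> smooth V f -> smooth V nu -> ((0 < l)%N -> smooth V eta) ->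
  smooth V (lambda_ f nu eta l).
Proof.
move=> oV smf smnu; elim: l => [|l IH] sme k.
  by apply: Ck_det => // i j; apply: smooth_col_mx.
apply: (@Ck_diff_apply _ _ n k V _ (lambda_ f nu eta l) eta (fun x => x)) => // [j|]; last exact: sme.
by apply: Ck_deriv; apply: (IH _ k.+1) => _; apply: sme.
Qed.

Lemma not_set_injP (S : set 'rV[K]_n) (g : {linear 'rV[K]_n -> 'rV[K]_(n + 1)}) :
  S 0 -> (forall v w, S v -> S w -> S (v - w)) ->
  (~ set_inj S g) <-> exists w, [/\ S w, w != 0 & g w = 0].
Proof.
move=> S0 SB; split=> [H|[w [Sw w0 gw]] inj]; last first.
  by move/eqP: w0; apply; apply: inj; rewrite ?inE // gw linear0.
apply: contrapT => Hn; apply: H => v w; rewrite !inE => Sv Sw gvw.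
apply/eqP; rewrite -subr_eq0; apply/negP => /negP vw; apply: Hn.
exists (v - w); split=> //; first exact: SB.
by rewrite linearB /= gvw subrr.
Qed.

Section Filtration.
Variables (V : set 'rV[K]_n) (p : 'rV[K]_n) (lam : nat -> 'rV[K]_n -> K^o) (k : nat).
Hypotheses (oV : open V) (Vp : V p) (smlam : forall l, (l < k)%N -> smooth V (lam l)).

Lemma triangular_implicit_tangent j (vs : nat -> 'rV[K]_n) : (j <= k)%N ->
  (forall i, (i < j)%N -> 'd (lam i) p (vs i) != 0 /\
     forall l, (l < i)%N -> 'd (lam l) p (vs i) = 0) ->
  exists N : set 'rV[K]_n, [/\ open N, N p, N `<=` V &
    forall (S : set 'rV[K]_n) q v,
      (forall y, N y -> (forall l, (l < j)%N -> lam l y = 0) -> S y) -> N q ->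
      (forall l, (l < j)%N -> lam l q = 0) ->
      (forall l, (l < j)%N -> 'd (lam l) q v = 0) -> tangent_space S q v].
Proof.
move=> jk Hvs; pose F (x : 'rV[K]_n) : 'rV[K]_j := \row_(l < j) lam l x.
have ltk (l : 'I_j) : (l < k)%N by apply: leq_trans jk.
have smF : smooth V F.
  move=> r; apply: Ck_row => // l; apply: Ck_eq (smlam (ltk l) r) => //.
  by move=> x _; rewrite mxE.
have dF x (l : 'I_j) v : V x -> 'd F x v 0 l = 'd (lam l) x v.
  move=> Vx; have d1 := is_diff_coord l (smooth_diff smF Vx).
  have d2 : is_diff x (fun y => F y 0 l : K^o) ('d (lam l) x).
    have -> : (fun y => F y 0 l : K^o) = lam l by apply/funext => y; rewrite mxE.
    exact: smooth_diff (smlam (ltk l)) Vx.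
  by have := congr1 (fun g => g v) (etrans (esym (diff_val (is_diff_def := d1))) (diff_val (is_diff_def := d2))).
have [B BA] : exists B : 'M[K]_(j, n), B *m 'J F p = 1%:M.
  apply: (triangular_left_inverse (vs := vs)) => i; rewrite jacobian_mulE dF //.
  by have [di dl] := Hvs i (ltn_ord i); split=> // l li; rewrite dF // dl.
have [N [oN Np NV HN]] := implicit_tangent oV Vp smF BA.
exists N; split=> // S q v NS Nq lamq dlam; apply: HN => //.
- move=> y Ny Fy; apply: NS => // l lj.
  by have := congr1 (fun w : 'rV[K]_j => w 0 (Ordinal lj)) Fy; rewrite !mxE.
- by apply/rowP => l; rewrite !mxE lamq.
- by apply/rowP => l; rewrite dF ?mxE ?dlam //; apply: NV.
Qed.

Variables (U : set 'rV[K]_n) (f : 'rV[K]_n -> 'rV[K]_(n + 1)) (eta : 'rV[K]_n -> 'rV[K]_n).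
Hypotheses (VU : V `<=` U).
Hypothesis lam0 : forall q, V q -> (lam 0%N q = 0 <-> exists2 u, u != 0 & 'd f q u = 0).
Hypothesis line : forall q w w', V q -> 'd f q w = 0 -> 'd f q w' = 0 -> w != 0 ->
  exists s, w' = s *: w.
Hypothesis lamS : forall l q, lam l.+1 q = 'd (lam l) q (eta q).
Hypothesis null : (1 < k)%N -> forall q, V q -> singular_set U f 1 q ->
  eta q != 0 /\ 'd f q (eta q) = 0.
Hypothesis nondeg : forall j, (j < k)%N ->
  exists2 v, tangent_space (singular_set U f j) p v & 'd (lam j) p v != 0.
Hypothesis Sp : forall j, (j <= k)%N -> singular_set U f j p.

Lemma lam_differentiable l q : (l < k)%N -> V q -> differentiable (lam l) q.
Proof. by move=> lk Vq; have [? _] := smooth_diff (smlam lk) Vq. Qed.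

Definition cut_out j (N : set 'rV[K]_n) :=
  forall q, N q -> (singular_set U f j q <-> forall l, (l < j)%N -> lam l q = 0).

Definition tangent_cut_out j (N : set 'rV[K]_n) :=
  forall q, N q -> singular_set U f j q -> forall v,
    tangent_space (singular_set U f j) q v <-> forall l, (l < j)%N -> 'd (lam l) q v = 0.

(** The vector witnessing nondegeneracy is tangent to S_j, so it kills the earlier differentials:
    this makes the system triangular. *)
Lemma stratum_vectors j : (j < k)%N ->
  (exists N : set 'rV[K]_n, [/\ open N, N p, N `<=` V & cut_out j N]) ->
  exists v, 'd (lam j) p v != 0 /\ forall l, (l < j)%N -> 'd (lam l) p v = 0.
Proof.
move=> jk [N [oN Np NV HN]]; have [v Tv dv] := nondeg jk; exists v; split=> // l lj.
apply: (tangent_space_zero oN Np _ _ Tv); first by move=> y Ny /(HN y Ny); apply.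
exact: lam_differentiable (ltn_trans lj jk) Vp.
Qed.

Lemma stratum_tangent j : (j <= k)%N ->
  (forall i, (i <= j)%N -> exists N : set 'rV[K]_n, [/\ open N, N p, N `<=` V & cut_out i N]) ->
  exists N : set 'rV[K]_n, [/\ open N, N p, N `<=` V, cut_out j N & tangent_cut_out j N].
Proof.
move=> jk Hcut.
have /choice[vs Hvs] : forall i, exists v, (i < j)%N -> 'd (lam i) p v != 0 /\
    forall l, (l < i)%N -> 'd (lam l) p v = 0.
  move=> i; case: (ltnP i j) => ij; last by exists 0.
  have [v Hv] := stratum_vectors (leq_trans ij jk) (Hcut i (ltnW ij)).
  by exists v.
have [N1 [oN1 N1p N1V HN1]] := triangular_implicit_tangent jk Hvs.
have [N2 [oN2 N2p N2V HN2]] := Hcut j (leqnn j).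
have oN : open (N1 `&` N2) by apply: openI.
exists (N1 `&` N2); split=> //; first by move=> y [/N1V].
  by move=> q [_ N2q]; apply: HN2.
move=> q [N1q N2q] Sq v; split=> [Tv l lj|dlam].
  apply: (tangent_space_zero oN _ _ _ Tv) => //.
    by move=> y [_ N2y] /(HN2 y N2y); apply.
  by apply: lam_differentiable (N1V q N1q); apply: leq_trans jk.
have lamq := (HN2 q N2q).1 Sq.
(* The equations describe S_j only on [N2], so the complement of [N2] is added to the set and
   removed again by locality of the tangent space. *)
have := HN1 (singular_set U f j `|` ~` N2) q v.
move=> /(_ _ N1q lamq dlam) T'.
apply: (tangent_space_local oN2 N2q) (T' _) => [y N2y [//|] //|y N1y lamy].
by have [N2y|] := pselect (N2 y); [left; apply/HN2|right].
Qed.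

(** A point of S_j is (j+1)-singular when some null vector is tangent to S_j. Null vectors being
    proportional to [eta], this says that the differentials of the earlier functions vanish on
    [eta], and those values are the next functions [lam]. *)
Theorem stratum_cut_out j : (j <= k)%N ->
  exists N : set 'rV[K]_n, [/\ open N, N p, N `<=` V & cut_out j N].
Proof.
(* Strong induction: the tangent space of S_j uses the equations of all strata up to S_j. *)
elim: j {-2}j (leqnn j) => [|j IH] i ij ik.
  move: ij; rewrite leqn0 => /eqP ->; exists V; split=> // q Vq; split=> // _.
  exact: VU.
move: ij; rewrite leq_eqVlt => /predU1P[Ei|]; last by rewrite ltnS => ij; apply: IH.
rewrite {}Ei in ik *.
have [N [oN Np NV HN HT]] := stratum_tangent (ltnW ik) (fun i ij => IH i ij (leq_trans ij (ltnW ik))).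
exists N; split=> // q Nq.
have Vq := NV q Nq.
have T0 : singular_set U f j q -> tangent_space (singular_set U f j) q 0.
  by move=> Sq; apply/HT => // l _; rewrite linear0.
have TB v w : singular_set U f j q -> tangent_space (singular_set U f j) q v ->
    tangent_space (singular_set U f j) q w -> tangent_space (singular_set U f j) q (v - w).
  move=> Sq /(HT q Nq Sq) Tv /(HT q Nq Sq) Tw; apply/HT => // l lj.
  by rewrite linearB /= Tv // Tw // subrr.
have E : singular_set U f j.+1 q <-> singular_set U f j q /\
    exists w, [/\ tangent_space (singular_set U f j) q w, w != 0 & 'd f q w = 0].
  split=> -[Sq H]; split=> //.
    by apply/not_set_injP => //; [exact: T0|move=> v w; exact: TB].
  by apply/not_set_injP => //; [exact: T0|move=> v w; exact: TB].
split=> [/E[Sq [w [Tw w0 dw]]] l|Hl].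
  rewrite ltnS leq_eqVlt => /predU1P[->|lj]; last by apply: (HN q Nq).1.
  (* For the first stratum [lam 0] detects null vectors directly; [eta] is available as a null field
     only from the second one on. *)
  case: j {IH HN} HT T0 TB E ik Sq Tw => [|j] HT T0 TB E ik Sq Tw.
    by apply/lam0 => //; exists w.
  have [eta0 deta] := null (leq_trans (isT : 1 < j.+2)%N ik) Vq (singular_set_le (isT : 1 <= j.+1)%N Sq).
  have [s Es] := line Vq dw deta w0.
  rewrite lamS Es linearZ /=.
  by have /(_ j (ltnSn j)) := (HT q Nq Sq w).1 Tw; move=> ->; rewrite scaler0.
have Sq : singular_set U f j q by apply/HN => // l lj; apply: Hl; apply: ltnW.
apply/E; split=> //.
case: j {IH HN} HT T0 TB E ik Hl Sq => [|j] HT T0 TB E ik Hl Sq.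
  have [u u0 du] := (lam0 Vq).1 (Hl 0%N isT).
  by exists u; split=> //; apply/HT.
have [eta0 deta] := null (leq_trans (isT : 1 < j.+2)%N ik) Vq (singular_set_le (isT : 1 <= j.+1)%N Sq).
exists (eta q); split=> //; apply/HT => // l lj.
by rewrite -lamS; apply: Hl.
Qed.

Theorem stratum_tangent_cut_out j : (j <= k)%N ->
  exists N : set 'rV[K]_n, [/\ open N, N p, N `<=` V, cut_out j N & tangent_cut_out j N].
Proof.
move=> jk; apply: stratum_tangent => // i ij.
exact: stratum_cut_out (leq_trans ij jk).
Qed.

End Filtration.
End Strata.

(** * The immersion condition without charts *)

Section ProjectiveImmersion.
Context {R : realType} {c : scalar_kind} {n : nat}.
Local Notation K := (scalars R c).
Implicit Types (D V : set 'rV[K]_n) (f nu : 'rV[K]_n -> 'rV[K]_(n + 1)).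

Lemma KdotE m (X Y : 'rV[K]_m) : Kdot X Y = (X *m Y^T) 0 0.
Proof. by rewrite mxE; apply: eq_bigr => j _; rewrite mxE. Qed.

Lemma is_diff_row_mx m1 m2 (E : normedModType K) (g dg : E -> 'rV[K]_m1) (h dh : E -> 'rV[K]_m2) x :
  is_diff x g dg -> is_diff x h dh ->
  is_diff x (fun y => row_mx (g y) (h y)) (fun v => row_mx (dg v) (dh v)).
Proof.
move=> Hg Hh.
have rE (a : 'rV[K]_m1) (b : 'rV[K]_m2) :
    row_mx a b = a *m row_mx 1%:M 0 + b *m row_mx 0 1%:M.
  by rewrite !mul_mx_row !mulmx1 !mulmx0 add_row_mx addr0 add0r.
have := is_diffD (is_diff_mulmxr (row_mx 1%:M 0) Hg) (is_diff_mulmxr (row_mx 0 1%:M) Hh).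
by congr is_diff_def; apply/funext => y; rewrite /= rE.
Qed.

(** With r = nu/nu_i, differentiating nu = nu_i r gives d nu = (d nu_i/nu_i) nu + nu_i dr. *)
Lemma projective_chart_diff D f nu q i : open D -> D q -> smooth D f -> smooth D nu ->
  nu q 0 i != 0 ->
  exists dr : 'rV[K]_n -> 'rV[K]_(n + 1),
    (forall u, 'd (fun x => row_mx (f x) ((nu x 0 i)^-1 *: nu x)) q u = row_mx ('d f q u) (dr u)) /\
    (forall u, 'd nu q u = ('d nu q u 0 i / nu q 0 i) *: nu q + nu q 0 i *: dr u).
Proof.
move=> oD Dq smf smnu nui.
pose D' := D `&` (fun x => nu x 0 i : K^o) @^-1` [set y | y != 0].
have smi : smooth D (fun x => nu x 0 i : K^o) by move=> k; apply: Ck_coord.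
have oD' : open D' by exact: open_preimage oD (smi 0%N) open_neq0.
have D'q : D' q by [].
have D'D : D' `<=` D by move=> x [].
pose r x := (nu x 0 i)^-1 *: nu x.
have smr : smooth D' r.
  move=> k; apply: Ck_scale => //; last exact: Ck_sub D'D (smnu k).
  by apply: CkV => //; [move=> x []|exact: Ck_sub D'D (smi k)].
have dr := smooth_diff smr D'q.
exists ('d r q); split=> u.
  by have H := is_diff_row_mx (smooth_diff smf Dq) dr; rewrite (diff_val (is_diff_def := H)).
have d1 := is_diff_scale (is_diff_coord i (smooth_diff smnu Dq)) dr.
have d2 : is_diff q (fun x => (nu x 0 i : K^o) *: r x) ('d nu q).
  have E y : D' y -> nu y = (nu y 0 i : K^o) *: r y.
    by move=> [_ ny]; rewrite /r scalerA mulfV // scale1r.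
  exact: (is_diff_eq_open oD' D'q E (smooth_diff smnu Dq)).
have := congr1 (fun g => g u) (etrans (esym (diff_val (is_diff_def := d2))) (diff_val (is_diff_def := d1))).
move=> H; apply: etrans H _.
have gen (a b : K) (v w : 'rV[K]_(n + 1)) : a *: w + b *: (a^-1 *: v) = (b / a) *: v + a *: w.
  by rewrite addrC scalerA.
exact: gen.
Qed.

(** Together with its converse below, this restates the immersion property as: no non-zero [u] has
    df(u) = 0 and d nu(u) proportional to nu. In this form it passes through linear maps and
    coordinate changes, where the affine charts of P^n would not match. *)
Lemma projective_immersion_kernel D f nu q u s : open D -> D q -> smooth D f -> smooth D nu ->
  nu q != 0 -> projective_immersion_at f nu q ->
  'd f q u = 0 -> 'd nu q u = s *: nu q -> u = 0.
Proof.
move=> oD Dq smf smnu nu0 imm dfu dnu.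
have /rV0Pn[i nui] := nu0.
have [dr [H1 H2]] := projective_chart_diff oD Dq smf smnu nui.
apply: (imm i nui); rewrite linear0 H1 dfu.
have : nu q 0 i *: dr u = 0.
  have := H2 u; rewrite dnu mxE mulfK // => /eqP.
  by rewrite -[X in X == _]addr0 (inj_eq (addrI _)) => /eqP.
by move=> /eqP; rewrite scaler_eq0 (negbTE nui) => /eqP ->; rewrite row_mx0.
Qed.

Lemma kernel_projective_immersion D f nu q : open D -> D q -> smooth D f -> smooth D nu ->
  (forall u s, 'd f q u = 0 -> 'd nu q u = s *: nu q -> u = 0) ->
  projective_immersion_at f nu q.
Proof.
move=> oD Dq smf smnu inj i nui u v E.
have [dr [H1 H2]] := projective_chart_diff oD Dq smf smnu nui.
apply/eqP; rewrite -subr_eq0; apply/eqP.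
have : 'd (fun x => row_mx (f x) ((nu x 0 i)^-1 *: nu x)) q (u - v) = 0.
  by rewrite linearB /= E subrr.
rewrite H1 -[0]hsubmxK => /eq_row_mx[]; rewrite linear0 => dfu; rewrite linear0 => dru.
by apply: inj dfu _; rewrite H2 dru scaler0 addr0.
Qed.

End ProjectiveImmersion.

(** * The covectors that become the coordinate differentials *)

Section AdaptedBasis.
Context {F : fieldType}.

Lemma exists_dual n (u : 'rV[F]_n) : u != 0 -> exists b : 'cV[F]_n, u *m b = 1%:M.
Proof.
move=> u0; have /row_freeP[B uB] : row_free u by rewrite /row_free rank_rV u0.
by exists B.
Qed.

(** The last covector a_(k-1) decides: if it kills [u] it joins the columns in the annihilator of
    [u], otherwise it is rescaled to be the dual covector [b]. *)
Lemma adapted_basis n k (u : 'rV[F]_n) (a : nat -> 'cV[F]_n) (vs : nat -> 'rV[F]_n) :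
  (0 < k)%N -> u != 0 ->
  (forall l, (l.+1 < k)%N -> u *m a l = 0) ->
  (forall i, (i < k)%N -> vs i *m a i != 0 /\ forall l, (l < i)%N -> vs i *m a l = 0) ->
  exists (M : 'M[F]_n) (b : 'cV[F]_n),
    [/\ M \in unitmx, forall i : 'I_n, i = n.-1 :> nat -> col i M = b,
        forall i : 'I_n, (i < n.-1)%N -> u *m col i M = 0 &
        forall i : 'I_n, (i.+1 < k)%N -> col i M = a i] /\
    (u *m a k.-1 = 0 -> forall i : 'I_n, (i < k)%N -> col i M = a i) /\
    (u *m a k.-1 != 0 -> exists2 t, t != 0 & b = t *: a k.-1).
Proof.
move=> k0 u0 ua Hvs.
(* Used with m = k in the first case and m = k - 1 in the second. *)
have key m : (m <= k)%N -> (forall l, (l < m)%N -> u *m a l = 0) ->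
    forall b, u *m b = 1%:M -> exists M : 'M[F]_n,
    [/\ M \in unitmx, forall i : 'I_n, i = n.-1 :> nat -> col i M = b,
        forall i : 'I_n, (i < n.-1)%N -> u *m col i M = 0 &
        forall i : 'I_n, (i < m)%N -> col i M = a i].
  move=> mk um b ub; pose P : 'M[F]_(n, m) := \matrix_(i, l) a l i 0.
  have colP l : col l P = a l by apply/colP => i; rewrite !mxE.
  have mulP (w : 'rV[F]_n) l : (w *m P) 0 l = (w *m a l) 0 0.
    by rewrite !mxE; apply: eq_bigr => i _; rewrite mxE.
  have [B BP] : exists B : 'M[F]_(m, n), B *m P = 1%:M.
    apply: (triangular_left_inverse (vs := vs)) => i.
    have [ai al] := Hvs i (leq_trans (ltn_ord i) mk); split=> [|l li].
      rewrite mulP; apply: contraNneq ai => E; apply/eqP/matrixP => s t.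
      by rewrite !ord1 E mxE.
    by rewrite mulP al // mxE.
  have uP : u *m P = 0 by apply/rowP => l; rewrite mulP um // !mxE.
  have [M [uM ML Mb uMi]] := complete_basis BP uP ub.
  exists M; split=> // i im; rewrite (ML i (Ordinal im)) //; exact: colP.
have [ua0|ua0] := eqVneq (u *m a k.-1) 0.
  have [b ub] := exists_dual u0.
  have [|M [uM Mb uMi Ma]] := key k (leqnn k) _ b ub.
    move=> l; rewrite -(prednK k0) ltnS leq_eqVlt => /predU1P[->//|lk].
    by apply: ua; rewrite -(prednK k0) ltnS.
  exists M, b; split; first by split=> // i ik; apply: Ma; apply: ltnW.
  by split.
have t0 : (u *m a k.-1) 0 0 != 0.
  by apply: contraNneq ua0 => E; apply/eqP/matrixP => s t; rewrite !ord1 E mxE.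
pose b := ((u *m a k.-1) 0 0)^-1 *: a k.-1.
have ub : u *m b = 1%:M.
  apply/matrixP => i j; rewrite !ord1 /b -scalemxAr [LHS]mxE mulVf // [RHS]mxE eqxx.
  by [].
have [|M [uM Mb uMi Ma]] := key k.-1 (leq_pred k) _ b ub.
  by move=> l lk; apply: ua; rewrite -(prednK k0) ltnS.
exists M, b; split; first by split=> // i ik; apply: Ma; rewrite -ltnS prednK.
by split=> [/eqP|_]; [rewrite (negbTE ua0)|exists ((u *m a k.-1) 0 0)^-1; rewrite ?invr_eq0].
Qed.

End AdaptedBasis.

(** * From a nondegenerate front to linear algebra at p *)

Section FrontData.
Context {R : realType} {c : scalar_kind} {n : nat}.
Local Notation K := (scalars R c).
Implicit Types (U V : set 'rV[K]_n) (f nu : 'rV[K]_n -> 'rV[K]_(n + 1)).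

Definition gradient (g : 'rV[K]_n -> K^o) q : 'cV[K]_n := \col_i 'd g q (delta_mx 0 i).

Lemma mulmx_gradient (g : 'rV[K]_n -> K^o) q (v : 'rV[K]_n) :
  v *m gradient g q = ('d g q v : K)%:M.
Proof.
rewrite [X in 'd g q X]row_sum_delta linear_sum /=.
apply/matrixP => i j; rewrite !ord1 !mxE mulr1n; apply: eq_bigr => l _.
by rewrite linearZ mxE.
Qed.

Lemma mulmx_gradient_eq0 (g : 'rV[K]_n -> K^o) q (v : 'rV[K]_n) :
  v *m gradient g q = 0 <-> 'd g q v = 0.
Proof.
rewrite mulmx_gradient; split=> [/matrixP/(_ 0 0)|->]; last by rewrite raddf0.
by rewrite !mxE eqxx mulr1n.
Qed.

Lemma singular_null_vector (S : set 'rV[K]_n) f q :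
  ~ set_inj S ('d f q) -> exists2 w, w != 0 & 'd f q w = 0.
Proof.
move=> H; apply: contrapT => Hn; apply: H => v w _ _ E.
apply/eqP; rewrite -subr_eq0; apply/negP => /negP vw; apply: Hn.
by exists (v - w) => //; rewrite linearB /= E subrr.
Qed.

(** Pairing a vanishing combination of the rows with nu kills the df part, and <nu, nu> being
    non-zero kills the coefficient of nu. *)
Lemma lambda0_eq0 f nu eta q : (forall u, Kdot ('d f q u) (nu q) = 0) ->
  Kdot (nu q) (nu q) != 0 ->
  lambda_ f nu eta 0 q = 0 <-> exists2 u, u != 0 & 'd f q u = 0.
Proof.
move=> orth nunu; split=> /= [/eqP/det0P[v v0]|[u u0 du]].
  rewrite -[v]hsubmxK mul_row_col jacobian_mulE => E.
  have r0 : rsubmx v = 0.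
    have := congr1 (mulmx^~ (nu q)^T) E; rewrite mulmxDl mul0mx.
    have -> : 'd f q (lsubmx v) *m (nu q)^T = 0.
      by apply/matrixP => i j; rewrite !ord1 -KdotE orth mxE.
    rewrite add0r [rsubmx v]mx11_scalar mul_scalar_mx -scalemxAl => /matrixP/(_ 0 0).
    rewrite !mxE [X in _ * X](_ : _ = Kdot (nu q) (nu q)); last by rewrite KdotE mxE.
    by move/eqP; rewrite mulf_eq0 (negbTE nunu) orbF => /eqP ->; rewrite raddf0.
  exists (lsubmx v); last by move: E; rewrite r0 mul0mx addr0.
  by apply: contraNneq v0 => l0; rewrite -[v]hsubmxK l0 r0 row_mx0.
apply/eqP/det0P; exists (row_mx u 0).
  by apply: contraNneq u0; rewrite -[X in _ = X]hsubmxK linear0 => /eq_row_mx[->].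
by rewrite mul_row_col mul0mx addr0 jacobian_mulE du.
Qed.

(** All later steps at p use only this package: [a l] is the gradient of lambda^(l) at p, [u] spans
    the null line, and [vs] witnesses independence. *)
Theorem nondegenerate_front_data U f k p : (0 < k)%N -> is_front U f ->
  k_nondegenerate U f k p ->
  exists (N : set 'rV[K]_n) nu (u : 'rV[K]_n) (a : nat -> 'cV[K]_n) (vs : nat -> 'rV[K]_n),
  [/\ open N, N p & N `<=` U] /\ [/\ smooth N f, smooth N nu & normal_field N f nu] /\
  [/\ \rank ('J f p) = n.-1, u != 0 & u *m 'J f p = 0] /\
  (forall j, (j <= k)%N -> forall v,
     tangent_space (singular_set U f j) p v <-> forall l, (l < j)%N -> v *m a l = 0) /\
  (forall l, (l.+1 < k)%N -> u *m a l = 0) /\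
  (singular_set U f k.+1 p <-> u *m a k.-1 = 0) /\
  (forall i, (i < k)%N -> vs i *m a i != 0 /\ forall l, (l < i)%N -> vs i *m a l = 0).
Proof.
move=> k0 [df _] [V [nu [eta [[oV Vp VU [dnu Hnu]] [Heta Hj]]]]].
have smf : smooth V f by apply: Kdifferentiable_smooth => //; apply: Kdifferentiable_sub df.
have smnu : smooth V nu by apply: Kdifferentiable_smooth.
pose lam := lambda_ f nu eta.
have smlam l : (l < k)%N -> smooth V (lam l).
  move=> lk; apply: smooth_lambda => // l0; apply: Kdifferentiable_smooth => //.
  by have [] := Heta (leq_ltn_trans l0 lk).
have orth q w : V q -> Kdot ('d f q w) (nu q) = 0 by move=> /Hnu[].
have [[_ /singular_null_vector[u u0 dfu]] [v0 _ dlv]] := Hj 1%N (introT andP (conj isT k0)).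
have nup : nu p != 0 by have [] := Hnu p Vp.
have [rJ nunu] := nondegenerate_rank oV Vp smf smnu orth nup u0 dfu dlv.
have [N1 [oN1 N1p N1V line]] := null_line_near oV Vp smf u0 dfu rJ.
have smdot : smooth V (fun q => Kdot (nu q) (nu q) : K^o).
  by move=> r; apply: Ck_sum => // j; apply: CkM => //; apply: Ck_coord.
pose N := N1 `&` (V `&` (fun q => Kdot (nu q) (nu q) : K^o) @^-1` [set y | y != 0]).
have oN : open N by apply: openI => //; apply: open_preimage oV (smdot 0%N) open_neq0.
have Np : N p by [].
have NV : N `<=` V by move=> q [_ []].
have smlamN l : (l < k)%N -> smooth N (lam l) by move=> lk r; apply: Ck_sub NV (smlam l lk r).
have lam0 q : N q -> (lam 0%N q = 0 <-> exists2 u, u != 0 & 'd f q u = 0).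
  by move=> [_ [Vq nq]]; apply: lambda0_eq0 => // w; apply: orth.
have lineN q w w' : N q -> 'd f q w = 0 -> 'd f q w' = 0 -> w != 0 -> exists s, w' = s *: w.
  by move=> [N1q _]; apply: line.
have nullN : (1 < k)%N -> forall q, N q -> singular_set U f 1 q -> eta q != 0 /\ 'd f q (eta q) = 0.
  by move=> k1 q /NV Vq; have [_] := Heta k1; apply.
have nondeg j : (j < k)%N -> exists2 v, tangent_space (singular_set U f j) p v & 'd (lam j) p v != 0.
  by move=> jk; have [] := Hj j.+1 (introT andP (conj isT jk)).
have Sp j : (j <= k)%N -> singular_set U f j p.
  by case: j => [|j] jk; [apply: VU|have [] := Hj j.+1 (introT andP (conj isT jk))].
have lamS l q : lam l.+1 q = 'd (lam l) q (eta q) by [].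
have NU : N `<=` U by move=> q /NV/VU.
have cut j : (j <= k)%N -> exists N' : set 'rV[K]_n,
    [/\ open N', N' p, N' `<=` N, cut_out lam U f j N' & tangent_cut_out lam U f j N'].
  exact: (stratum_tangent_cut_out oN Np smlamN NU lam0 lineN lamS nullN nondeg).
have Tp j w : (j <= k)%N ->
    (tangent_space (singular_set U f j) p w <-> forall l, (l < j)%N -> 'd (lam l) p w = 0).
  move=> jk; have [N' [_ N'p _ _ H]] := cut j jk; exact: H N'p (Sp j jk) w.
(* At p the vector [u] is a multiple of eta, so the differential of lambda^(l) on it is a multiple
   of lambda^(l+1)(p), zero because p lies in S_(l+2). *)
have ulam l : (l.+1 < k)%N -> 'd (lam l) p u = 0.
  move=> lk; have [N' [_ N'p _ /(_ p N'p) H _]] := cut l.+2 lk.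
  have k1 : (1 < k)%N by apply: leq_ltn_trans lk.
  have [eta0 deta] := nullN k1 p Np (Sp 1%N k0).
  have [s ->] := lineN p _ u Np deta dfu eta0.
  by rewrite linearZ /= -lamS (H.1 (Sp _ lk)) // scaler0.
have /choice[vs Hvs] : forall i, exists w, (i < k)%N -> 'd (lam i) p w != 0 /\
    forall l, (l < i)%N -> 'd (lam l) p w = 0.
  move=> i; case: (ltnP i k) => ik; last by exists 0.
  have [w Tw dw] := nondeg i ik; exists w; split=> //.
  exact/Tp/Tw/ltnW.
(* By [ulam], tangency of [u] to S_k is automatic for all equations except the last one. *)
have orderS : singular_set U f k.+1 p <-> 'd (lam k.-1) p u = 0.
  have T0 : tangent_space (singular_set U f k) p 0 by apply/Tp => // l _; rewrite linear0.
  have TB v w : tangent_space (singular_set U f k) p v ->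
      tangent_space (singular_set U f k) p w -> tangent_space (singular_set U f k) p (v - w).
    by move=> /Tp Tv /Tp Tw; apply/Tp => // l lk; rewrite linearB /= Tv // Tw // subrr.
  split=> [[_ /not_set_injP[]// w [/Tp Tw w0 dw]]|du].
    have [s ->] := lineN p w u Np dw dfu w0.
    by rewrite linearZ /= (Tw (leqnn k)) ?scaler0 // prednK.
  split; first exact: Sp.
  apply/not_set_injP => //; exists u; split=> //; apply/Tp => // l.
  rewrite -(prednK k0) ltnS leq_eqVlt => /predU1P[->//|lk].
  by apply: ulam; rewrite -(prednK k0) ltnS.
exists N, nu, u, (fun l => gradient (lam l) p), vs; split; first by [].
split.
  split; [by move=> r; apply: Ck_sub NV (smf r)|by move=> r; apply: Ck_sub NV (smnu r)|].
  by split; [exact: Kdifferentiable_sub NV dnu|move=> q /NV; exact: Hnu].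
split; first by rewrite jacobian_mulE.
split.
  move=> j jk v; split=> [/(Tp j v jk) H l lj|H]; first by apply/mulmx_gradient_eq0/H.
  by apply/Tp => // l lj; apply/mulmx_gradient_eq0/H.
split; first by move=> l lk; apply/mulmx_gradient_eq0/ulam.
split; first by rewrite orderS mulmx_gradient_eq0.
move=> i ik; have [di dl] := Hvs i ik; split.
  by apply: contraNneq di => /mulmx_gradient_eq0 ->.
by move=> l li; apply/mulmx_gradient_eq0/dl.
Qed.

End FrontData.

Lemma mulmx_col (F : pzRingType) n (w : 'rV[F]_n) (M : 'M[F]_n) i :
  w *m col i M = ((w *m M) 0 i)%:M.
Proof.
apply/matrixP => s t; rewrite !ord1 !mxE mulr1n; apply: eq_bigr => l _.
by rewrite mxE.
Qed.

Lemma ord_succ_eq n (i : 'I_n) : (i.+1 == n) = (i == n.-1 :> nat).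
Proof. by case: n i => [[]|n i]. Qed.

Lemma ord_shift2_lt n (i : 'I_n) (j : 'I_(n + 1)) : j = i.+2 :> nat -> (i < n.-1)%N.
Proof. by move=> ji; have := ltn_ord j; rewrite ji [X in (_ < X)%N]addn1 ltnS ltn_predRL. Qed.

(** * The chart built from f and one extra covector *)

Section AdaptedChart.
Context {R : realType} {c : scalar_kind} {n : nat}.
Local Notation K := (scalars R c).

(** Drops the first two components and leaves 0 in the last slot, where the covector [b] is added;
    with indices from 0 this realizes the shift in (P_5). *)
Definition shift2_mx : 'M[K]_(n + 1, n) := \matrix_(j, i) (j == i.+2 :> nat)%:R.

Lemma mulmx_shift2 (y : 'rV[K]_(n + 1)) (i : 'I_n) (j : 'I_(n + 1)) :
  j = i.+2 :> nat -> (y *m shift2_mx) 0 i = y 0 j.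
Proof.
move=> ji; rewrite mxE (bigD1 j) //= mxE ji eqxx mulr1 big1 ?addr0 // => l lj.
rewrite mxE -ji; have -> : (l == j :> nat) = false by apply: negbTE.
by rewrite mulr0.
Qed.

Lemma mulmx_shift2_last (y : 'rV[K]_(n + 1)) (i : 'I_n) :
  i = n.-1 :> nat -> (y *m shift2_mx) 0 i = 0.
Proof.
move=> il; rewrite mxE big1 // => l _; rewrite mxE.
have /negbTE -> : l != i.+2 :> nat by apply/eqP => /ord_shift2_lt; rewrite il ltnn.
by rewrite mulr0.
Qed.

Lemma mulmx_basis_vector (s : 'M[K]_1) (i : 'I_n) :
  (s *m basis_vector n n) 0 i = if i == n.-1 :> nat then s 0 0 else 0.
Proof.
rewrite mxE big_ord1 mxE ord_succ_eq.
by case: eqP => _; rewrite ?mulr1 ?mulr0.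
Qed.

Variables (f : 'rV[K]_n -> 'rV[K]_(n + 1)) (p : 'rV[K]_n) (A : 'M[K]_(n + 1)) (b : 'cV[K]_n).

Definition adapted_chart (q : 'rV[K]_n) : 'rV[K]_n :=
  (f q - f p) *m A *m shift2_mx + (q - p) *m b *m basis_vector n n.

Lemma adapted_chart0 : adapted_chart p = 0.
Proof. by rewrite /adapted_chart !subrr !mul0mx addr0. Qed.

Lemma adapted_chartE q (i : 'I_n) (j : 'I_(n + 1)) : j = i.+2 :> nat ->
  adapted_chart q 0 i = ((f q - f p) *m A) 0 j.
Proof.
move=> ji; rewrite /adapted_chart [LHS]mxE (mulmx_shift2 _ ji) mulmx_basis_vector.
by rewrite ltn_eqF ?addr0 // (ord_shift2_lt ji).
Qed.

Variable N : set 'rV[K]_n.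
Hypotheses (oN : open N) (smf : smooth N f).

Lemma smooth_adapted_chart : smooth N adapted_chart.
Proof.
have s1 : smooth N (fun q => (f q - f p) *m A *m shift2_mx).
  by do 2 apply: smooth_mulmxr => //; apply: smooth_sub_cst.
have s2 : smooth N (fun q => (q - p) *m b *m basis_vector n n).
  by do 2 apply: smooth_mulmxr => //; apply: smooth_sub_cst => //; apply: smooth_id.
by move=> k; apply: CkD.
Qed.

Lemma diff_adapted_chart q v : N q ->
  'd adapted_chart q v = 'd f q v *m A *m shift2_mx + v *m b *m basis_vector n n.
Proof.
move=> Nq; have d1 := is_diffB (smooth_diff smf Nq) (is_diff_cst (f p) q).
have d2 := is_diffB (is_diff_id q) (is_diff_cst p q).
have d3 := is_diffD (is_diff_mulmxr shift2_mx (is_diff_mulmxr A d1))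
  (is_diff_mulmxr (basis_vector n n) (is_diff_mulmxr b d2)).
have := congr1 (fun g => g v) (diff_val (is_diff_def := d3)).
by move=> /= E; apply: etrans E _; rewrite /= !subr0.
Qed.

Lemma jacobian_adapted_chart (M : 'M[K]_n) : N p ->
  (forall (j : 'I_(n + 1)) (i : 'I_n), (i < n.-1)%N -> j = i.+2 :> nat ->
     'J f p *m col j A = col i M) ->
  (forall i : 'I_n, i = n.-1 :> nat -> col i M = b) ->
  'J adapted_chart p = M.
Proof.
move=> Np H1 H2; apply/row_matrixP => l; apply/rowP => i.
rewrite !rowE jacobian_mulE diff_adapted_chart // [LHS]mxE -jacobian_mulE.
have colE' (v : 'rV[K]_n) (y : 'cV[K]_n) : col i M = y -> (v *m M) 0 i = (v *m y) 0 0.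
  by move=> <-; rewrite mulmx_col [RHS]mxE eqxx mulr1n.
rewrite mulmx_basis_vector; case: eqP => il.
  by rewrite mulmx_shift2_last // add0r (colE' _ b) // H2.
have il' : (i < n.-1)%N.
  have n0 : (0 < n)%N by apply: leq_trans (ltn_ord i).
  by rewrite ltn_neqAle -ltnS prednK // ltn_ord andbT; apply/eqP.
have jn : (i.+2 < n + 1)%N.
  by rewrite addn1 ltnS -ltn_predRL.
pose j := Ordinal jn; have ji : j = i.+2 :> nat by [].
rewrite addr0 (mulmx_shift2 _ ji) (colE' _ ('J f p *m col j A)); last by rewrite (H1 j i).
by rewrite mulmxA mulmx_col [RHS]mxE eqxx mulr1n.
Qed.

End AdaptedChart.

(** * Spans of coordinate fields as common kernels *)

Section CoordinateSpan.
Context {R : realType} {c : scalar_kind} {n : nat}.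
Local Notation K := (scalars R c).

(** The columns of [M] are the differentials dz_i at p, dual to the coordinate fields; a span of
    some fields is the common kernel of the remaining differentials. Fields count from 1, columns
    from 0. *)
Lemma coordinate_spanP (z x : 'rV[K]_n -> 'rV[K]_n) (M : 'M[K]_n) p a b :
  'J z p = M -> (forall v, 'd x (z p) ('d z p v) = v) -> (forall v, 'd z p ('d x (z p) v) = v) ->
  forall v, coordinate_span z x a b p v <->
    forall i : 'I_n, ~~ (a <= i.+1 <= b)%N -> v *m col i M = 0.
Proof.
move=> EM xz zx v.
have cf_mul j (i : 'I_n) : (coordinate_field z x j p *m M) 0 i = (i.+1 == j)%:R.
  by rewrite /coordinate_field -EM jacobian_mulE zx mxE.
have col0 (w : 'rV[K]_n) i : w *m col i M = 0 <-> (w *m M) 0 i = 0.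
  rewrite mulmx_col; split=> [/matrixP/(_ 0 0)|->]; last by rewrite raddf0.
  by rewrite !mxE eqxx mulr1n.
rewrite /coordinate_span /=; split=> [Hv i iab|H].
  apply/col0; have -> := coord_span (X := in_tuple _) Hv.
  rewrite mulmx_suml summxE big1 // => l _; rewrite -scalemxAl mxE.
  have [j] : exists2 j, j \in index_iota a b.+1 &
      (in_tuple [seq coordinate_field z x j p | j <- index_iota a b.+1])`_l = coordinate_field z x j p.
    by apply/mapP; apply: mem_nth.
  rewrite mem_index_iota ltnS => jab ->; rewrite cf_mul.
  by case: eqP iab => [->|_]; rewrite ?jab ?mulr0.
have -> : v = \sum_(i < n) (v *m M) 0 i *: coordinate_field z x i.+1 p.
  have E : 'd x (z p) (v *m M) = v by rewrite -EM jacobian_mulE xz.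
  have gen (g : {linear 'rV[K]_n -> 'rV[K]_n}) (y : 'rV[K]_n) :
      g y = \sum_(i < n) y 0 i *: g (basis_vector n i.+1).
    rewrite {1}[y]row_sum_delta linear_sum; apply: eq_bigr => i _; rewrite linearZ /=.
    by congr (_ *: g _); apply/rowP => l; rewrite !mxE eqSS.
  by rewrite -[LHS]E; apply: gen.
apply: memv_suml => i _; case: (boolP (a <= i.+1 <= b)%N) => iab.
  by apply: memvZ; apply: memv_span; apply/map_f; rewrite mem_index_iota ltnS.
by rewrite (col0 _ _).1 ?scale0r ?mem0v //; apply: H.
Qed.

End CoordinateSpan.

(** * Assembly of the chart and the affine map *)

Theorem lemma3p1 (R : realType) (c : scalar_kind) (n k : nat)
    (U : set 'rV[scalars R c]_n)
    (f : 'rV[scalars R c]_n -> 'rV[scalars R c]_(n + 1))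
    (p : 'rV[scalars R c]_n) :
  (1 <= k <= n)%N ->
  is_domain U ->
  is_front U f ->
  U p ->
  k_nondegenerate U f k p ->
  exists (V : set 'rV[scalars R c]_n)
         (z x : 'rV[scalars R c]_n -> 'rV[scalars R c]_n)
         (Theta : 'rV[scalars R c]_(n + 1) -> 'rV[scalars R c]_(n + 1)),
    let W := z @` V in
    let fhat := fun w => Theta (f (x w)) in
    [/\ V `<=` U, coordinate_system V p z x & affine_transformation Theta] /\
    (* P_0 *)
    z p = 0 /\
    (* P_1 *)
    extended_null_field U f V (coordinate_field z x n) /\
    (* P_2 *)
    (forall i, (1 <= i < k)%N ->
       tangent_space (singular_set U f i) p = coordinate_span z x i.+1 n p) /\
    (* P_3 *)
    ((k < n)%N ->
       (singular_set U f k.+1 p ->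
          tangent_space (singular_set U f k) p = coordinate_span z x k.+1 n p) /\
       (~ singular_set U f k.+1 p ->
          tangent_space (singular_set U f k) p = coordinate_span z x k n.-1 p)) /\
    (* P_4 *)
    (fhat 0 = 0 /\
     exists nu, normal_field W fhat nu /\ nu 0 = basis_vector (n + 1) 1) /\
    (* P_5 *)
    (forall w, W w -> forall (i : 'I_n) (j : 'I_(n + 1)),
       j = i.+2 :> nat -> fhat w 0 j = w 0 i) /\
    (* P_6 *)
    (forall (i : nat) (j : 'I_(n + 1)), (1 <= i < n)%N -> (j < 2)%N ->
       'd (fun w => fhat w 0 j : (scalars R c)^o) 0 (basis_vector n i) = 0).
Proof.
move=> /andP[k0 kn] _ front _ nondeg.
have [N [nu [u [a [vs [[oN Np NU] [[smf smnu [_ Hnu]] [[rJ u0 uJ] [Tp [ua [Sk Hvs]]]]]]]]]]] :=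
  nondegenerate_front_data k0 front nondeg.
have [M [b [[uM Mb uMi Ma] [Ma0 Ma1]]]] := adapted_basis k0 u0 ua Hvs.
have [nup orthp _] := Hnu p Np.
have Jnu : 'J f p *m (nu p)^T = 0.
  apply/row_matrixP => i; rewrite row_mul row0; apply/matrixP => s t.
  by rewrite !ord1 -KdotE rowE jacobian_mulE orthp mxE.
have [A [uA A0 A1 A2]] := adapted_frame (addn1 n) rJ u0 uJ nup Jnu uM uMi.
pose z := adapted_chart f p A b.
have smz : smooth N z by apply: smooth_adapted_chart.
have Jz : 'J z p = M.
  by apply: (jacobian_adapted_chart smf Np) => // j i il ji; apply: A2.
have uJz : 'J z p \in unitmx by rewrite Jz.
have [V [x [[oV Vp VN oW] [smx xK]]]] :=
  inverse_function (@archimedean_scalarsP R c) (@seq_complete_scalars R c) oN Np smz uJz.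
have smzV : smooth V z by move=> r; apply: Ck_sub VN (smz r).
have dxz q v : V q -> 'd x (z q) ('d z q v) = v.
  by move=> Vq; exact: (inverse_diff_cancel v oV Vq oW smzV smx xK).
have dzx q v : V q -> 'd z q ('d x (z q) v) = v.
  by move=> Vq; exact: (inverse_diff_cancel_r v oV Vq oW smzV smx xK).
have z0 : z p = 0 by apply: adapted_chart0.
pose Theta (y : 'rV[scalars R c]_(n + 1)) := y *m A - f p *m A.
pose W := z @` V; pose fhat w := Theta (f (x w)).
have xW w : W w -> N (x w) by move=> [q Vq <-]; rewrite xK //; apply: VN.
have smfx : smooth W (fun w => f (x w)) by move=> r; apply: (Ck_comp (D' := N)).
have smfhat : smooth W fhat by apply: smooth_sub_cst => //; apply: smooth_mulmxr.
have dcomp m (g : 'rV[scalars R c]_n -> 'rV[scalars R c]_m) (B : 'M[scalars R c]_m)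
    (e : 'rV[scalars R c]_m) q v : V q -> smooth N g ->
    'd (fun w => g (x w) *m B - e) (z q) v = 'd g q ('d x (z q) v) *m B.
  move=> Vq smg; have Wq : W (z q) by exists q.
  have dg : is_diff (x (z q)) g ('d g q) by rewrite xK //; apply: smooth_diff smg (VN q Vq).
  have dgx := is_diff_comp (smooth_diff smx Wq) dg.
  have H := is_diffB (is_diff_mulmxr B dgx) (is_diff_cst e (z q)).
  have := congr1 (fun h => h v) (diff_val (is_diff_def := H)) => E.
  by apply: etrans E _; rewrite /= subr0.
have dfhat q v : V q -> 'd fhat (z q) v = 'd f q ('d x (z q) v) *m A.
  by move=> Vq; exact: (dcomp _ f A (f p *m A) q v Vq smf).
have spanP i j v : coordinate_span z x i j p v <->
    forall l : 'I_n, ~~ (i <= l.+1 <= j)%N -> v *m col l M = 0.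
  by apply: coordinate_spanP => // {}v; [apply: dxz|apply: dzx].
have tangent_span i : (i <= k)%N -> (forall l : 'I_n, (l < i)%N -> col l M = a l) ->
    tangent_space (singular_set U f i) p = coordinate_span z x i.+1 n p.
  move=> ik Mi; apply/funext => v; apply/propext; rewrite spanP.
  split=> [/Tp H l|H]; first by rewrite ltn_ord andbT -ltnNge ltnS => li; rewrite Mi // H.
  apply/Tp => // l li; have ln : (l < n)%N by apply: leq_trans li (leq_trans ik kn).
  by rewrite -(Mi (Ordinal ln)) // H // ltn_ord andbT -ltnNge ltnS.
have n0 : (0 < n)%N by apply: leq_trans kn.
exists V, z, x, Theta; rewrite -/W; split.
  split; first by move=> q /VN/NU.
    split; [by split|split=> //; exact: smooth_Kdifferentiable].
  by exists A, (- (f p *m A)).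
split; first exact: z0.
split.
  split.
    apply: smooth_Kdifferentiable => r.
    apply: (Ck_comp (D' := W) (g := fun w => 'd x w (basis_vector n n))) => //.
      by move=> q Vq; exists q.
    by apply: Ck_deriv; apply: smx.
  move=> q Vq [_ /singular_null_vector[w w0 dw]].
  (* All coordinates but the last factor through f, so dz(w) sees only b(w). *)
  have wE : w = (w *m b) 0 0 *: coordinate_field z x n q.
    have dz : 'd z q w = (w *m b) 0 0 *: basis_vector n n.
      by rewrite (diff_adapted_chart p A b smf w (VN q Vq)) dw !mul0mx add0r [w *m b in LHS]mx11_scalar mul_scalar_mx.
    have dxZ s (e : 'rV[scalars R c]_n) : 'd x (z q) (s *: e) = s *: 'd x (z q) e.
      by rewrite -!jacobian_mulE scalemxAl.
    exact: (etrans (esym (dxz q w Vq)) (etrans (congr1 ('d x (z q)) dz) (dxZ _ _))).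
  split; first by apply: contraNneq w0 => E; rewrite wE E scaler0.
  have /eqP := dw; rewrite wE linearZ /= scaler_eq0 => /orP[/eqP E|/eqP //].
  by case/negP: w0; rewrite wE E scale0r.
split.
  by move=> i /andP[_ ik]; apply: tangent_span => [|l li]; [exact: ltnW|apply/Ma/(leq_ltn_trans li)].
split.
  move=> ltkn; split=> [/Sk E|nS]; first by apply: tangent_span => // l lk; apply: Ma0.
  (* Here the last coordinate differential is a multiple of a_(k-1), which replaces the k-th
     coordinate in the description of the tangent space. *)
  have [|t t0 bE] := Ma1; first by apply/eqP => E; apply: nS; apply/Sk.
  apply/funext => v; apply/propext; rewrite spanP; split=> [/Tp H l|H].
    rewrite negb_and -!ltnNge => /orP[lk|ln].
      by rewrite Ma // H // ltnW.
    rewrite Mb; last by apply/eqP; rewrite eqn_leq -ltnS prednK // ltn_ord -ltnS.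
    by rewrite bE -scalemxAr H ?scaler0 // prednK.
  apply/Tp => // l lk; have := lk; rewrite leq_eqVlt => /predU1P[E|lk1].
    have ln : (n.-1 < n)%N by rewrite prednK.
    have := H (Ordinal ln); rewrite /= negb_and -!ltnNge ltnSn orbT => /(_ isT).
    rewrite Mb // bE -scalemxAr -E /= => /eqP.
    by rewrite scaler_eq0 (negbTE t0) => /eqP.
  have ln : (l < n)%N by apply: ltn_trans lk ltkn.
  by rewrite -(Ma (Ordinal ln)) // H //= negb_and -ltnNge lk1.
split.
  split; first by rewrite -z0 xK // /Theta subrr.
  (* Normals transform by the inverse transpose, which preserves their pairing with the image of
     df. *)
  pose nuhat w := nu (x w) *m (invmx A)^T.
  have smnuhat : smooth W nuhat.
    by apply: smooth_mulmxr => // r; apply: (Ck_comp (D' := N)).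
  have dnuhat q v : V q -> 'd nuhat (z q) v = 'd nu q ('d x (z q) v) *m (invmx A)^T.
    move=> Vq; have -> : nuhat = (fun w => nu (x w) *m (invmx A)^T - 0).
      by apply/funext => w; rewrite subr0.
    exact: (dcomp _ nu (invmx A)^T 0 q v Vq smnu).
  have uAT : (invmx A)^T \in unitmx by rewrite unitmx_tr unitmx_inv.
  exists nuhat; split; last first.
    have j0n : (0 < n + 1)%N by rewrite addn1.
    (* The first column of [A] is the transpose of nu(p), so multiplying it by the inverse of [A]
       gives the first basis vector. *)
    rewrite /nuhat -z0 xK // -[nu p]trmxK -(A0 (Ordinal j0n)) // -trmx_mul colE mulKmx //.
    by apply/rowP => j; rewrite !mxE eqSS andbT.
  split; first exact: smooth_Kdifferentiable.
  move=> w [q Vq <-]; have [nuq orth imm] := Hnu q (VN q Vq).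
  split.
  - by rewrite /nuhat xK //; apply: contraNneq nuq => E; rewrite -[nu q](mulmxK uAT) E mul0mx.
  - move=> v; rewrite dfhat // KdotE /nuhat xK // trmx_mul trmxK mulmxA mulmxK // -KdotE.
    exact: orth.
  have Wq : W (z q) by exists q.
  apply: (kernel_projective_immersion oW Wq smfhat smnuhat) => v s.
  have nuz : nuhat (z q) = nu q *m (invmx A)^T by rewrite /nuhat xK.
  have A_inj (y : 'rV[scalars R c]_(n + 1)) : y *m A = 0 -> y = 0.
    by move=> E; rewrite -[y](mulmxK uA) E mul0mx.
  have AT_inj (y y' : 'rV[scalars R c]_(n + 1)) :
      y *m (invmx A)^T = s *: (y' *m (invmx A)^T) -> y = s *: y'.
    by move=> E; rewrite -[y](mulmxK uAT) E -scalemxAl mulmxK.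
  move=> /(etrans (esym (dfhat q v Vq)))/A_inj E1 /(etrans (esym (dnuhat q v Vq))).
  rewrite nuz => /AT_inj E2.
  have E := projective_immersion_kernel oN (VN q Vq) smf smnu nuq imm E1 E2.
  exact: (etrans (esym (dzx q v Vq)) (etrans (congr1 ('d z q) E) (linear0 _))).
split.
  move=> w [q Vq <-] i j ji; rewrite xK // /Theta -mulmxBl.
  by rewrite /z (adapted_chartE _ _ _ _ _ ji).
(* The first two columns of [A] are killed by the Jacobian of f at p, so the first two components of
   [fhat] have zero differential at 0. *)
move=> i j _ j2.
have Wp : W (z p) by exists p.
have H := is_diff_coord j (smooth_diff smfhat Wp); rewrite -z0 (diff_val (is_diff_def := H)).
rewrite dfhat // -jacobian_mulE -mulmxA.
have -> (y : 'rV_n) : (y *m ('J f p *m A)) 0 j = (y *m ('J f p *m col j A)) 0 0.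
  by rewrite !mulmxA mulmx_col [RHS]mxE eqxx mulr1n.
by rewrite A1 // mulmx0 mxE.
Qed.
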